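(* Suppose that either (i) $p>0$ and $k=\infty$, or (ii) $p>0$, $\frac4p\notin\mathbb{N}$ and $k\in\mathbb{N}\cup\{\infty\}$ satisfies $k>3+\frac4p$. Let $\sigma:\mathbb{R}\to\mathbb{R}$ be a $C^k$ function with $\sup_{x\in\mathbb{R}}|\sigma'(x)|<1$ (so that $\Sigma=\{(t,x):t=\sigma(x)\}$ is a $C^k$ uniformly space-like hypersurface). Set $m=\lfloor k-3-\frac4p\rfloor$ (with $m=\infty$ if $k=\infty$). Then there exist a nearby space-like hypersurface $\Sigma_0=\{(t,x): t=\sigma_0(x)\}$ with $\sigma_0(x)<\sigma(x)$ for all $x\in\mathbb{R}$, and a solution $u\in C^m_{t,x}(\{(t,x):\sigma_0(x)\le t<\sigma(x)\})$ to $$u_{tt}-u_{xx}-\tfrac{2(p+2)}{p^2}|u|^pu=0$$ that blows up on $\Sigma$ in the sense that $$\lim_{t\nearrow\sigma(x)}\bigl(\sigma(x)-t\bigr)^{\frac2p}u(t,x)=\bigl(1-|\sigma'(x)|^2\bigr)^{\frac1p}\qquad\text{for all }x\in\mathbb{R}.$$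
   Context: All functions are real-valued, with $(t,x)\in\mathbb{R}\times\mathbb{R}$ (one space dimension). $\lfloor x\rfloor$ is the greatest integer less than or equal to $x$. A hypersurface $\{t=\sigma_0(x)\}$ is called space-like if it is everywhere non-characteristic, i.e. $\limsup_{y\to x}\frac{|\sigma_0(x)-\sigma_0(y)|}{|x-y|}<1$ for every $x\in\mathbb{R}$. The word ''nearby'' is informal and imposes no quantitative condition. When $m<2$, ''solution'' is understood in the sense of distributions. In the limit, $x$ is held fixed. *)

(* Defs.v *)
From Stdlib Require Import Reals ZArith.
From Coquelicot Require Import Coquelicot.

Open Scope R_scope.

(* Regularity exponents live in N ∪ {∞}; [None] stands for ∞. *)
Definition le_ext (n : nat) (k : option nat) : Prop :=
  match k with Some k => (n <= k)%nat | None => True end.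

Definition lt_ext (r : R) (k : option nat) : Prop :=
  match k with Some k => r < INR k | None => True end.

(* [Int_part] is the floor function on R.  [Z.to_nat] loses nothing when
   3 + 4/p < k, since the floor is then nonnegative. *)
Definition regularity_exponent (p : R) (k : option nat) : option nat :=
  match k with
  | Some k => Some (Z.to_nat (Int_part (INR k - 3 - 4 / p)))
  | None => None
  end.

Definition is_C (k : option nat) (f : R -> R) : Prop :=
  forall (n : nat) (x : R), le_ext n k ->
    ex_derive_n f n x /\ continuous (Derive_n f n) x.

(* Points of R * R are pairs (t, x). *)

(* C^m up to the part of the boundary contained in S: u is the restriction to S
   of a function of class C^m on an open neighbourhood of S.  As functions are
   total here, u itself plays the role of this extension, so that the partial
   derivatives of u are meaningful at every point of S. *)
Definition is_C_on (m : option nat) (S : R * R -> Prop) (u : R -> R -> R) : Prop :=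
  exists U : R * R -> Prop,
    open U /\
    (forall z, S z -> U z) /\
    (forall (n : nat) (t x : R), le_ext n m -> U (t, x) -> ex_diff_n u n t x).

Definition limsup_at (f : R -> R) (x : R) : Rbar :=
  Rbar_glb (fun s => exists d : posreal,
    s = Lub_Rbar (fun q => exists y, y <> x /\ Rabs (y - x) < d /\ q = f y)).

Definition space_like (s : R -> R) : Prop :=
  forall x, Rbar_lt (limsup_at (fun y => Rabs (s x - s y) / Rabs (x - y)) x) 1.

Definition sup_abs_derivative (s : R -> R) : Rbar :=
  Lub_Rbar (fun q => exists x, q = Rabs (Derive s x)).

Definition region (s0 s : R -> R) (z : R * R) : Prop :=
  s0 (snd z) <= fst z < s (snd z).

Definition open_region (s0 s : R -> R) (z : R * R) : Prop :=
  s0 (snd z) < fst z < s (snd z).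

(* For v = 0 the factor [Rpower (Rabs v) p] takes the value 1 instead of 0,
   but the product with v is 0, as it should be. *)
Definition nonlinearity (p v : R) : R :=
  2 * (p + 2) / p ^ 2 * (Rpower (Rabs v) p * v).

Definition classical_solution (p : R) (S : R * R -> Prop) (u : R -> R -> R) : Prop :=
  forall t x, S (t, x) ->
    partial_derive 2 0 u t x - partial_derive 0 2 u t x
      - nonlinearity p (u t x) = 0.

(* Compact subsets of the plane are given as closed bounded sets. *)
Definition test_function (O : R * R -> Prop) (phi : R -> R -> R) : Prop :=
  (forall (n : nat) (t x : R), ex_diff_n phi n t x) /\
  exists K : R * R -> Prop,
    closed K /\
    (exists M, forall t x, K (t, x) -> Rabs t <= M /\ Rabs x <= M) /\
    (forall z, K z -> O z) /\
    (forall t x, ~ K (t, x) -> phi t x = 0).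

(* The integral over the plane is an iterated integral over any square outside
   of which phi vanishes.  It is used for u continuous on O; the integrand is
   then continuous and compactly supported. *)
Definition distributional_solution (p : R) (O : R * R -> Prop)
    (u : R -> R -> R) : Prop :=
  forall (phi : R -> R -> R) (M : R),
    test_function O phi ->
    (forall t x, phi t x <> 0 -> Rabs t <= M /\ Rabs x <= M) ->
    is_RInt (fun x => RInt (fun t =>
        u t x * (partial_derive 2 0 phi t x - partial_derive 0 2 phi t x)
          - nonlinearity p (u t x) * phi t x) (- M) M) (- M) M 0.

(* A solution of u_tt - u_xx - 2(p+2)/p^2 |u|^p u = 0, of class C^m, on
   {s0(x) <= t < s(x)}: in the sense of distributions, hence on the interior
   of that set, when m < 2, and pointwise otherwise. *)
Definition is_solution (p : R) (m : option nat) (s0 s : R -> R)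
    (u : R -> R -> R) : Prop :=
  match m with
  | Some 0%nat | Some 1%nat => distributional_solution p (open_region s0 s) u
  | _ => classical_solution p (region s0 s) u
  end.

Definition blows_up_on (p : R) (s : R -> R) (u : R -> R -> R) : Prop :=
  forall x,
    filterlim (fun t => Rpower (s x - t) (2 / p) * u t x)
      (at_left (s x))
      (locally (Rpower (1 - Rabs (Derive s x) ^ 2) (1 / p))).

(* Main.v *)
Require Import Defs.
From Stdlib Require Import Reals ZArith Lra Lia ClassicalEpsilon FunctionalExtensionality.
From Coquelicot Require Import Coquelicot.
Open Scope R_scope.

(** Since the slope of sigma is bounded away from 1 in absolute value, the maps
    x |-> x + sigma x and x |-> x - sigma x are bijections of the line, and
    psi := (x + sigma) o (x - sigma)^-1 is increasing.  In the coordinates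
    d = psi (x - t) - (t + x) and b = psi (x - t) the blow-up surface becomes the
    line d = 0, the past of the surface is d > 0, and for positive u = v (d, b)
    the wave equation becomes
      v_dd + v_db = a (a + 1) W(b)^(1 - q) v^q,   a = 2 / p,  q = p + 1,
    where W is determined by the derivatives of sigma.  As a q = a + 2, the
    function W(b) d^(-a) solves this equation up to the term v_db, and its
    coefficient W is what the prescribed blow-up rate demands.  So the task is to
    find a solution asymptotic to W(b) d^(-a), in two stages.

    Approximate solutions.  The correction z = v - W d^(-a) has to satisfy
      z_dd - (a + 1) (a + 2) d^-2 z = - v_db + (quadratic and higher terms in z).
    The operator on the left only involves d and is inverted by variation of
    parameters (euler_inv): it turns O(d^(s - 2)) into O(d^s) as long as s stays
    strictly between the exponents of the homogeneous solutions d^(- a - 1) and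
    d^(a + 2).  Iterating gains a factor d^gam each time, for some 0 < gam <= 1, at
    the cost of one b-derivative of W (corrections_induct).  The iteration runs
    through the exponents j gam - a for j = 1, ..., N and stops when the next one,
    s = (N + 1) gam - a, is larger than a + 2.  It must step over a + 2, where the
    inverse would create a logarithm; with gam = 1 this is the condition that 4 / p
    is not an integer, and when sigma is smooth one takes gam smaller and pays with
    more steps (gain_exponent).

    Exact solution.  The remainder w solves w_dd + w_db = nonlin w with
    w = O(d^s), i.e. w is the double integral duhamel of nonlin w, first along
    b - d = constant and then in d.  This double integral divides the coefficient
    of d^(s - 2) by s (s - 1), while the linear part of nonlin is about
    (a + 1) (a + 2) d^-2 w.  Because s > a + 2 makes s (s - 1) > (a + 1) (a + 2),
    Picard iteration contracts in a thin layer 0 < d < rho(b) (lin_base), without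
    any smallness of the data.  Differentiating in b gives linear recursions with
    the same contraction factor (lin_class), hence b-derivatives; the remaining
    derivatives come from the equation itself (full_regularity).  If rho is
    1-Lipschitz, the layer contains the backward characteristics of its points,
    so everything stays inside it (layer_solution).

    Back in the original variables, the equation enters only through the second
    difference cross u h t x = u(t + h, x) + u(t - h, x) - u(t, x + h) - u(t, x - h),
    which by the mean value theorem in the two null variables equals h^2 times the
    nonlinearity at a nearby point (cross_wave).  This needs no second derivative
    of u.  It gives the classical equation when u is C^2 (classical_of_cross), and
    the weak one otherwise (distributional_of_cross), because cross is symmetric
    under the integral against a test function. *)

(** * Classes of functions with controlled derivatives *)

Definition open2 (D : R -> R -> Prop) : Prop :=
  forall d b, D d b -> locally_2d D d b.

(** Sequences of functions of (d, b): the iterates of a scheme are treated as one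
    object, so that a single argument bounds all of them uniformly. *)
Definition seqfun := nat -> R -> R -> R.

Definition deriv_b (D : R -> R -> Prop) (h h' : seqfun) : Prop :=
  forall n d b, D d b -> is_derive (fun y => h n d y) b (h' n d b).

Definition deriv_d (D : R -> R -> Prop) (h h' : seqfun) : Prop :=
  forall n d b, D d b -> is_derive (fun y => h n y b) d (h' n d b).

(** The C^M functions over a base class B.  Derivatives are existentially quantified
    and only constrained on D, so membership can be transported between domains
    and proved by exhibiting a derivative, without a total derivative operator.  The parameters r and s of B record a
    geometric rate in the index of the sequence and a power of d; they are the
    same for all derivatives because only b-derivatives are taken when s matters. *)
Fixpoint Ck (full : bool) (D : R -> R -> Prop) (B : R -> R -> seqfun -> Prop)
    (M : nat) (r s : R) (h : seqfun) : Prop :=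
  B r s h /\
  match M with
  | O => True
  | S M' =>
      (exists h', deriv_b D h h' /\ Ck full D B M' r s h') /\
      (full = true -> exists h', deriv_d D h h' /\ Ck full D B M' r s h')
  end.

(** What a base class has to satisfy for the Leibniz rule to work inside Ck:
    rates multiply and exponents add. *)
Record graded (D : R -> R -> Prop) (B : R -> R -> seqfun -> Prop) : Prop := {
  graded_open : open2 D;
  graded_plus : forall r s h k, B r s h -> B r s k ->
    B r s (fun n d b => h n d b + k n d b);
  graded_mult : forall r1 r2 s1 s2 h k, B r1 s1 h -> B r2 s2 k ->
    B (r1 * r2) (s1 + s2) (fun n d b => h n d b * k n d b);
  graded_ext : forall r s h k, (forall n d b, D d b -> h n d b = k n d b) ->
    B r s h -> B r s k;
  graded_const : forall c, B 1 0 (fun _ _ _ => c) }.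

Lemma open2_slice_b D d b : open2 D -> D d b -> locally b (fun y => D d y).
Proof. intros HD H. apply locally_2d_1d_const_x. now apply HD. Qed.

Lemma open2_slice_d D d b : open2 D -> D d b -> locally d (fun y => D y b).
Proof. intros HD H. apply locally_2d_1d_const_y. now apply HD. Qed.

Lemma deriv_b_ext D h k h' k' : open2 D ->
  (forall n d b, D d b -> h n d b = k n d b) ->
  (forall n d b, D d b -> h' n d b = k' n d b) ->
  deriv_b D h h' -> deriv_b D k k'.
Proof.
  intros HD E E' H n d b Hd. rewrite <- E' by easy.
  apply (is_derive_ext_loc (fun y => h n d y)).
  - generalize (open2_slice_b D d b HD Hd). apply filter_imp. intros y Hy. now apply E.
  - now apply H.
Qed.

Lemma deriv_d_ext D h k h' k' : open2 D ->
  (forall n d b, D d b -> h n d b = k n d b) ->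
  (forall n d b, D d b -> h' n d b = k' n d b) ->
  deriv_d D h h' -> deriv_d D k k'.
Proof.
  intros HD E E' H n d b Hd. rewrite <- E' by easy.
  apply (is_derive_ext_loc (fun y => h n y b)).
  - generalize (open2_slice_d D d b HD Hd). apply filter_imp. intros y Hy. now apply E.
  - now apply H.
Qed.

(** The next lemmas fix the normed module to R, where the general rules leave
    goals about abstract operations. *)
Lemma is_derive_plus_R (f g : R -> R) (x l k : R) : is_derive f x l -> is_derive g x k ->
  is_derive (fun y => f y + g y) x (l + k).
Proof. intros H K. now apply @is_derive_plus. Qed.

Lemma is_derive_minus_R (f g : R -> R) (x l k : R) : is_derive f x l -> is_derive g x k ->
  is_derive (fun y => f y - g y) x (l - k).
Proof. intros H K. now apply @is_derive_minus. Qed.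

Lemma is_derive_mult_R (f g : R -> R) (x l k : R) : is_derive f x l -> is_derive g x k ->
  is_derive (fun y => f y * g y) x (l * g x + f x * k).
Proof. intros H K. apply (is_derive_mult f g); [easy|easy|]. intros; apply Rmult_comm. Qed.

Lemma is_derive_const_R (c x : R) : is_derive (fun _ : R => c) x 0.
Proof. apply @is_derive_const. Qed.

Lemma is_derive_ext_R (f g : R -> R) (x l : R) : (forall y, f y = g y) ->
  is_derive f x l -> is_derive g x l.
Proof. apply @is_derive_ext. Qed.

Lemma is_derive_val (f : R -> R) (x l l' : R) : is_derive f x l -> l = l' -> is_derive f x l'.
Proof. now intros H <-. Qed.

Section Algebra.
Variables (full : bool) (D : R -> R -> Prop) (B : R -> R -> seqfun -> Prop).
Hypothesis HB : graded D B.
Notation C := (Ck full D B).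

Lemma Ck_base M r s h : C M r s h -> B r s h.
Proof. destruct M; simpl; tauto. Qed.

Lemma Ck_ext M : forall r s h k, (forall n d b, D d b -> h n d b = k n d b) ->
  C M r s h -> C M r s k.
Proof.
  destruct M as [|M]; intros r s h k E [H0 H].
  - split; [|easy]. now apply (graded_ext D B HB r s h).
  - destruct H as [[h1 [Hb H1]] H2].
    split; [now apply (graded_ext D B HB r s h)|]. split.
    + exists h1. split; [|easy].
      apply (deriv_b_ext D h k h1 h1); auto. apply HB.
    + intros F. destruct (H2 F) as [h2 [Hd H3]]. exists h2. split; [|easy].
      apply (deriv_d_ext D h k h2 h2); auto. apply HB.
Qed.

Lemma Ck_pred M : forall r s h, C (S M) r s h -> C M r s h.
Proof.
  induction M as [|M IH]; intros r s h [H0 [[h1 [Hb H1]] H2]].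
  - now split.
  - split; [easy|]. split.
    + exists h1. split; [easy|]. now apply IH.
    + intros F. destruct (H2 F) as [h2 [Hd H3]]. exists h2. split; [easy|]. now apply IH.
Qed.

Lemma Ck_le M' M r s h : (M' <= M)%nat -> C M r s h -> C M' r s h.
Proof.
  intros L. induction L as [|M L IH]; [easy|]. intros H. apply IH. now apply Ck_pred.
Qed.

Lemma Ck_plus M : forall r s h k, C M r s h -> C M r s k ->
  C M r s (fun n d b => h n d b + k n d b).
Proof.
  induction M as [|M IH]; intros r s h k [H0 H] [K0 K].
  - split; [|easy]. now apply HB.
  - destruct H as [[h1 [Hb H1]] H2], K as [[k1 [Kb K1]] K2].
    split; [now apply HB|]. split.
    + eexists. split; [|apply (IH r s h1 k1); easy].
      intros n d b Hd. apply is_derive_plus_R; auto.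
    + intros F. destruct (H2 F) as [h2 [Hd H3]]. destruct (K2 F) as [k2 [Kd K3]].
      eexists. split; [|apply (IH r s h2 k2); easy].
      intros n d b Hdb. apply is_derive_plus_R; auto.
Qed.

(** By the product rule; the derivative of a product is again a sum of products
    of functions with one derivative less. *)
Lemma Ck_mult M : forall r1 r2 s1 s2 h k, C M r1 s1 h -> C M r2 s2 k ->
  C M (r1 * r2) (s1 + s2) (fun n d b => h n d b * k n d b).
Proof.
  induction M as [|M IH]; intros r1 r2 s1 s2 h k H K.
  - destruct H as [H _], K as [K _]. split; [|easy]. now apply HB.
  - pose proof (Ck_pred _ _ _ _ H) as Hp. pose proof (Ck_pred _ _ _ _ K) as Kp.
    destruct H as [H0 [[h1 [Hb H1]] H2]], K as [K0 [[k1 [Kb K1]] K2]].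
    split; [now apply HB|]. split.
    + eexists. split; [|apply Ck_plus; [apply (IH r1 r2 s1 s2 h1 k)|apply (IH r1 r2 s1 s2 h k1)]; easy].
      intros n d b Hd. apply (is_derive_mult_R (fun y => h n d y) (fun y => k n d y)); auto.
    + intros F. destruct (H2 F) as [h2 [Hd H3]]. destruct (K2 F) as [k2 [Kd K3]].
      eexists. split; [|apply Ck_plus; [apply (IH r1 r2 s1 s2 h2 k)|apply (IH r1 r2 s1 s2 h k2)]; easy].
      intros n d b Hdb. apply (is_derive_mult_R (fun y => h n y b) (fun y => k n y b)); auto.
Qed.

Lemma Ck_const M c : C M 1 0 (fun _ _ _ => c).
Proof.
  revert c. induction M as [|M IH]; intros c.
  - split; [|easy]. apply HB.
  - split; [apply HB|]. split.
    + exists (fun _ _ _ => 0). split; [|apply IH]. intros n d b _. apply is_derive_const_R.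
    + intros _. exists (fun _ _ _ => 0). split; [|apply IH]. intros n d b _. apply is_derive_const_R.
Qed.

Lemma Ck_scal M c r s h : C M r s h -> C M r s (fun n d b => c * h n d b).
Proof.
  intros H. replace r with (1 * r) by ring. replace s with (0 + s) by ring.
  apply (Ck_mult M 1 r 0 s (fun _ _ _ => c) h); [apply Ck_const|easy].
Qed.

Lemma Ck_minus M r s h k : C M r s h -> C M r s k ->
  C M r s (fun n d b => h n d b - k n d b).
Proof.
  intros H K. apply (Ck_ext M r s (fun n d b => h n d b + (-1) * k n d b)).
  - intros; ring.
  - apply Ck_plus; [easy|]. now apply Ck_scal.
Qed.

Lemma Ck_mult_eq M r1 r2 r s1 s2 s h k : C M r1 s1 h -> C M r2 s2 k ->
  r = r1 * r2 -> s = s1 + s2 -> C M r s (fun n d b => h n d b * k n d b).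
Proof. intros H K -> ->. now apply Ck_mult. Qed.

Lemma is_derive_Rpower_comp (f : R -> R) (x l q : R) : 0 < f x -> is_derive f x l ->
  is_derive (fun y => Rpower (f y) q) x (q * (Rpower (f x) (q - 1) * l)).
Proof.
  intros Hf Hd.
  replace (q * (Rpower (f x) (q - 1) * l)) with (l * (q * Rpower (f x) (q - 1))) by ring.
  apply (is_derive_comp (fun z => Rpower z q) f x).
  - apply is_derive_Reals. now apply derivable_pt_lim_power.
  - easy.
Qed.

(** Induction over all exponents at once, as the derivative of h^q involves
    h^(q - 1). *)
Lemma Ck_power M : forall q h, (forall n d b, D d b -> 0 < h n d b) ->
  (forall q', B 1 0 (fun n d b => Rpower (h n d b) q')) ->
  C M 1 0 h -> C M 1 0 (fun n d b => Rpower (h n d b) q).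
Proof.
  induction M as [|M IH]; intros q h Hpos Hbase H.
  - split; [apply Hbase|easy].
  - pose proof (Ck_pred _ _ _ _ H) as Hp.
    destruct H as [H0 [[h1 [Hb H1]] H2]].
    split; [apply Hbase|]. split.
    + eexists. split; [|apply (Ck_scal M q);
        apply (Ck_mult_eq M 1 1 1 0 0 0 (fun n d b => Rpower (h n d b) (q - 1)) h1);
        [now apply IH|easy|ring|ring]].
      intros n d b Hd. apply is_derive_Rpower_comp; auto.
    + intros F. destruct (H2 F) as [h2 [Hd H3]].
      eexists. split; [|apply (Ck_scal M q);
        apply (Ck_mult_eq M 1 1 1 0 0 0 (fun n d b => Rpower (h n d b) (q - 1)) h2);
        [now apply IH|easy|ring|ring]].
      intros n d b Hdb. apply (is_derive_Rpower_comp (fun y => h n y b)); auto.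
Qed.

End Algebra.

(** * Weighted bounds *)

Definition cont_class (D : R -> R -> Prop) (r s : R) (h : seqfun) : Prop :=
  forall n d b, D d b -> continuity_2d_pt (h n) d b.

(** Bounds K r^n d^s are uniform on the triangles - L <= b - d, b <= L, and not on
    the strips |b| <= L: a backward characteristic b - d = constant starting in
    such a triangle stays in it. *)
Definition weighted (D : R -> R -> Prop) (r s : R) (h : seqfun) : Prop :=
  (forall n d b, D d b -> continuity_2d_pt (h n) d b) /\
  forall L, exists K, forall n d b, D d b -> d <= 1 -> - L <= b - d -> b <= L ->
    Rabs (h n d b) <= K * r ^ n * Rpower d s.

Lemma Rpower_pos x y : 0 < Rpower x y.
Proof. apply exp_pos. Qed.

Lemma Rpower_zero x : Rpower x 0 = 1.
Proof. unfold Rpower. rewrite Rmult_0_l. apply exp_0. Qed.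

Lemma Rpower_inv_r w : 0 < w -> w * Rpower w (-1) = 1.
Proof.
  intros H. rewrite <- (Rpower_1 w) at 1 by easy. rewrite <- Rpower_plus.
  replace (1 + -1) with 0 by ring. apply Rpower_zero.
Qed.

Lemma Rpower_cancel d t : Rpower d (- t) * Rpower d t = 1.
Proof. rewrite <- Rpower_plus, Rplus_opp_l. apply Rpower_zero. Qed.

Lemma Rpower_exp_anti d s s' : 0 < d <= 1 -> s' <= s -> Rpower d s <= Rpower d s'.
Proof.
  intros [H1 H2] H. unfold Rpower.
  assert (ln d <= 0). { rewrite <- ln_1. destruct H2 as [H2| ->]; [left; now apply ln_increasing|lra]. }
  destruct (Req_dec (s * ln d) (s' * ln d)) as [->|Hn]; [lra|].
  left. apply exp_increasing. nra.
Qed.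

Lemma cont_class_graded D : open2 D -> graded D (cont_class D).
Proof.
  intros HD. split.
  - easy.
  - intros r s h k H K n d b Hd. apply continuity_2d_pt_plus; auto.
  - intros r1 r2 s1 s2 h k H K n d b Hd. apply continuity_2d_pt_mult; auto.
  - intros r s h k E H n d b Hd. apply (continuity_2d_pt_ext_loc (h n)); [|auto].
    generalize (HD d b Hd). intros [e He]. exists e. intros u v Hu Hv. apply E. auto.
  - intros c n d b _. apply continuity_2d_pt_const.
Qed.

Lemma weighted_graded D : open2 D -> graded D (weighted D).
Proof.
  intros HD. pose proof (cont_class_graded D HD) as G. split.
  - easy.
  - intros r s h k [H1 H2] [K1 K2]. split; [now apply (graded_plus _ _ G r s)|].
    intros L. destruct (H2 L) as [KH H], (K2 L) as [KK K]. exists (KH + KK).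
    intros n d b Hd H3 H4 H5. eapply Rle_trans; [apply Rabs_triang|].
    specialize (H n d b Hd H3 H4 H5). specialize (K n d b Hd H3 H4 H5). lra.
  - intros r1 r2 s1 s2 h k [H1 H2] [K1 K2].
    split; [now apply (graded_mult _ _ G r1 r2 s1 s2)|].
    intros L. destruct (H2 L) as [KH H], (K2 L) as [KK K]. exists (KH * KK).
    intros n d b Hd H3 H4 H5. rewrite Rabs_mult, Rpower_plus, Rpow_mult_distr.
    specialize (H n d b Hd H3 H4 H5). specialize (K n d b Hd H3 H4 H5).
    replace (KH * KK * (r1 ^ n * r2 ^ n) * (Rpower d s1 * Rpower d s2))
      with ((KH * r1 ^ n * Rpower d s1) * (KK * r2 ^ n * Rpower d s2)) by ring.
    apply Rmult_le_compat; auto using Rabs_pos.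
  - intros r s h k E [H1 H2]. split; [now apply (graded_ext _ _ G r s h)|].
    intros L. destruct (H2 L) as [K H]. exists K. intros n d b Hd. rewrite <- E by easy. now apply H.
  - intros c. split; [apply (graded_const _ _ G)|].
    intros L. exists (Rabs c). intros n d b _ _ _ _.
    rewrite pow1, Rpower_zero. lra.
Qed.

Lemma Ck_map full full' D D' B B' M : (full' = true -> full = true) ->
  (forall d b, D' d b -> D d b) -> forall r s r' s' h,
  (forall k, B r s k -> B' r' s' k) ->
  Ck full D B M r s h -> Ck full' D' B' M r' s' h.
Proof.
  intros HF HD. induction M as [|M IH]; intros r s r' s' h HB [H0 H].
  - split; [auto|easy].
  - destruct H as [[h1 [Hb H1]] H2]. split; [auto|]. split.
    + exists h1. split; [|now apply (IH r s)]. intros n d b Hd. auto.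
    + intros F. destruct (H2 (HF F)) as [h2 [Hd H3]].
      exists h2. split; [|now apply (IH r s)]. intros n d b Hdb. auto.
Qed.

Definition wC (D : R -> R -> Prop) := Ck false D (weighted D).

(** Lowering the exponent is harmless because weighted only bounds for d <= 1. *)
Lemma wC_weaken D M r s r' s' h : (forall d b, D d b -> 0 < d) ->
  0 <= r <= r' -> s' <= s -> wC D M r s h -> wC D M r' s' h.
Proof.
  intros HD Hr Hs. apply Ck_map; auto. intros k [H1 H2]. split; [easy|].
  intros L. destruct (H2 L) as [K HK]. exists (Rabs K). intros n d b Hd H3 H4 H5.
  eapply Rle_trans; [now apply HK|].
  pose proof (Rpower_pos d s). pose proof (Rpower_exp_anti d s s' (conj (HD _ _ Hd) H3) Hs).
  pose proof (pow_le r n (proj1 Hr)). pose proof (pow_incr r r' n Hr).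
  pose proof (Rle_abs K). pose proof (Rabs_pos K).
  apply Rle_trans with (Rabs K * r ^ n * Rpower d s).
  - apply Rmult_le_compat_r; [lra|]. apply Rmult_le_compat_r; lra.
  - apply Rmult_le_compat; [nra|lra| |lra]. now apply Rmult_le_compat_l.
Qed.

Lemma wC_shift D M r s h : wC D M r s h -> wC D M r s (fun n => h (S n)).
Proof.
  revert h. induction M as [|M IH]; intros h [[H1 H2] H].
  - split; [|easy]. split; [intros n; apply H1|].
    intros L. destruct (H2 L) as [K HK]. exists (K * r). intros n d b Hd H3 H4 H5.
    eapply Rle_trans; [now apply HK|]. simpl. right. ring.
  - destruct H as [[h1 [Hb H3]] _]. split; [split; [intros n; apply H1|]|split].
    + intros L. destruct (H2 L) as [K HK]. exists (K * r). intros n d b Hd H4 H5 H6.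
      eapply Rle_trans; [now apply HK|]. simpl. right. ring.
    + exists (fun n => h1 (S n)). split; [|now apply IH]. intros n; apply Hb.
    + easy.
Qed.

Lemma cont2_power (h : R -> R -> R) q d b : 0 < h d b -> continuity_2d_pt h d b ->
  continuity_2d_pt (fun x y => Rpower (h x y) q) d b.
Proof.
  intros Hp Hc. apply (continuity_1d_2d_pt_comp (fun z => Rpower z q)); [|easy].
  apply derivable_continuous_pt. eexists. now apply derivable_pt_lim_power.
Qed.

Lemma wC_Rpower D M s : open2 D -> (forall d b, D d b -> 0 < d) ->
  wC D M 1 s (fun _ d _ => Rpower d s).
Proof.
  intros HO HD.
  assert (H0 : weighted D 1 s (fun _ d _ => Rpower d s)).
  { split.
    - intros n d b Hd. apply cont2_power; [eauto|]. apply continuity_2d_pt_id1.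
    - intros L. exists 1. intros n d b _ _ _ _. pose proof (Rpower_pos d s).
      rewrite pow1, Rabs_pos_eq; lra. }
  induction M as [|M IH]; [now split|]. split; [easy|]. split; [|easy].
  exists (fun _ _ _ => 0). split; [intros n d b _; apply is_derive_const_R|].
  apply (Ck_ext false D _ (weighted_graded D HO) M 1 s (fun n d b => 0 * Rpower d s)).
  - intros; ring.
  - now apply (Ck_scal false D _ (weighted_graded D HO) M 0).
Qed.

Lemma Ck_deriv_b full D B M r s h h' : graded D B ->
  Ck full D B (S M) r s h -> deriv_b D h h' -> Ck full D B M r s h'.
Proof.
  intros G [_ [[h1 [Hb H1]] _]] Hb'. apply (Ck_ext full D B G M r s h1); [|easy].
  intros n d b Hd. rewrite <- (is_derive_unique _ _ _ (Hb n d b Hd)).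
  now apply is_derive_unique, Hb'.
Qed.

(** * Smooth functions of one variable *)

Fixpoint smooth1 (M : nat) (g : R -> R) : Prop :=
  (forall x, continuity_pt g x) /\ match M with
  | O => True
  | S M' => exists g', (forall x, is_derive g x (g' x)) /\ smooth1 M' g'
  end.

Lemma smooth1_cont M g : smooth1 M g -> forall x, continuity_pt g x.
Proof. destruct M; simpl; tauto. Qed.

Definition of_b (g : R -> R) : seqfun := fun _ _ b => g b.
Definition everywhere (_ _ : R) : Prop := True.

Lemma everywhere_open : open2 everywhere.
Proof. intros d b _. exists (mkposreal 1 Rlt_0_1). easy. Qed.

Lemma cont2_of_b g d b : continuity_pt g b -> continuity_2d_pt (fun _ y => g y) d b.
Proof. intros H. apply (continuity_1d_2d_pt_comp g (fun _ y => y)); [easy|apply continuity_2d_pt_id2]. Qed.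

Lemma smooth1_Ck full D M r s g : open2 D -> smooth1 M g -> Ck full D (cont_class D) M r s (of_b g).
Proof.
  intros HD. pose proof (cont_class_graded D HD) as G.
  assert (Z : forall M, Ck full D (cont_class D) M r s (fun _ _ _ => 0)).
  { intros M'. induction M' as [|M' IH].
    - split; [|easy]. intros n d b _. apply continuity_2d_pt_const.
    - split; [intros n d b _; apply continuity_2d_pt_const|].
      split; [|intros _]; exists (fun _ _ _ => 0); (split; [|easy]);
      intros n d b _; apply is_derive_const_R. }
  revert g. induction M as [|M IH]; intros g [H0 H].
  - split; [|easy]. intros n d b _. now apply cont2_of_b.
  - destruct H as [g' [Hg H]]. split; [intros n d b _; now apply cont2_of_b|]. split.
    + exists (of_b g'). split; [intros n d b _; apply Hg|auto].
    + intros _. exists (fun _ _ _ => 0). split; [|easy]. intros n d b _. apply (is_derive_const_R (g b)).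
Qed.

Lemma cont_bounded (g : R -> R) a c : (forall x, continuity_pt g x) ->
  exists K, 0 < K /\ forall x, a <= x <= c -> Rabs (g x) <= K.
Proof.
  intros H. destruct (Rle_dec a c) as [Hac|Hac].
  - destruct (continuity_ab_maj (fun x => Rabs (g x)) a c Hac) as [x0 [Hx _]].
    + intros x _. apply (continuity_pt_comp g Rabs); [easy|apply Rcontinuity_abs].
    + exists (Rabs (g x0) + 1). split; [pose proof (Rabs_pos (g x0)); lra|].
      intros x Hxx. specialize (Hx x Hxx). simpl in Hx. lra.
  - exists 1. split; [lra|]. intros x Hx. lra.
Qed.

Lemma smooth1_wC D M g : open2 D -> (forall d b, D d b -> 0 < d) -> smooth1 M g -> wC D M 1 0 (of_b g).
Proof.
  intros HO HD.
  assert (HW : forall g, (forall x, continuity_pt g x) -> weighted D 1 0 (of_b g)).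
  { clear g. intros g H. split; [intros n d b _; now apply cont2_of_b|].
    intros L. destruct (cont_bounded g (- L) L H) as [K [_ HK]]. exists K.
    intros n d b Hd H1 H2 H3. rewrite pow1, Rpower_zero. unfold of_b.
    specialize (HD d b Hd). assert (- L <= b <= L) by lra. specialize (HK b H0). lra. }
  revert g. induction M as [|M IH]; intros g [H0 H].
  - split; [now apply HW|easy].
  - destruct H as [g' [Hg H]]. split; [auto|]. split; [|easy].
    exists (of_b g'). split; [intros n d b _; apply Hg|now apply IH].
Qed.

Lemma Ck_smooth1 M : forall g, Ck false everywhere (cont_class everywhere) M 1 0 (of_b g) -> smooth1 M g.
Proof.
  assert (H0 : forall g, cont_class everywhere 1 0 (of_b g) -> forall x, continuity_pt g x).
  { intros g H x. apply continuity_pt_filterlim.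
    specialize (H O 0 x I). intros P [e He].
    destruct (H e) as [e' He']. exists e'. intros y Hy. apply He.
    apply (He' 0 y); [rewrite Rminus_eq_0, Rabs_R0; apply cond_pos|exact Hy]. }
  induction M as [|M IH]; intros g [H1 H].
  - split; [exact (H0 _ H1)|easy].
  - destruct H as [[h' [Hb H]] _]. split; [exact (H0 _ H1)|].
    exists (h' O 0). split; [intros x; exact (Hb O 0 x I)|].
    apply IH. apply (Ck_ext _ _ _ (cont_class_graded _ everywhere_open) M 1 0 h'); [|easy].
    intros n d b _. unfold of_b. rewrite <- (is_derive_unique _ _ _ (Hb n d b I)).
    apply is_derive_unique; exact (Hb O 0 b I).
Qed.

Lemma smooth1_mult M g h : smooth1 M g -> smooth1 M h -> smooth1 M (fun x => g x * h x).
Proof.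
  intros H K. apply Ck_smooth1. pose proof (cont_class_graded _ everywhere_open) as G.
  apply (Ck_mult_eq _ _ _ G M 1 1 1 0 0 0 (of_b g) (of_b h)); try ring; (apply smooth1_Ck; [apply everywhere_open|easy]).
Qed.

Lemma smooth1_plus M g h : smooth1 M g -> smooth1 M h -> smooth1 M (fun x => g x + h x).
Proof.
  intros H K. apply Ck_smooth1. pose proof (cont_class_graded _ everywhere_open) as G.
  apply (Ck_plus _ _ _ G M 1 0 (of_b g) (of_b h)); (apply smooth1_Ck; [apply everywhere_open|easy]).
Qed.

Lemma smooth1_scal M c g : smooth1 M g -> smooth1 M (fun x => c * g x).
Proof.
  intros H. apply Ck_smooth1. pose proof (cont_class_graded _ everywhere_open) as G.
  apply (Ck_scal _ _ _ G M c 1 0 (of_b g)); (apply smooth1_Ck; [apply everywhere_open|easy]).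
Qed.

Lemma smooth1_const M c : smooth1 M (fun _ => c).
Proof. apply Ck_smooth1. exact (Ck_const _ _ _ (cont_class_graded _ everywhere_open) M c). Qed.

Lemma smooth1_power M q g : (forall x, 0 < g x) -> smooth1 M g -> smooth1 M (fun x => Rpower (g x) q).
Proof.
  intros Hp H. apply Ck_smooth1. pose proof (cont_class_graded _ everywhere_open) as G.
  apply (Ck_power _ _ _ G M q (of_b g)).
  - intros n d b _. apply Hp.
  - intros q' n d b _. apply (cont2_power (fun _ y => g y)); [apply Hp|].
    apply cont2_of_b. now apply (smooth1_cont M).
  - (apply smooth1_Ck; [apply everywhere_open|easy]).
Qed.

Lemma smooth1_pred M g : smooth1 (S M) g -> smooth1 M g.
Proof.
  revert g. induction M as [|M IH]; intros g [H0 [g' [Hg H]]]; [easy|].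
  split; [easy|]. exists g'. split; [easy|]. now apply IH.
Qed.

Lemma smooth1_le M' M g : (M' <= M)%nat -> smooth1 M g -> smooth1 M' g.
Proof. intros L. induction L as [|M L IH]; [easy|]. intros H. apply IH. now apply smooth1_pred. Qed.

Lemma smooth1_ext M g h : (forall x, g x = h x) -> smooth1 M g -> smooth1 M h.
Proof. intros E H. replace h with g; [easy|]. now apply functional_extensionality. Qed.

Lemma smooth1_deriv M g g' : smooth1 (S M) g -> (forall x, is_derive g x (g' x)) -> smooth1 M g'.
Proof.
  intros [_ [g1 [H1 H]]] Hg. apply (smooth1_ext M g1); [|easy]. intros x.
  rewrite <- (is_derive_unique _ _ _ (H1 x)). now apply is_derive_unique.
Qed.

Lemma smooth1_id M : smooth1 M (fun x => x).
Proof.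
  destruct M as [|M]; (split; [intros x; apply continuity_pt_id|]); [easy|].
  exists (fun _ => 1). split; [intros x; apply @is_derive_id|apply smooth1_const].
Qed.

Lemma smooth1_comp M : forall g h, smooth1 M g -> smooth1 M h -> smooth1 M (fun x => g (h x)).
Proof.
  induction M as [|M IH]; intros g h Hg Hh.
  - split; [|easy]. intros x. apply (continuity_pt_comp h g); [apply Hh|apply Hg].
  - pose proof (smooth1_pred _ _ Hh) as Hh'. destruct Hg as [G0 [g' [Dg Hg]]], Hh as [H0 [h' [Dh Hh]]].
    split; [intros x; now apply (continuity_pt_comp h g)|].
    exists (fun x => h' x * g' (h x)). split.
    + intros x. now apply (is_derive_comp g h).
    + apply (smooth1_mult M h' (fun x => g' (h x))); auto.
Qed.

(** * Taylor remainders of a power *)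

Fixpoint binom_coef (q : R) (i : nat) : R :=
  match i with O => 1 | S i => binom_coef q i * (q - INR i) / INR (S i) end.

Lemma binom_coef_step i q : INR (S i) * binom_coef q (S i) = q * binom_coef (q - 1) i.
Proof.
  revert q. induction i as [|i IH]; intros q.
  - simpl. field.
  - pose proof (IH q) as E.
    replace (INR (S (S i)) * binom_coef q (S (S i))) with (binom_coef q (S i) * (q - INR (S i))).
    2:{ change (binom_coef q (S (S i))) with (binom_coef q (S i) * (q - INR (S i)) / INR (S (S i))). field. apply not_0_INR. lia. }
    change (binom_coef (q - 1) (S i)) with (binom_coef (q - 1) i * (q - 1 - INR i) / INR (S i)).
    assert (INR (S i) <> 0) by (apply not_0_INR; lia).
    apply (Rmult_eq_reg_l (INR (S i))); [|easy].
    rewrite <- Rmult_assoc, E. rewrite S_INR in *. field. easy.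
Qed.

(** The Taylor remainder of (1 + y)^q at 0 after i terms. *)
Fixpoint binom_rem (q : R) (i : nat) (y : R) : R :=
  match i with O => Rpower (1 + y) q | S i => binom_rem q i y - binom_coef q i * y ^ i end.

Lemma is_derive_binom_rem0 q y : 0 < 1 + y -> is_derive (binom_rem q 0) y (q * binom_rem (q - 1) 0 y).
Proof.
  intros H. simpl. eapply is_derive_val.
  - apply (is_derive_Rpower_comp (fun y => 1 + y) y 1 q H).
    eapply is_derive_val; [apply is_derive_plus_R; [apply is_derive_const_R|apply @is_derive_id]|].
    change (0 + 1 = 1); ring.
  - ring.
Qed.

(** Differentiation lowers both q and the order of the remainder.  This lets every
    estimate on remainders be proved by induction on the order. *)
Lemma is_derive_binom_rem i q y : 0 < 1 + y -> is_derive (binom_rem q (S i)) y (q * binom_rem (q - 1) i y).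
Proof.
  intros H. revert q. induction i as [|i IH]; intros q.
  - eapply is_derive_val.
    + apply (is_derive_minus_R (binom_rem q 0) (fun y => binom_coef q 0 * y ^ 0) y); [now apply is_derive_binom_rem0|].
      apply (is_derive_const_R (binom_coef q 0 * 1)).
    + ring.
  - eapply is_derive_val.
    + apply (is_derive_minus_R (binom_rem q (S i)) (fun y => binom_coef q (S i) * y ^ S i) y); [apply IH|].
      apply (is_derive_scal (fun y => y ^ S i)). apply is_derive_pow. apply @is_derive_id.
    + change one with 1. change (binom_rem (q - 1) (S i) y) with (binom_rem (q - 1) i y - binom_coef (q - 1) i * y ^ i).
      simpl pred. transitivity (q * binom_rem (q - 1) i y - (INR (S i) * binom_coef q (S i)) * y ^ i).
      * unfold mult; simpl. ring.
      * rewrite binom_coef_step. ring.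
Qed.

Lemma binom_rem_zero q i : binom_rem q (S i) 0 = 0.
Proof.
  induction i as [|i IH].
  - simpl. rewrite Rplus_0_r. unfold Rpower. rewrite ln_1, Rmult_0_r, exp_0. ring.
  - change (binom_rem q (S (S i)) 0) with (binom_rem q (S i) 0 - binom_coef q (S i) * 0 ^ S i). rewrite IH. simpl. ring.
Qed.

Lemma MVT_bound (f f' : R -> R) a c K : (forall x, Rmin a c <= x <= Rmax a c -> is_derive f x (f' x)) ->
  (forall x, Rmin a c <= x <= Rmax a c -> Rabs (f' x) <= K) ->
  Rabs (f c - f a) <= K * Rabs (c - a).
Proof.
  intros H1 H2. destruct (MVT_gen f a c f') as [x [Hx E]].
  - intros x Hx. apply H1. lra.
  - intros x Hx. apply derivable_continuous_pt. exists (f' x). apply is_derive_Reals. auto.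
  - rewrite E, Rabs_mult. apply Rmult_le_compat_r; [apply Rabs_pos|auto].
Qed.

Lemma Rpower_bound_half q y : Rabs y <= / 2 -> Rpower (1 + y) q <= Rpower 2 (Rabs q).
Proof.
  intros H. apply Rabs_le_between in H. unfold Rpower.
  assert (- ln 2 <= ln (1 + y) <= ln 2).
  { split.
    - rewrite <- ln_Rinv by lra. apply Rcomplements.ln_le; lra.
    - apply Rcomplements.ln_le; lra. }
  assert (q * ln (1 + y) <= Rabs q * ln 2).
  { eapply Rle_trans; [apply Rle_abs|]. rewrite Rabs_mult. apply Rmult_le_compat_l; [apply Rabs_pos|].
    apply Rabs_le. lra. }
  destruct H1 as [H1| ->]; [|lra]. left. now apply exp_increasing.
Qed.

Lemma between_abs x y : Rmin 0 y <= x <= Rmax 0 y -> Rabs x <= Rabs y.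
Proof.
  intros H1. unfold Rmin, Rmax in H1. destruct (Rle_dec 0 y).
  - rewrite !Rabs_pos_eq; lra.
  - rewrite !Rabs_left1; lra.
Qed.

(** Each order is integrated from the previous one, starting from the boundedness
    of (1 + y)^q for |y| <= 1/2. *)
Lemma binom_rem_bound i : forall q, exists K, 0 <= K /\ forall y, Rabs y <= / 2 -> Rabs (binom_rem q i y) <= K * Rabs y ^ i.
Proof.
  induction i as [|i IH]; intros q.
  - exists (Rpower 2 (Rabs q)). split; [left; apply Rpower_pos|]. intros y Hy. simpl.
    pose proof (Rpower_pos (1 + y) q). rewrite Rabs_pos_eq by lra.
    pose proof (Rpower_bound_half q y Hy). lra.
  - destruct (IH (q - 1)) as [K [HK H]]. exists (Rabs q * K). split; [apply Rmult_le_pos; [apply Rabs_pos|easy]|].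
    intros y Hy. replace (binom_rem q (S i) y) with (binom_rem q (S i) y - binom_rem q (S i) 0) by (rewrite binom_rem_zero; ring).
    eapply Rle_trans.
    + apply (MVT_bound _ (fun y => q * binom_rem (q - 1) i y) 0 y (Rabs q * (K * Rabs y ^ i))).
      * intros x Hx. apply is_derive_binom_rem. pose proof (between_abs x y Hx) as Hb.
        assert (Hb' : Rabs x <= /2) by lra. apply Rabs_le_between in Hb'. lra.
      * intros x Hx. pose proof (between_abs x y Hx) as Hb. rewrite Rabs_mult.
        apply Rmult_le_compat_l; [apply Rabs_pos|]. eapply Rle_trans; [apply H; lra|].
        apply Rmult_le_compat_l; [easy|]. apply pow_incr. split; [apply Rabs_pos|easy].
    + rewrite Rminus_0_r. simpl. right. ring.
Qed.

Lemma cont2_binom_rem q i (h : R -> R -> R) d b : 0 < 1 + h d b -> continuity_2d_pt h d b ->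
  continuity_2d_pt (fun x y => binom_rem q i (h x y)) d b.
Proof.
  intros Hp Hc. apply (continuity_1d_2d_pt_comp (binom_rem q i)); [|easy].
  apply derivable_continuous_pt. destruct i; eexists; apply is_derive_Reals.
  - now apply is_derive_binom_rem0.
  - now apply is_derive_binom_rem.
Qed.

Lemma half_pos y : Rabs y <= / 2 -> 0 < 1 + y.
Proof. intros H. apply Rabs_le_between in H. lra. Qed.

Lemma Rpower_natmult d i t : Rpower d t ^ i = Rpower d (INR i * t).
Proof.
  induction i as [|i IH].
  - simpl. now rewrite Rmult_0_l, Rpower_zero.
  - change (Rpower d t ^ S i) with (Rpower d t * Rpower d t ^ i). rewrite IH, <- Rpower_plus, S_INR.
    f_equal. ring.
Qed.

Section Weighted.
Variable D : R -> R -> Prop.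
Hypothesis HO : open2 D.
Hypothesis HD : forall d b, D d b -> 0 < d.
Let G := weighted_graded D HO.

(** A remainder of order i of a function O(d^t) is O(d^(i t)), and so are its
    b-derivatives: the factor y_b = O(d^t) makes up for the order of the remainder
    lost by differentiation. *)
Lemma wC_binom_rem M : forall q i t y, 0 <= t -> (forall n d b, D d b -> Rabs (y n d b) <= / 2) ->
  wC D M 1 t y -> wC D M 1 (INR i * t) (fun n d b => binom_rem q i (y n d b)).
Proof.
  assert (Hbase : forall q i t y, 0 <= t -> (forall n d b, D d b -> Rabs (y n d b) <= / 2) ->
    weighted D 1 t y -> weighted D 1 (INR i * t) (fun n d b => binom_rem q i (y n d b))).
  { intros q i t y Ht Hy [H1 H2]. split.
    - intros n d b Hd. apply cont2_binom_rem; [now apply half_pos, Hy|now apply H1].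
    - intros L. destruct (H2 L) as [K HK]. destruct (binom_rem_bound i q) as [K' [HK' H']].
      exists (K' * K ^ i). intros n d b Hd H3 H4 H5. eapply Rle_trans; [now apply H', Hy|].
      specialize (HK n d b Hd H3 H4 H5). rewrite pow1 in *. rewrite <- Rpower_natmult.
      replace (K' * K ^ i * 1 * Rpower d t ^ i) with (K' * (K * 1 * Rpower d t) ^ i).
      2:{ rewrite Rmult_1_r, Rpow_mult_distr. ring. }
      apply Rmult_le_compat_l; [easy|]. apply pow_incr. split; [apply Rabs_pos|easy]. }
  induction M as [|M IH]; intros q i t y Ht Hy H.
  - split; [|easy]. apply Hbase; try easy. apply H.
  - pose proof (Ck_pred _ _ _ _ _ _ _ H) as Hp. destruct H as [H0 [[y' [Hb H1]] _]].
    split; [now apply Hbase|]. split; [|easy].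
    exists (fun n d b => q * (binom_rem (q - 1) (pred i) (y n d b) * y' n d b)). split.
    + intros n d b Hd. apply (is_derive_val _ _ (y' n d b * (q * binom_rem (q - 1) (pred i) (y n d b)))); [|ring].
      apply (is_derive_comp (binom_rem q i) (fun z => y n d z)); [|now apply Hb].
      destruct i; [apply is_derive_binom_rem0|apply is_derive_binom_rem]; now apply half_pos, Hy.
    + apply (Ck_scal _ _ _ G). destruct i as [|i].
      * apply (wC_weaken D M 1 t); [easy|lra|simpl; lra|].
        apply (Ck_mult_eq _ _ _ G M 1 1 1 0 t t (fun n d b => binom_rem (q - 1) 0 (y n d b)) y'); try ring; [|easy].
        replace 0 with (INR 0 * t) by (simpl; ring). now apply IH.
      * apply (Ck_mult_eq _ _ _ G M 1 1 1 (INR i * t) t _ (fun n d b => binom_rem (q - 1) i (y n d b)) y');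
          [now apply IH|easy|ring|rewrite S_INR; ring].
Qed.

(** The version for differences: a geometric rate r of y - z is inherited by
    functions of y and z. *)
Lemma wC_binom_rem_diff M : forall q r t t' y z, 0 <= t -> (0 <= r) ->
  (forall n d b, D d b -> Rabs (y n d b) <= / 2) -> (forall n d b, D d b -> Rabs (z n d b) <= / 2) ->
  wC D M 1 t y -> wC D M 1 t z -> wC D M r t' (fun n d b => y n d b - z n d b) ->
  wC D M r t' (fun n d b => binom_rem q 0 (y n d b) - binom_rem q 0 (z n d b)).
Proof.
  assert (Hbase : forall q r t t' y z,
    (forall n d b, D d b -> Rabs (y n d b) <= / 2) -> (forall n d b, D d b -> Rabs (z n d b) <= / 2) ->
    weighted D 1 t y -> weighted D 1 t z -> weighted D r t' (fun n d b => y n d b - z n d b) ->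
    weighted D r t' (fun n d b => binom_rem q 0 (y n d b) - binom_rem q 0 (z n d b))).
  { intros q r t t' y z Hy Hz [Y1 Y2] [Z1 Z2] [H1 H2]. split.
    - intros n d b Hd. apply continuity_2d_pt_minus; apply cont2_binom_rem; auto using half_pos.
    - intros L. destruct (H2 L) as [K HK]. destruct (binom_rem_bound 0 (q - 1)) as [K' [HK' H']].
      exists ((Rabs q * K') * K). intros n d b Hd H3 H4 H5. specialize (HK n d b Hd H3 H4 H5).
      eapply Rle_trans.
      + apply (MVT_bound (binom_rem q 0) (fun y => q * binom_rem (q - 1) 0 y) (z n d b) (y n d b) (Rabs q * K')).
        * intros x Hx. apply is_derive_binom_rem0. specialize (Hy n d b Hd). specialize (Hz n d b Hd).
          apply Rabs_le_between in Hy. apply Rabs_le_between in Hz.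
          unfold Rmin, Rmax in Hx. destruct Rle_dec; lra.
        * intros x Hx. rewrite Rabs_mult. apply Rmult_le_compat_l; [apply Rabs_pos|].
          rewrite <- (Rmult_1_r K'). apply (H' x). specialize (Hy n d b Hd). specialize (Hz n d b Hd).
          apply Rabs_le_between in Hy. apply Rabs_le_between in Hz. apply Rabs_le_between.
          unfold Rmin, Rmax in Hx. destruct Rle_dec; lra.
      + rewrite !Rmult_assoc. do 2 (apply Rmult_le_compat_l; [try apply Rabs_pos; easy|]). lra. }
  induction M as [|M IH]; intros q r t t' y z Ht Hr Hy Hz Y Z H.
  - split; [|easy]. apply (Hbase q r t t'); try easy. apply Y. apply Z. apply H.
  - pose proof (Ck_pred _ _ _ _ _ _ _ Y) as Yp. pose proof (Ck_pred _ _ _ _ _ _ _ Z) as Zp.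
    pose proof (Ck_pred _ _ _ _ _ _ _ H) as Hp.
    pose proof H as Hd'.
    destruct Y as [Y0 [[y' [Yb Y1]] _]], Z as [Z0 [[z' [Zb Z1]] _]].
    split; [apply (Hbase q r t t'); try easy; apply H|]. split; [|easy].
    exists (fun n d b => q * ((binom_rem (q - 1) 0 (y n d b) - binom_rem (q - 1) 0 (z n d b)) * y' n d b
                            + binom_rem (q - 1) 0 (z n d b) * (y' n d b - z' n d b))). split.
    + intros n d b Hd.
      apply (is_derive_val _ _ (y' n d b * (q * binom_rem (q - 1) 0 (y n d b)) - z' n d b * (q * binom_rem (q - 1) 0 (z n d b)))); [|ring].
      apply is_derive_minus_R.
      * apply (is_derive_comp (binom_rem q 0) (fun x => y n d x)); [|now apply Yb].
        apply is_derive_binom_rem0; now apply half_pos, Hy.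
      * apply (is_derive_comp (binom_rem q 0) (fun x => z n d x)); [|now apply Zb].
        apply is_derive_binom_rem0; now apply half_pos, Hz.
    + apply (Ck_scal _ _ _ G). apply (Ck_plus _ _ _ G).
      * apply (wC_weaken D M r (t' + t)); [easy|lra|lra|].
        apply (Ck_mult_eq _ _ _ G M r 1 r t' t _ (fun n d b => binom_rem (q - 1) 0 (y n d b) - binom_rem (q - 1) 0 (z n d b)) y'); try ring; [|easy].
        now apply (IH (q - 1) r t).
      * apply (Ck_mult_eq _ _ _ G M 1 r r 0 t' t' (fun n d b => binom_rem (q - 1) 0 (z n d b)) (fun n d b => y' n d b - z' n d b)); try ring.
        -- replace 0 with (INR 0 * t) by (simpl; ring). now apply wC_binom_rem.
        -- apply (Ck_deriv_b _ _ _ _ _ _ _ _ G Hd').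
           intros n d b Hd. apply is_derive_minus_R; auto.
Qed.
End Weighted.

(** * Primitives depending on a parameter *)

Lemma continuity_2d_pt_swap f x y : continuity_2d_pt f x y -> continuity_2d_pt (fun u v => f v u) y x.
Proof. intros H eps. destruct (H eps) as [e He]. exists e. intros u v Hu Hv. now apply He. Qed.

Lemma cont2_slice_d f d b : continuity_2d_pt f d b -> continuous (fun y => f y b) d.
Proof.
  intros H P [e He]. destruct (H e) as [e' He']. exists e'. intros y Hy. apply He.
  apply He'; [exact Hy|]. rewrite Rminus_eq_0, Rabs_R0. apply cond_pos.
Qed.

Lemma cont2_slice_b f d b : continuity_2d_pt f d b -> continuous (fun y => f d y) b.
Proof. intros H. apply (cont2_slice_d (fun u v => f v u)). now apply continuity_2d_pt_swap. Qed.

Lemma RInt_correct_R (f : R -> R) a c : ex_RInt f a c -> is_RInt f a c (RInt f a c).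
Proof. apply @RInt_correct. Qed.

Lemma RInt_ext_R (f g : R -> R) a c :
  (forall x, Rmin a c < x < Rmax a c -> f x = g x) -> RInt f a c = RInt g a c.
Proof. apply @RInt_ext. Qed.

Lemma RInt_minus_R (f g : R -> R) a c : ex_RInt f a c -> ex_RInt g a c ->
  RInt (fun x => f x - g x) a c = RInt f a c - RInt g a c.
Proof. apply @RInt_minus. Qed.

Lemma ex_RInt_minus_R (f g : R -> R) a c : ex_RInt f a c -> ex_RInt g a c ->
  ex_RInt (fun x => f x - g x) a c.
Proof. apply @ex_RInt_minus. Qed.

Lemma ex_RInt_cont_R (f : R -> R) a c :
  (forall z, Rmin a c <= z <= Rmax a c -> continuous f z) -> ex_RInt f a c.
Proof. apply @ex_RInt_continuous. Qed.

Lemma RInt_Chasles_R (f : R -> R) a c e : ex_RInt f a c -> ex_RInt f c e ->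
  RInt f a c + RInt f c e = RInt f a e.
Proof. apply @RInt_Chasles. Qed.

Lemma is_RInt_derive_R (F f : R -> R) a c :
  (forall x, Rmin a c <= x <= Rmax a c -> is_derive F x (f x)) ->
  (forall x, Rmin a c <= x <= Rmax a c -> continuous f x) ->
  is_RInt f a c (F c - F a).
Proof. apply @is_RInt_derive. Qed.

Lemma is_RInt_unique_R (f : R -> R) (a c l : R) : is_RInt f a c l -> RInt f a c = l.
Proof. apply @is_RInt_unique. Qed.

Lemma RInt_abs_le (f : R -> R) a c K : ex_RInt f a c ->
  (forall t, Rmin a c <= t <= Rmax a c -> Rabs (f t) <= K) ->
  Rabs (RInt f a c) <= Rabs (c - a) * K.
Proof.
  intros Hex H. destruct (Rle_dec a c) as [L|L].
  - rewrite (Rabs_pos_eq (c - a)) by lra. apply abs_RInt_le_const; auto.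
    intros t Ht. apply H. rewrite Rmin_left, Rmax_right; lra.
  - rewrite <- (opp_RInt_swap f c a) by now apply ex_RInt_swap.
    change (opp (RInt f c a)) with (- RInt f c a). rewrite Rabs_Ropp, Rabs_minus_sym, (Rabs_pos_eq (a - c)) by lra.
    apply abs_RInt_le_const; [lra|now apply ex_RInt_swap|].
    intros t Ht. apply H. rewrite Rmin_right, Rmax_left; lra.
Qed.

Lemma cont2_bounded_near f d b : continuity_2d_pt f d b ->
  locally_2d (fun u v => Rabs (f u v) <= Rabs (f d b) + 1) d b.
Proof.
  intros H. destruct (H (mkposreal 1 Rlt_0_1)) as [e He]. exists e. intros u v Hu Hv.
  specialize (He u v Hu Hv). simpl in He.
  replace (f u v) with (f d b + (f u v - f d b)) by ring.
  eapply Rle_trans; [apply Rabs_triang|]. lra.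
Qed.

Section Primitive.
Variables (D : R -> R -> Prop) (c : R).
Hypothesis HO : open2 D.
Hypothesis Hc : forall d b, D d b -> forall e, Rmin c d <= e <= Rmax c d -> D e b.

Definition prim (g : R -> R -> R) (d b : R) : R := RInt (fun e => g e b) c d.

Variable g : R -> R -> R.
Hypothesis Hg : forall d b, D d b -> continuity_2d_pt g d b.

Lemma prim_ex d b : D d b -> ex_RInt (fun e => g e b) c d.
Proof.
  intros H. apply ex_RInt_cont_R. intros e He. apply cont2_slice_d, Hg. now apply (Hc d b).
Qed.

Lemma prim_deriv_d d b : D d b -> is_derive (fun y => prim g y b) d (g d b).
Proof.
  intros H. apply (is_derive_RInt (fun e => g e b) (fun y => prim g y b) c d).
  - generalize (open2_slice_d D d b HO H). apply filter_imp. intros y Hy.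
    apply RInt_correct_R, prim_ex, Hy.
  - apply cont2_slice_d, Hg, H.
Qed.

(** Joint continuity: moving b changes the integrand uniformly little on the
    compact segment, moving d changes the length of the segment. *)
Lemma prim_cont d b : D d b -> continuity_2d_pt (prim g) d b.
Proof.
  intros H eps. set (K := Rabs (g d b) + 1). set (W := Rabs (d - c) + 1).
  assert (HK : 0 < K) by (unfold K; pose proof (Rabs_pos (g d b)); lra).
  assert (HW : 0 < W) by (unfold W; pose proof (Rabs_pos (d - c)); lra).
  pose proof (cond_pos eps) as He.
  assert (He2 : 0 < eps / (2 * W)) by (apply Rdiv_lt_0_compat; lra).
  destruct (uniform_continuity_2d_1d g (Rmin c d) (Rmax c d) b
    (fun x Hx => Hg x b (Hc d b H x Hx)) (mkposreal _ He2)) as [d1 H1].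
  destruct (HO d b H) as [d2 H2]. destruct (cont2_bounded_near g d b (Hg d b H)) as [d3 H3].
  assert (He4 : 0 < eps / (2 * K)) by (apply Rdiv_lt_0_compat; lra).
  assert (Hm : 0 < Rmin (Rmin d1 d2) (Rmin d3 (eps / (2 * K)))).
  { repeat apply Rmin_pos; try apply cond_pos; easy. }
  exists (mkposreal _ Hm). intros u v Hu Hv. simpl in Hu, Hv.
  assert (Hu' : Rabs (u - d) < d1 /\ Rabs (u - d) < d2 /\ Rabs (u - d) < d3 /\ Rabs (u - d) < eps / (2 * K)).
  { repeat split; eapply Rlt_le_trans; try exact Hu; unfold Rmin; repeat destruct Rle_dec; lra. }
  assert (Hv' : Rabs (v - b) < d1 /\ Rabs (v - b) < d2 /\ Rabs (v - b) < d3).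
  { repeat split; eapply Rlt_le_trans; try exact Hv; unfold Rmin; repeat destruct Rle_dec; lra. }
  assert (Hdd : Rabs (d - d) < d2) by (rewrite Rminus_eq_0, Rabs_R0; apply cond_pos).
  assert (Duv : D u v) by (apply H2; tauto). assert (Ddv : D d v) by (apply H2; tauto).
  assert (Hseg : forall e, Rmin d u <= e <= Rmax d u -> Rabs (e - d) <= Rabs (u - d)).
  { intros e Hes. unfold Rmin, Rmax in Hes. destruct Rle_dec.
    - rewrite !Rabs_pos_eq; lra.
    - rewrite !Rabs_left1; lra. }
  assert (Hex : ex_RInt (fun e => g e v) d u).
  { apply ex_RInt_cont_R. intros e Hes. apply cont2_slice_d, Hg, H2; [|tauto].
    specialize (Hseg e Hes). lra. }
  assert (E : prim g u v - prim g d b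
    = RInt (fun e => g e v - g e b) c d + RInt (fun e => g e v) d u).
  { unfold prim. rewrite <- (RInt_Chasles_R (fun e => g e v) c d u); [|now apply prim_ex|easy].
    rewrite (RInt_minus_R (fun e => g e v) (fun e => g e b)) by now apply prim_ex. ring. }
  rewrite E. eapply Rle_lt_trans; [apply Rabs_triang|].
  assert (A1 : Rabs (RInt (fun e => g e v - g e b) c d) <= Rabs (d - c) * (eps / (2 * W))).
  { apply RInt_abs_le.
    - apply ex_RInt_minus_R; now apply prim_ex.
    - intros t Ht. left. apply (H1 t b t v); try easy.
      + pose proof (cond_pos d1). lra.
      + destruct Hv' as [Hv' _]. apply Rabs_def2 in Hv'. lra.
      + rewrite Rminus_eq_0, Rabs_R0. apply cond_pos. }
  assert (A2 : Rabs (RInt (fun e => g e v) d u) <= Rabs (u - d) * K).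
  { apply RInt_abs_le; [easy|]. intros t Ht. apply H3; [|tauto]. specialize (Hseg t Ht). lra. }
  assert (B1 : Rabs (d - c) * (eps / (2 * W)) < eps / 2).
  { replace (eps / 2) with (W * (eps / (2 * W))) by (field; lra). apply Rmult_lt_compat_r; [easy|unfold W; lra]. }
  assert (B2 : Rabs (u - d) * K <= eps / 2).
  { replace (eps / 2) with (eps / (2 * K) * K) by (field; lra). apply Rmult_le_compat_r; [lra|]. lra. }
  lra.
Qed.

Lemma prim_deriv_b g' d b : (forall d b, D d b -> continuity_2d_pt g' d b) ->
  (forall d b, D d b -> is_derive (fun y => g d y) b (g' d b)) ->
  D d b -> is_derive (fun y => prim g d y) b (prim g' d b).
Proof.
  intros Hg' Hd H. unfold prim.
  replace (RInt (fun e => g' e b) c d) with (RInt (fun t => Derive (fun u => g t u) b) c d).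
  - apply (is_derive_RInt_param (fun y e => g e y) c d b).
    + generalize (open2_slice_b D d b HO H). apply filter_imp. intros y Hy t Ht.
      exists (g' t y). apply Hd. now apply (Hc d y).
    + intros t Ht. assert (Dt : D t b) by now apply (Hc d b).
      apply (continuity_2d_pt_ext_loc (fun u v => g' v u)).
      * destruct (HO t b Dt) as [e He]. exists e. intros u v Hu Hv. symmetry.
        apply is_derive_unique, Hd. now apply He.
      * apply continuity_2d_pt_swap. now apply Hg'.
    + generalize (open2_slice_b D d b HO H). apply filter_imp. intros y Hy. now apply prim_ex.
  - apply RInt_ext. intros e He. apply is_derive_unique, Hd, (Hc d b H). lra.
Qed.

End Primitive.

(** Extended by 0, a positive power is integrable from 0 by the fundamental theorem
    of calculus on the whole line; Rpower alone has a junk value at 0. *)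
Definition pos_power (t e : R) : R := if Rlt_dec 0 e then Rpower e t else 0.

Lemma pos_power_pos t e : 0 < e -> pos_power t e = Rpower e t.
Proof. intros H. unfold pos_power. now destruct Rlt_dec. Qed.

Lemma pos_power_neg t e : e <= 0 -> pos_power t e = 0.
Proof. intros H. unfold pos_power. destruct Rlt_dec; lra. Qed.

Lemma Rpower_small t K eps : 0 < t -> 0 <= K -> 0 < eps ->
  exists del, 0 < del /\ forall e, 0 < e < del -> K * Rpower e t < eps.
Proof.
  intros Ht HK He. exists (Rpower (eps / (K + 1)) (/ t)). split; [apply Rpower_pos|].
  intros e [H1 H2].
  assert (H3 : Rpower e t < eps / (K + 1)).
  { replace (eps / (K + 1)) with (Rpower (Rpower (eps / (K + 1)) (/ t)) t).
    - apply Rlt_Rpower_l; easy.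
    - rewrite Rpower_mult, Rinv_l, Rpower_1; [easy|apply Rdiv_lt_0_compat; lra|lra]. }
  pose proof (Rpower_pos e t).
  apply Rle_lt_trans with ((K + 1) * Rpower e t); [nra|].
  apply Rmult_lt_compat_l with (r := K + 1) in H3; [|lra].
  replace ((K + 1) * (eps / (K + 1))) with eps in H3 by (field; lra). easy.
Qed.

Lemma is_derive_pos_power t e : 0 < t -> is_derive (pos_power (t + 1)) e ((t + 1) * pos_power t e).
Proof.
  intros Ht. destruct (Rtotal_order e 0) as [H|[->|H]].
  - rewrite pos_power_neg, Rmult_0_r by lra. apply (is_derive_ext_loc (fun _ => 0)).
    + assert (He : 0 < - e) by lra. exists (mkposreal _ He). intros y Hy.
      rewrite pos_power_neg; [easy|]. apply Rabs_def2 in Hy. simpl in Hy. unfold minus, plus, opp in Hy; simpl in Hy. lra.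
    + apply is_derive_const_R.
  - rewrite (pos_power_neg t 0), Rmult_0_r by lra. apply is_derive_Reals. intros eps He.
    destruct (Rpower_small t 1 eps Ht Rle_0_1 He) as [del [Hdel H]].
    exists (mkposreal _ Hdel). intros h Hh Hh'. simpl in Hh'.
    rewrite Rplus_0_l, (pos_power_neg _ 0) by lra. rewrite !Rminus_0_r.
    destruct (Rlt_dec 0 h) as [Hp|Hn].
    + rewrite pos_power_pos, Rpower_plus, Rpower_1 by easy.
      replace (Rpower h t * h / h) with (Rpower h t) by (field; lra).
      pose proof (Rpower_pos h t). rewrite Rabs_pos_eq in * by lra.
      specialize (H h (conj Hp Hh')). lra.
    + rewrite pos_power_neg by lra. unfold Rdiv. rewrite Rmult_0_l, Rabs_R0. easy.
  - rewrite pos_power_pos by easy. apply (is_derive_ext_loc (fun e => Rpower e (t + 1))).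
    + exists (mkposreal _ H). intros y Hy. rewrite pos_power_pos; [easy|].
      apply Rabs_def2 in Hy. unfold minus, plus, opp in Hy; simpl in Hy. lra.
    + replace t with (t + 1 - 1) at 2 by ring. apply is_derive_Reals. now apply derivable_pt_lim_power.
Qed.

Lemma pos_power_cont t e : 0 < t -> continuous (pos_power t) e.
Proof.
  intros Ht. destruct (Rtotal_order e 0) as [H|[->|H]].
  - apply (continuous_ext_loc _ (fun _ => 0)); [|apply continuous_const].
    assert (He : 0 < - e) by lra. exists (mkposreal _ He). intros y Hy.
    rewrite pos_power_neg; [easy|]. apply Rabs_def2 in Hy. simpl in Hy. unfold minus, plus, opp in Hy; simpl in Hy. lra.
  - intros P [eps HP]. rewrite pos_power_neg in HP by lra.
    destruct (Rpower_small t 1 eps Ht Rle_0_1 (cond_pos eps)) as [del [Hdel H]].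
    exists (mkposreal _ Hdel). intros y Hy. apply HP.
    unfold ball in *; simpl in *; unfold AbsRing_ball, abs, minus, plus, opp in *; simpl in *.
    rewrite Ropp_0, Rplus_0_r in *. destruct (Rlt_dec 0 y) as [Hp|Hn].
    + rewrite pos_power_pos by easy. pose proof (Rpower_pos y t). rewrite Rabs_pos_eq in * by lra.
      specialize (H y (conj Hp Hy)). lra.
    + rewrite pos_power_neg by lra. rewrite Rabs_R0. apply cond_pos.
  - apply (continuous_ext_loc _ (fun e => Rpower e t)).
    + exists (mkposreal _ H). intros y Hy. rewrite pos_power_pos; [easy|].
      apply Rabs_def2 in Hy. unfold minus, plus, opp in Hy; simpl in Hy. lra.
    + apply (ex_derive_continuous (V := R_NormedModule)). eexists. apply is_derive_Reals. now apply derivable_pt_lim_power.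
Qed.

Lemma is_RInt_pos_power t d : 0 < t -> is_RInt (pos_power t) 0 d (pos_power (t + 1) d / (t + 1)).
Proof.
  intros Ht.
  replace (pos_power (t + 1) d / (t + 1)) with (/ (t + 1) * pos_power (t + 1) d - / (t + 1) * pos_power (t + 1) 0).
  - apply (is_RInt_derive_R (fun e => / (t + 1) * pos_power (t + 1) e)).
    + intros e _. apply (is_derive_val _ _ (/ (t + 1) * ((t + 1) * pos_power t e))); [|field; lra].
      apply (is_derive_scal (pos_power (t + 1))). now apply is_derive_pos_power.
    + intros e _. now apply pos_power_cont.
  - rewrite (pos_power_neg _ 0) by lra. field. lra.
Qed.

Lemma RInt_pos_power_bound (f : R -> R) d t K : 0 < t -> 0 < d -> ex_RInt f 0 d ->
  (forall e, 0 < e < d -> Rabs (f e) <= K * Rpower e t) ->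
  Rabs (RInt f 0 d) <= K * Rpower d (t + 1) / (t + 1).
Proof.
  intros Ht Hd Hex H.
  assert (I : is_RInt (fun e => K * pos_power t e) 0 d (K * (pos_power (t + 1) d / (t + 1)))).
  { apply (is_RInt_scal (pos_power t)). now apply is_RInt_pos_power. }
  eapply Rle_trans; [apply abs_RInt_le; [lra|easy]|].
  apply Rle_trans with (RInt (fun e => K * pos_power t e) 0 d).
  - apply RInt_le; [lra| |now exists (K * (pos_power (t + 1) d / (t + 1)))|].
    + now apply (ex_RInt_norm f).
    + intros e He. rewrite pos_power_pos by lra. now apply H.
  - rewrite (is_RInt_unique_R _ _ _ _ I), pos_power_pos by easy. right. unfold Rdiv. ring.
Qed.

(** * Integration along characteristics *)

Lemma cont2_comp (f g h : R -> R -> R) x y :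
  continuity_2d_pt f (g x y) (h x y) -> continuity_2d_pt g x y -> continuity_2d_pt h x y ->
  continuity_2d_pt (fun u v => f (g u v) (h u v)) x y.
Proof.
  intros Hf Hg Hh eps. destruct (Hf eps) as [e He]. destruct (Hg e) as [e1 H1]. destruct (Hh e) as [e2 H2].
  assert (Hm : 0 < Rmin e1 e2) by (apply Rmin_pos; apply cond_pos).
  exists (mkposreal _ Hm). intros u v Hu Hv. simpl in Hu, Hv.
  pose proof (Rmin_l e1 e2). pose proof (Rmin_r e1 e2).
  apply He; [apply H1|apply H2]; lra.
Qed.

Lemma cont2_shear f a x y : continuity_2d_pt f x (y + a * x) ->
  continuity_2d_pt (fun u v => f u (v + a * u)) x y.
Proof.
  intros H. apply (cont2_comp f (fun u _ => u) (fun u v => v + a * u)); [easy|apply continuity_2d_pt_id1|].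
  apply continuity_2d_pt_plus; [apply continuity_2d_pt_id2|].
  apply continuity_2d_pt_mult; [apply continuity_2d_pt_const|apply continuity_2d_pt_id1].
Qed.

Section Duhamel.
Variable rho : R -> R.
Hypothesis rho_pos : forall b, 0 < rho b.
Hypothesis rho_lip : forall x y, Rabs (rho x - rho y) <= Rabs (x - y).

(** The integrals below start at d = 0, so the domain is extended past the line
    d = 0, where integrands are continued by zero (see cut). *)
Definition below (d b : R) : Prop := d < rho b.
(** With rho 1-Lipschitz, the backward characteristics from a point of the
    layer never leave it before reaching d = 0. *)
Definition layer (d b : R) : Prop := 0 < d < rho b.
(** The set below in the coordinates (d, b - d), in which characteristics are
    parallel to the first axis. *)
Let sheared_below (e c : R) : Prop := e < rho (c + 1 * e).

Lemma below_open : open2 below.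
Proof.
  intros d b H. unfold below in *. assert (He : 0 < (rho b - d) / 2) by lra.
  exists (mkposreal _ He). intros u v Hu Hv. simpl in *.
  pose proof (rho_lip v b) as L. apply Rabs_le_between in L. apply Rabs_def2 in Hu. lra.
Qed.

Lemma layer_open : open2 layer.
Proof.
  intros d b [H0 H]. destruct (below_open d b H) as [e He].
  assert (Hm : 0 < Rmin e d) by (apply Rmin_pos; [apply cond_pos|easy]).
  exists (mkposreal _ Hm). intros u v Hu Hv. simpl in *.
  pose proof (Rmin_l e d). pose proof (Rmin_r e d). split.
  - apply Rabs_def2 in Hu. lra.
  - apply He; lra.
Qed.

Lemma layer_pos d b : layer d b -> 0 < d.
Proof. now intros []. Qed.

Lemma below_seg d b : below d b -> forall e, Rmin 0 d <= e <= Rmax 0 d -> below e b.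
Proof.
  intros H e He. unfold below, Rmin, Rmax in *. specialize (rho_pos b). destruct Rle_dec; lra.
Qed.

Lemma sheared_below_open : open2 sheared_below.
Proof.
  intros e c H. unfold sheared_below in *. assert (He : 0 < (rho (c + 1 * e) - e) / 4) by lra.
  exists (mkposreal _ He). intros u v Hu Hv. simpl in *.
  pose proof (rho_lip (v + 1 * u) (c + 1 * e)) as L. apply Rabs_le_between in L.
  assert (Rabs (v + 1 * u - (c + 1 * e)) <= Rabs (v - c) + Rabs (u - e)).
  { replace (v + 1 * u - (c + 1 * e)) with ((v - c) + (u - e)) by ring. apply Rabs_triang. }
  apply Rabs_def2 in Hu as Hu'. lra.
Qed.

Lemma sheared_below_seg d b : sheared_below d b -> forall e, Rmin 0 d <= e <= Rmax 0 d -> sheared_below e b.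
Proof.
  intros H e He. unfold sheared_below, Rmin, Rmax in *. pose proof (rho_pos (b + 1 * e)).
  destruct Rle_dec; [|lra].
  pose proof (rho_lip (b + 1 * e) (b + 1 * d)) as L.
  replace (b + 1 * e - (b + 1 * d)) with (- (d - e)) in L by ring.
  rewrite Rabs_Ropp, (Rabs_pos_eq (d - e)) in L by lra. apply Rabs_le_between in L. lra.
Qed.

(** The solution of g_d + g_b = k vanishing at d = 0. *)
Definition char_int (k : R -> R -> R) (d b : R) : R := RInt (fun e => k e (b - d + e)) 0 d.
(** The solution of h_dd + h_db = k vanishing together with h_d at d = 0. *)
Definition duhamel (k : R -> R -> R) (d b : R) : R := RInt (fun e => char_int k e b) 0 d.

Let sheared (k : R -> R -> R) (e c : R) : R := k e (c + 1 * e).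

Lemma char_int_prim k d b : char_int k d b = prim 0 (sheared k) d (b + -1 * d).
Proof. unfold char_int, prim, sheared. apply RInt_ext. intros e _. f_equal. ring. Qed.

Lemma sheared_cont k : (forall d b, below d b -> continuity_2d_pt k d b) ->
  forall d b, sheared_below d b -> continuity_2d_pt (sheared k) d b.
Proof. intros Hk d b H. apply cont2_shear, Hk, H. Qed.

Lemma below_sheared_below d b : below d b -> sheared_below d (b + -1 * d).
Proof. unfold below, sheared_below. now replace (b + -1 * d + 1 * d) with b by ring. Qed.

Section Fixed.
Variable k : R -> R -> R.
Hypothesis Hk : forall d b, below d b -> continuity_2d_pt k d b.

Lemma char_int_cont d b : below d b -> continuity_2d_pt (char_int k) d b.
Proof.
  intros H. apply (continuity_2d_pt_ext (fun d b => prim 0 (sheared k) d (b + -1 * d))).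
  - intros x y. symmetry. apply char_int_prim.
  - apply cont2_shear. apply (prim_cont sheared_below); [apply sheared_below_open|apply sheared_below_seg|now apply sheared_cont|].
    now apply below_sheared_below.
Qed.

Lemma char_int_ex d b : below d b -> ex_RInt (fun e => k e (b - d + e)) 0 d.
Proof.
  intros H. apply (ex_RInt_ext (fun e => sheared k e (b + -1 * d))).
  - intros x _. unfold sheared. f_equal. ring.
  - apply (prim_ex sheared_below 0 sheared_below_seg (sheared k)); [now apply sheared_cont|]. now apply below_sheared_below.
Qed.

Lemma duhamel_cont d b : below d b -> continuity_2d_pt (duhamel k) d b.
Proof. apply (prim_cont below 0 below_open below_seg (char_int k)). apply char_int_cont. Qed.

Lemma duhamel_deriv_d d b : below d b -> is_derive (fun y => duhamel k y b) d (char_int k d b).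
Proof. apply (prim_deriv_d below 0 below_open below_seg (char_int k)). apply char_int_cont. Qed.

Lemma char_int_diag d b : below d b -> is_derive (fun z => char_int k (d + z) (b + z)) 0 (k d b).
Proof.
  intros H.
  apply (is_derive_ext (fun z => prim 0 (sheared k) (d + z) (b + -1 * d))).
  - intros z. rewrite char_int_prim. f_equal. ring.
  - apply (is_derive_val _ _ (1 * sheared k d (b + -1 * d))).
    + apply (is_derive_comp (fun x => prim 0 (sheared k) x (b + -1 * d)) (fun z => d + z)).
      * rewrite Rplus_0_r. apply (prim_deriv_d sheared_below); [apply sheared_below_open|apply sheared_below_seg|now apply sheared_cont|].
        now apply below_sheared_below.
      * apply (is_derive_val _ _ (0 + 1)); [|ring].
        apply is_derive_plus_R; [apply is_derive_const_R|apply @is_derive_id].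
    + unfold sheared. replace (b + -1 * d + 1 * d) with b by ring. ring.
Qed.

Lemma char_int_deriv_b k' d b : (forall d b, below d b -> continuity_2d_pt k' d b) ->
  (forall d b, below d b -> is_derive (fun y => k d y) b (k' d b)) ->
  below d b -> is_derive (fun y => char_int k d y) b (char_int k' d b).
Proof.
  intros Hk' Hd H. apply (is_derive_ext (fun y => prim 0 (sheared k) d (y + -1 * d))).
  - intros y. symmetry. apply char_int_prim.
  - rewrite char_int_prim. apply (is_derive_val _ _ (1 * prim 0 (sheared k') d (b + -1 * d))); [|ring].
    apply (is_derive_comp (fun x => prim 0 (sheared k) d x) (fun y => y + -1 * d)).
    + apply (prim_deriv_b sheared_below); [apply sheared_below_open|apply sheared_below_seg|now apply sheared_cont|now apply sheared_cont| |].
      * intros e c Hec. unfold sheared. apply (is_derive_val _ _ (1 * k' e (c + 1 * e))); [|ring].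
        apply (is_derive_comp (fun x => k e x) (fun y => y + 1 * e)); [now apply Hd|].
        apply (is_derive_val _ _ (1 + 0)); [|ring].
        apply is_derive_plus_R; [apply @is_derive_id|apply (is_derive_const_R (1 * e))].
      * now apply below_sheared_below.
    + apply (is_derive_val _ _ (1 + 0)); [|ring].
      apply is_derive_plus_R; [apply @is_derive_id|apply (is_derive_const_R (-1 * d))].
Qed.

End Fixed.

Lemma duhamel_deriv_b k k' d b : (forall d b, below d b -> continuity_2d_pt k d b) ->
  (forall d b, below d b -> continuity_2d_pt k' d b) ->
  (forall d b, below d b -> is_derive (fun y => k d y) b (k' d b)) ->
  below d b -> is_derive (fun y => duhamel k d y) b (duhamel k' d b).
Proof.
  intros Hk Hk' Hd H. apply (prim_deriv_b below 0 below_open below_seg (char_int k)); [| | |easy].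
  - now apply char_int_cont.
  - now apply char_int_cont.
  - intros e c Hec. now apply char_int_deriv_b.
Qed.

Lemma char_int_bound k d b K t : (forall d b, below d b -> continuity_2d_pt k d b) -> 0 < t -> layer d b ->
  (forall e y, layer e y -> b - d <= y - e -> y <= b -> Rabs (k e y) <= K * Rpower e t) ->
  Rabs (char_int k d b) <= K / (t + 1) * Rpower d (t + 1).
Proof.
  intros Hk Ht [Hd Hb] H.
  replace (K / (t + 1) * Rpower d (t + 1)) with (K * Rpower d (t + 1) / (t + 1)) by (field; lra).
  assert (Hseg : forall e, 0 <= e <= d -> below e (b - d + e)).
  { intros e He. pose proof (sheared_below_seg d (b - d)) as S. unfold sheared_below in S.
    unfold below. replace (b - d + e) with (b - d + 1 * e) by ring. apply S.
    - now replace (b - d + 1 * d) with b by ring.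
    - rewrite Rmin_left, Rmax_right by lra. easy. }
  apply RInt_pos_power_bound; [easy|easy| |].
  - now apply char_int_ex.
  - intros e He. apply H; [split; [easy|]|lra|lra]. apply Hseg. lra.
Qed.

Lemma layer_down d b e : layer d b -> 0 < e <= d -> layer e b.
Proof. unfold layer. lra. Qed.

(** The factor 1 / ((t + 1) (t + 2)) is what makes the Picard iteration contract. *)
Lemma duhamel_bound k d b K t : (forall d b, below d b -> continuity_2d_pt k d b) -> 0 < t -> layer d b ->
  (forall e y, layer e y -> b - d <= y - e -> y <= b -> Rabs (k e y) <= K * Rpower e t) ->
  Rabs (duhamel k d b) <= K / ((t + 1) * (t + 2)) * Rpower d (t + 2).
Proof.
  intros Hk Ht Hdb H.
  replace (K / ((t + 1) * (t + 2)) * Rpower d (t + 2))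
    with (K / (t + 1) * Rpower d (t + 1 + 1) / (t + 1 + 1)).
  2:{ replace (t + 1 + 1) with (t + 2) by ring. field. lra. }
  apply RInt_pos_power_bound; [lra|apply Hdb| |].
  - apply (prim_ex below 0 below_seg (char_int k)); [now apply char_int_cont|apply Hdb].
  - intros e He. apply char_int_bound; [easy|easy| |].
    + apply (layer_down d b); [easy|lra].
    + intros x y Hxy H1 H2. apply H; [easy|lra|easy].
Qed.

Definition cut (g : R -> R -> R) (e b : R) : R := if Rlt_dec 0 e then g e b else 0.

Lemma cut_pos g e b : 0 < e -> cut g e b = g e b.
Proof. intros H. unfold cut. now destruct Rlt_dec. Qed.

Lemma cut_neg g e b : e <= 0 -> cut g e b = 0.
Proof. intros H. unfold cut. destruct Rlt_dec; lra. Qed.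

(** Continuity across d = 0 holds because a positive power of d dominates. *)
Lemma cut_cont r t g n : 0 < t -> weighted layer r t g ->
  forall d b, below d b -> continuity_2d_pt (cut (g n)) d b.
Proof.
  intros Ht [H1 H2] d b H. destruct (Rtotal_order d 0) as [Hd|[->|Hd]].
  - apply (continuity_2d_pt_ext_loc (fun _ _ => 0)); [|apply continuity_2d_pt_const].
    assert (He : 0 < - d) by lra. exists (mkposreal _ He). intros u v Hu Hv.
    rewrite cut_neg; [easy|]. apply Rabs_def2 in Hu. simpl in Hu. lra.
  - intros eps. rewrite (cut_neg _ 0) by lra.
    destruct (H2 (Rabs b + 2)) as [K HK].
    destruct (Rpower_small t (Rabs (K * r ^ n)) eps Ht (Rabs_pos _) (cond_pos eps)) as [del [Hdel Hs]].
    destruct (below_open 0 b H) as [e1 He1].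
    assert (Hm : 0 < Rmin (Rmin e1 del) 1) by (repeat apply Rmin_pos; try apply cond_pos; lra).
    exists (mkposreal _ Hm). intros u v Hu Hv. simpl in *.
    pose proof (Rmin_l (Rmin e1 del) 1). pose proof (Rmin_r (Rmin e1 del) 1).
    pose proof (Rmin_l e1 del). pose proof (Rmin_r e1 del).
    rewrite !Rminus_0_r in *. destruct (Rlt_dec 0 u) as [Hp|Hn].
    + rewrite cut_pos by easy. rewrite (Rabs_pos_eq u) in Hu by lra.
      assert (Hlay : layer u v). { split; [easy|]. apply He1; [rewrite Rminus_0_r, Rabs_pos_eq; lra|lra]. }
      apply Rabs_def2 in Hv as Hv'. pose proof (Rle_abs b). pose proof (Rle_abs (- b)).
      rewrite Rabs_Ropp in *.
      eapply Rle_lt_trans; [apply HK; [easy|lra|lra|lra]|].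
      pose proof (Rpower_pos u t).
      apply Rle_lt_trans with (Rabs (K * r ^ n) * Rpower u t).
      * apply Rmult_le_compat_r; [lra|apply Rle_abs].
      * apply Hs. lra.
    + rewrite cut_neg, Rabs_R0 by lra. apply cond_pos.
  - apply (continuity_2d_pt_ext_loc (g n)); [|now apply H1].
    exists (mkposreal _ Hd). intros u v Hu Hv. rewrite cut_pos; [easy|].
    apply Rabs_def2 in Hu. simpl in Hu. lra.
Qed.

Lemma cut_deriv g g' n : deriv_b layer g g' -> forall d b, below d b ->
  is_derive (fun y => cut (g n) d y) b (cut (g' n) d b).
Proof.
  intros H d b Hdb. destruct (Rlt_dec 0 d) as [Hd|Hd].
  - rewrite cut_pos by easy. apply (is_derive_ext (fun y => g n d y)).
    + intros y. now rewrite cut_pos.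
    + now apply H.
  - rewrite cut_neg by lra. apply (is_derive_ext (fun y => 0)).
    + intros y. rewrite cut_neg; lra.
    + apply is_derive_const_R.
Qed.

Definition char_int_seq (g : seqfun) : seqfun := fun n => char_int (cut (g n)).
Definition duhamel_seq (g : seqfun) : seqfun := fun n => duhamel (cut (g n)).

Lemma weighted_char_int r t g : 0 < t -> weighted layer r t g -> weighted layer r (t + 1) (char_int_seq g).
Proof.
  intros Ht H. pose proof (fun n => cut_cont r t g n Ht H) as Hc. split.
  - intros n d b Hd. apply char_int_cont; [apply Hc|apply Hd].
  - destruct H as [_ H]. intros L. destruct (H L) as [K HK]. exists (K / (t + 1)).
    intros n d b Hd H1 H2 H3.
    replace (K / (t + 1) * r ^ n * Rpower d (t + 1)) with (K * r ^ n / (t + 1) * Rpower d (t + 1)) by (field; lra).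
    apply char_int_bound; [apply Hc|easy|easy|]. intros e y He H4 H5.
    rewrite cut_pos by apply He. apply HK; [easy| |lra|lra]. destruct He. lra.
Qed.

Lemma weighted_duhamel r t g : 0 < t -> weighted layer r t g -> weighted layer r (t + 2) (duhamel_seq g).
Proof.
  intros Ht H. pose proof (fun n => cut_cont r t g n Ht H) as Hc. split.
  - intros n d b Hd. apply duhamel_cont; [apply Hc|apply Hd].
  - destruct H as [_ H]. intros L. destruct (H L) as [K HK]. exists (K / ((t + 1) * (t + 2))).
    intros n d b Hd H1 H2 H3.
    replace (K / ((t + 1) * (t + 2)) * r ^ n * Rpower d (t + 2)) with (K * r ^ n / ((t + 1) * (t + 2)) * Rpower d (t + 2)) by (field; lra).
    apply duhamel_bound; [apply Hc|easy|easy|]. intros e y He H4 H5.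
    rewrite cut_pos by apply He. apply HK; [easy| |lra|lra]. destruct He. lra.
Qed.

Lemma duhamel_seq_deriv_b r t g g' : 0 < t -> weighted layer r t g -> weighted layer r t g' ->
  deriv_b layer g g' -> deriv_b layer (duhamel_seq g) (duhamel_seq g').
Proof.
  intros Ht H H' Hd n d b Hdb. apply duhamel_deriv_b.
  - now apply (cut_cont r t).
  - now apply (cut_cont r t).
  - now apply cut_deriv.
  - apply Hdb.
Qed.

Lemma char_int_seq_deriv_b r t g g' : 0 < t -> weighted layer r t g -> weighted layer r t g' ->
  deriv_b layer g g' -> deriv_b layer (char_int_seq g) (char_int_seq g').
Proof.
  intros Ht H H' Hd n d b Hdb. apply char_int_deriv_b.
  - now apply (cut_cont r t).
  - now apply (cut_cont r t).
  - now apply cut_deriv.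
  - apply Hdb.
Qed.

Lemma wC_char_int M : forall r t g, 0 < t -> wC layer M r t g -> wC layer M r (t + 1) (char_int_seq g).
Proof.
  induction M as [|M IH]; intros r t g Ht [H0 H].
  - split; [now apply weighted_char_int|easy].
  - destruct H as [[g' [Hb H]] _]. split; [now apply weighted_char_int|]. split; [|easy].
    exists (char_int_seq g'). split; [|now apply IH]. apply (char_int_seq_deriv_b r t); try easy. now apply (Ck_base false layer (weighted layer) M).
Qed.

End Duhamel.

(** * Inverting the Euler operator *)

Definition cs (h : R -> R -> R) : seqfun := fun _ => h.

Definition two (_ : R) : R := 2.
(** The domain of the approximate solutions: any layer containing d <= 1 and its
    neighbourhood would do. *)
Definition strip : R -> R -> Prop := layer two.

Lemma two_pos b : 0 < two b.
Proof. unfold two. lra. Qed.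

Lemma two_lip x y : Rabs (two x - two y) <= Rabs (x - y).
Proof. unfold two. rewrite Rminus_eq_0, Rabs_R0. apply Rabs_pos. Qed.

Lemma strip_open : open2 strip.
Proof. apply layer_open; apply two_lip. Qed.

Lemma strip_pos d b : strip d b -> 0 < d.
Proof. now intros []. Qed.

Lemma strip_seg d b : strip d b -> forall e, Rmin 1 d <= e <= Rmax 1 d -> strip e b.
Proof.
  intros [H1 H2] e He. unfold strip, layer, two in *. unfold Rmin, Rmax in He. destruct Rle_dec; lra.
Qed.

Definition strip_graded := weighted_graded strip strip_open.

Lemma weighted_slice D t h n : weighted D 1 t h -> weighted D 1 t (cs (h n)).
Proof.
  intros [H1 H2]. split; [intros m; apply (H1 n)|]. intros L. destruct (H2 L) as [K HK]. exists K.
  intros m d b. rewrite pow1. specialize (HK n d b). rewrite pow1 in HK. exact HK.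
Qed.

(** Inversion of h |-> h_dd - (a + 1) (a + 2) d^-2 h, whose homogeneous solutions
    are d^(a + 2) and d^(- a - 1). *)
Section Euler.
Variable a : R.
Hypothesis Ha : 0 < a.

(** Variation of parameters needs two primitives: from 0 where the integrand is
    integrable there, from 1 where it is not. *)
Definition int0 (g : R -> R -> R) : R -> R -> R := prim 0 (cut g).
Definition int1 (g : R -> R -> R) : R -> R -> R := prim 1 g.

Lemma cut_strip_cont t g : 0 < t -> weighted strip 1 t (cs g) ->
  forall d b, below two d b -> continuity_2d_pt (cut g) d b.
Proof. intros Ht H. apply (cut_cont two two_lip 1 t (cs g) O Ht H). Qed.

Lemma wC_int0 M : forall t g, 0 < t -> wC strip M 1 t (cs g) -> wC strip M 1 (t + 1) (cs (int0 g)).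
Proof.
  assert (Hbase : forall t g, 0 < t -> weighted strip 1 t (cs g) -> weighted strip 1 (t + 1) (cs (int0 g))).
  { intros t g Ht H. pose proof (cut_strip_cont t g Ht H) as Hc. split.
    - intros n d b [_ Hd]. apply (prim_cont (below two) 0 (below_open two two_lip) (below_seg two two_pos) (cut g) Hc).
      exact Hd.
    - intros L. destruct H as [_ H]. destruct (H L) as [K HK]. exists (K / (t + 1)).
      intros n d b Hd H1 H2 H3. rewrite pow1.
      replace (K / (t + 1) * 1 * Rpower d (t + 1)) with (K * Rpower d (t + 1) / (t + 1)) by (field; lra).
      apply RInt_pos_power_bound; [easy|apply Hd| |].
      + apply (prim_ex (below two) 0 (below_seg two two_pos) (cut g) Hc). apply Hd.
      + intros e He. rewrite cut_pos by lra. specialize (HK O e b). rewrite pow1, Rmult_1_r in HK.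
        apply HK; try lra. destruct Hd. unfold two in *. split; unfold two; lra. }
  induction M as [|M IH]; intros t g Ht [H0 H].
  - split; [now apply Hbase|easy].
  - destruct H as [[g' [Hb H]] _]. split; [now apply Hbase|]. split; [|easy].
    exists (cs (int0 (g' O))). split.
    + pose proof (Ck_base false strip (weighted strip) M 1 t g' H) as H'.
      intros n d b [Hd1 Hd2]. apply (prim_deriv_b (below two) 0 (below_open two two_lip) (below_seg two two_pos)).
      * now apply (cut_strip_cont t).
      * apply (cut_strip_cont t); [easy|]. now apply weighted_slice.
      * apply (cut_deriv two (cs g) g' O Hb).
      * exact Hd2.
    + apply IH; [easy|]. apply (Ck_ext false strip _ strip_graded M 1 t g'); [|easy].
      intros n d b Hd. unfold cs. rewrite <- (is_derive_unique _ _ _ (Hb n d b Hd)).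
      apply is_derive_unique, (Hb O d b Hd).
Qed.

Lemma int1_bound (f : R -> R) d t K : t < -1 -> 0 < d <= 1 -> ex_RInt f 1 d -> 0 <= K ->
  (forall e, d <= e <= 1 -> Rabs (f e) <= K * Rpower e t) ->
  Rabs (RInt f 1 d) <= K / - (t + 1) * Rpower d (t + 1).
Proof.
  intros Ht Hd Hex HK H.
  assert (I : is_RInt (fun e => K * Rpower e t) d 1
    (K / (t + 1) * Rpower 1 (t + 1) - K / (t + 1) * Rpower d (t + 1))).
  { apply (is_RInt_derive_R (fun e => K / (t + 1) * Rpower e (t + 1))).
    - intros e He. rewrite Rmin_left, Rmax_right in He by lra.
      apply (is_derive_val _ _ (K / (t + 1) * ((t + 1) * Rpower e (t + 1 - 1)))).
      + apply (is_derive_scal (fun e => Rpower e (t + 1))). apply is_derive_Reals.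
        apply derivable_pt_lim_power. lra.
      + replace (t + 1 - 1) with t by ring. field. lra.
    - intros e He. rewrite Rmin_left, Rmax_right in He by lra.
      apply (ex_derive_continuous (V := R_NormedModule)). apply (ex_derive_scal (fun e => Rpower e t)).
      eexists. apply is_derive_Reals. apply derivable_pt_lim_power. lra. }
  rewrite <- (opp_RInt_swap f d 1) by now apply ex_RInt_swap.
  change (opp (RInt f d 1)) with (- RInt f d 1). rewrite Rabs_Ropp.
  eapply Rle_trans; [apply abs_RInt_le; [lra|now apply ex_RInt_swap]|].
  apply Rle_trans with (RInt (fun e => K * Rpower e t) d 1).
  - apply RInt_le; [lra| |eexists; exact I|].
    + apply (ex_RInt_norm f). now apply ex_RInt_swap.
    + intros e He. apply H. lra.
  - rewrite (is_RInt_unique_R _ _ _ _ I).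
    replace (Rpower 1 (t + 1)) with 1 by (unfold Rpower; rewrite ln_1, Rmult_0_r, exp_0; easy).
    replace (K / - (t + 1) * Rpower d (t + 1)) with (- (K / (t + 1) * Rpower d (t + 1))) by (field; lra).
    assert (K / (t + 1) <= 0).
    { unfold Rdiv. assert (/ (t + 1) < 0) by (apply Rinv_lt_0_compat; lra). nra. }
    lra.
Qed.

Lemma wC_int1 M : forall t g, t < -1 -> wC strip M 1 t (cs g) -> wC strip M 1 (t + 1) (cs (int1 g)).
Proof.
  assert (Hbase : forall t g, t < -1 -> weighted strip 1 t (cs g) -> weighted strip 1 (t + 1) (cs (int1 g))).
  { intros t g Ht [Hc H]. split.
    - intros n d b Hd. apply (prim_cont strip 1 strip_open strip_seg g (Hc O)). exact Hd.
    - intros L. destruct (H (L + 1)) as [K HK]. exists (Rabs K / - (t + 1)).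
      intros n d b Hd H1 H2 H3. rewrite pow1, Rmult_1_r.
      pose proof (strip_pos d b Hd).
      apply int1_bound; [easy|lra| |apply Rabs_pos|].
      + apply (prim_ex strip 1 strip_seg g (Hc O)). apply Hd.
      + intros e He. specialize (HK O e b). rewrite pow1, Rmult_1_r in HK.
        eapply Rle_trans; [apply HK; try lra; apply (strip_seg d b Hd); rewrite Rmin_right, Rmax_left; lra|].
        apply Rmult_le_compat_r; [left; apply Rpower_pos|apply Rle_abs]. }
  induction M as [|M IH]; intros t g Ht [H0 H].
  - split; [now apply Hbase|easy].
  - destruct H as [[g' [Hb H]] _]. split; [now apply Hbase|]. split; [|easy].
    exists (cs (int1 (g' O))). split.
    + pose proof (Ck_base false strip (weighted strip) M 1 t g' H) as H'.
      intros n d b Hd. apply (prim_deriv_b strip 1 strip_open strip_seg).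
      * apply (proj1 H0 O).
      * apply (proj1 H' O).
      * intros e y Hey. apply (Hb O e y Hey).
      * exact Hd.
    + apply IH; [easy|]. apply (Ck_ext false strip _ strip_graded M 1 t g'); [|easy].
      intros n d b Hd. unfold cs. rewrite <- (is_derive_unique _ _ _ (Hb n d b Hd)).
      apply is_derive_unique, (Hb O d b Hd).
Qed.

Definition low (h : R -> R -> R) : R -> R -> R := int0 (fun e b => Rpower e (a + 2) * h e b).
Definition high (h : R -> R -> R) : R -> R -> R := int1 (fun e b => Rpower e (- a - 1) * h e b).

(** Up to sign, 2 a + 3 is the Wronskian of the two homogeneous solutions. *)
Definition euler_inv (h : R -> R -> R) (d b : R) : R :=
  / (2 * a + 3) * (Rpower d (a + 2) * high h d b - Rpower d (- a - 1) * low h d b).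

Definition euler_inv_d (h : R -> R -> R) (d b : R) : R :=
  / (2 * a + 3) * ((a + 2) * (Rpower d (a + 1) * high h d b) + (a + 1) * (Rpower d (- a - 2) * low h d b)).

Lemma wC_power M s : wC strip M 1 s (cs (fun d _ => Rpower d s)).
Proof. apply (wC_Rpower strip M s strip_open strip_pos). Qed.

Lemma wC_product M s1 s2 s g h : wC strip M 1 s1 (cs g) -> wC strip M 1 s2 (cs h) -> s = s1 + s2 ->
  wC strip M 1 s (cs (fun d b => g d b * h d b)).
Proof.
  intros Hg Hh ->. apply (Ck_mult_eq false strip _ strip_graded M 1 1 1 s1 s2 _ (cs g) (cs h)); [easy|easy|ring|ring].
Qed.

Lemma wC_low M s h : - a < s -> wC strip M 1 (s - 2) (cs h) -> wC strip M 1 (s + a + 1) (cs (low h)).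
Proof.
  intros Hs H. replace (s + a + 1) with ((s + a) + 1) by ring. apply wC_int0; [lra|].
  apply (wC_product M (a + 2) (s - 2)); [apply wC_power|easy|ring].
Qed.

Lemma wC_high M s h : s < a + 2 -> wC strip M 1 (s - 2) (cs h) -> wC strip M 1 (s - a - 2) (cs (high h)).
Proof.
  intros Hs H. replace (s - a - 2) with ((s - a - 3) + 1) by ring. apply wC_int1; [lra|].
  apply (wC_product M (- a - 1) (s - 2)); [apply wC_power|easy|ring].
Qed.

(** The lower bound on s makes the integral from 0 converge, the upper one makes
    the integral from 1 grow like a power as d tends to 0, so that the contribution
    of d near 1 does not dominate.  At s = a + 2 a logarithm would appear. *)
Lemma wC_euler_inv M s h : - a < s < a + 2 -> wC strip M 1 (s - 2) (cs h) -> wC strip M 1 s (cs (euler_inv h)).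
Proof.
  intros Hs H. apply (Ck_scal false strip _ strip_graded M (/ (2 * a + 3)) 1 s
    (cs (fun d b => Rpower d (a + 2) * high h d b - Rpower d (- a - 1) * low h d b))).
  apply (Ck_minus false strip _ strip_graded M 1 s (cs (fun d b => Rpower d (a + 2) * high h d b))
    (cs (fun d b => Rpower d (- a - 1) * low h d b))).
  - apply (wC_product M (a + 2) (s - a - 2)); [apply wC_power|apply wC_high; [lra|easy]|ring].
  - apply (wC_product M (- a - 1) (s + a + 1)); [apply wC_power|apply wC_low; [lra|easy]|ring].
Qed.

Lemma wC_euler_inv_d M s h : - a < s < a + 2 -> wC strip M 1 (s - 2) (cs h) -> wC strip M 1 (s - 1) (cs (euler_inv_d h)).
Proof.
  intros Hs H. apply (Ck_scal false strip _ strip_graded M (/ (2 * a + 3)) 1 (s - 1)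
    (cs (fun d b => (a + 2) * (Rpower d (a + 1) * high h d b) + (a + 1) * (Rpower d (- a - 2) * low h d b)))).
  apply (Ck_plus false strip _ strip_graded M 1 (s - 1) (cs (fun d b => (a + 2) * (Rpower d (a + 1) * high h d b)))
    (cs (fun d b => (a + 1) * (Rpower d (- a - 2) * low h d b)))).
  - apply (Ck_scal false strip _ strip_graded M (a + 2) 1 (s - 1) (cs (fun d b => Rpower d (a + 1) * high h d b))).
    apply (wC_product M (a + 1) (s - a - 2)); [apply wC_power|apply wC_high; [lra|easy]|ring].
  - apply (Ck_scal false strip _ strip_graded M (a + 1) 1 (s - 1) (cs (fun d b => Rpower d (- a - 2) * low h d b))).
    apply (wC_product M (- a - 2) (s + a + 1)); [apply wC_power|apply wC_low; [lra|easy]|ring].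
Qed.

Lemma is_derive_Rpower d q : 0 < d -> is_derive (fun y => Rpower y q) d (q * Rpower d (q - 1)).
Proof. intros H. apply is_derive_Reals. now apply derivable_pt_lim_power. Qed.

Lemma low_deriv s h d b : - a < s -> weighted strip 1 (s - 2) (cs h) -> strip d b ->
  is_derive (fun y => low h y b) d (Rpower d (a + 2) * h d b).
Proof.
  intros Hs H Hd. unfold low, int0.
  set (g := fun e b => Rpower e (a + 2) * h e b).
  replace (Rpower d (a + 2) * h d b) with (cut g d b) by (rewrite cut_pos; [easy|now apply strip_pos in Hd]).
  apply (prim_deriv_d (below two) 0 (below_open two two_lip) (below_seg two two_pos)).
  - apply (cut_strip_cont (s + a)); [lra|].
    apply (wC_product 0 (a + 2) (s - 2)); [apply wC_power|now split|ring].
  - apply Hd.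
Qed.

Lemma high_deriv s h d b : weighted strip 1 (s - 2) (cs h) -> strip d b ->
  is_derive (fun y => high h y b) d (Rpower d (- a - 1) * h d b).
Proof.
  intros H Hd. unfold high, int1.
  apply (prim_deriv_d strip 1 strip_open strip_seg (fun e b => Rpower e (- a - 1) * h e b)); [|easy].
  intros e y Hey. apply continuity_2d_pt_mult; [|apply (proj1 H O e y Hey)].
  apply cont2_power; [now apply strip_pos in Hey|apply continuity_2d_pt_id1].
Qed.

Lemma Rpower_S d t : 0 < d -> Rpower d (t + 1) = Rpower d t * d.
Proof. intros H. rewrite Rpower_plus, Rpower_1; easy. Qed.

Lemma euler_inv_deriv s h d b : - a < s -> weighted strip 1 (s - 2) (cs h) -> strip d b ->
  is_derive (fun y => euler_inv h y b) d (euler_inv_d h d b).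
Proof.
  intros Hs H Hd. pose proof (strip_pos d b Hd) as Hp. unfold euler_inv, euler_inv_d.
  eapply is_derive_val.
  - apply (is_derive_scal (fun y => Rpower y (a + 2) * high h y b - Rpower y (- a - 1) * low h y b)).
    apply (is_derive_minus_R (fun y => Rpower y (a + 2) * high h y b) (fun y => Rpower y (- a - 1) * low h y b)).
    + apply (is_derive_mult_R (fun y => Rpower y (a + 2)) (fun y => high h y b));
        [now apply is_derive_Rpower|now apply (high_deriv s)].
    + apply (is_derive_mult_R (fun y => Rpower y (- a - 1)) (fun y => low h y b));
        [now apply is_derive_Rpower|now apply (low_deriv s)].
  - replace (a + 2 - 1) with (a + 1) by ring. replace (- a - 1 - 1) with (- a - 2) by ring.
    replace (Rpower d (a + 2)) with (Rpower d (a + 1) * d) by (rewrite <- Rpower_S by easy; f_equal; ring).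
    unfold scal; simpl; unfold mult; simpl. ring.
Qed.

Lemma euler_inv_d_deriv s h d b : - a < s -> weighted strip 1 (s - 2) (cs h) -> strip d b ->
  is_derive (fun y => euler_inv_d h y b) d ((a + 1) * (a + 2) * Rpower d (-2) * euler_inv h d b + h d b).
Proof.
  intros Hs H Hd. pose proof (strip_pos d b Hd) as Hp. unfold euler_inv, euler_inv_d.
  eapply is_derive_val.
  - apply (is_derive_scal (fun y => (a + 2) * (Rpower y (a + 1) * high h y b) + (a + 1) * (Rpower y (- a - 2) * low h y b))).
    apply (is_derive_plus_R (fun y => (a + 2) * (Rpower y (a + 1) * high h y b)) (fun y => (a + 1) * (Rpower y (- a - 2) * low h y b))).
    + apply (is_derive_scal (fun y => Rpower y (a + 1) * high h y b)).
      apply (is_derive_mult_R (fun y => Rpower y (a + 1)) (fun y => high h y b)); [now apply is_derive_Rpower|now apply (high_deriv s)].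
    + apply (is_derive_scal (fun y => Rpower y (- a - 2) * low h y b)).
      apply (is_derive_mult_R (fun y => Rpower y (- a - 2)) (fun y => low h y b)); [now apply is_derive_Rpower|now apply (low_deriv s)].
  - assert (E1 : Rpower d (a + 1 - 1) = Rpower d (-2) * Rpower d (a + 2)) by (rewrite <- Rpower_plus; f_equal; ring).
    assert (E2 : Rpower d (- a - 2 - 1) = Rpower d (-2) * Rpower d (- a - 1)) by (rewrite <- Rpower_plus; f_equal; ring).
    assert (E3 : Rpower d (a + 1) * Rpower d (- a - 1) = 1).
    { rewrite <- Rpower_plus. replace (a + 1 + (- a - 1)) with 0 by ring. apply Rpower_zero. }
    assert (E4 : Rpower d (- a - 2) * Rpower d (a + 2) = 1).
    { rewrite <- Rpower_plus. replace (- a - 2 + (a + 2)) with 0 by ring. apply Rpower_zero. }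
    rewrite E1, E2. unfold scal; simpl; unfold mult; simpl.
    transitivity (/ (2 * a + 3) * ((a + 2) * ((a + 1) * (Rpower d (-2) * Rpower d (a + 2)) * high h d b
      + (Rpower d (a + 1) * Rpower d (- a - 1)) * h d b)
      + (a + 1) * ((- a - 2) * (Rpower d (-2) * Rpower d (- a - 1)) * low h d b
      + (Rpower d (- a - 2) * Rpower d (a + 2)) * h d b))); [ring|].
    rewrite E3, E4. field. lra.
Qed.

End Euler.

(** * Approximate solutions *)

(** The terms of degree 2, ..., i + 1 of the Taylor expansion of (1 + x)^q. *)
Fixpoint binom_mid (q : R) (i : nat) (x : R) : R :=
  match i with O => 0 | S i => binom_mid q i x + binom_coef q (S (S i)) * x ^ S (S i) end.

Lemma binom_split q i x : binom_rem q 0 x = 1 + q * x + binom_mid q i x + binom_rem q (S (S i)) x.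
Proof.
  induction i as [|i IH].
  - simpl. field.
  - rewrite IH. change (binom_rem q (S (S (S i))) x) with (binom_rem q (S (S i)) x - binom_coef q (S (S i)) * x ^ S (S i)).
    change (binom_mid q (S i) x) with (binom_mid q i x + binom_coef q (S (S i)) * x ^ S (S i)). ring.
Qed.

Lemma binom_mid_zero q i : binom_mid q i 0 = 0.
Proof.
  induction i as [|i IH]; [easy|].
  change (binom_mid q (S i) 0) with (binom_mid q i 0 + binom_coef q (S (S i)) * 0 ^ S (S i)). rewrite IH. simpl. ring.
Qed.

Lemma wCs_ext M s g h : (forall d b, strip d b -> g d b = h d b) ->
  wC strip M 1 s (cs g) -> wC strip M 1 s (cs h).
Proof. intros E. apply (Ck_ext false strip _ strip_graded). intros n d b Hd. exact (E d b Hd). Qed.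

Lemma wCs_weaken M s s' g : s' <= s -> wC strip M 1 s (cs g) -> wC strip M 1 s' (cs g).
Proof. intros H. apply wC_weaken; [apply strip_pos|lra|easy]. Qed.

Lemma wCs_plus M s g h : wC strip M 1 s (cs g) -> wC strip M 1 s (cs h) ->
  wC strip M 1 s (cs (fun d b => g d b + h d b)).
Proof. apply (Ck_plus false strip _ strip_graded M 1 s (cs g) (cs h)). Qed.

Lemma wCs_scal M s c g : wC strip M 1 s (cs g) -> wC strip M 1 s (cs (fun d b => c * g d b)).
Proof. apply (Ck_scal false strip _ strip_graded M c 1 s (cs g)). Qed.

Lemma wCs_le M M' s g : (M' <= M)%nat -> wC strip M 1 s (cs g) -> wC strip M' 1 s (cs g).
Proof. apply Ck_le. Qed.

Lemma wCs_deriv M s g : wC strip (S M) 1 s (cs g) ->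
  wC strip M 1 s (cs (fun d b => Derive (fun y => g d y) b)) /\
  (forall d b, strip d b -> ex_derive (fun y => g d y) b).
Proof.
  intros [_ [[g' [Hb H]] _]]. split.
  - apply (Ck_ext false strip _ strip_graded M 1 s g'); [|easy].
    intros n d b Hd. symmetry. apply is_derive_unique, (Hb n d b Hd).
  - intros d b Hd. exists (g' O d b). apply (Hb O d b Hd).
Qed.

Lemma wCs_pow M t g i : 0 <= t -> wC strip M 1 t (cs g) -> wC strip M 1 t (cs (fun d b => g d b ^ S i)).
Proof.
  intros Ht H. induction i as [|i IH].
  - apply (wCs_ext M t g); [intros; simpl; ring|easy].
  - apply (wCs_weaken M (t + t)); [lra|]. now apply (wC_product M t t).
Qed.

Lemma wCs_pow_diff M t s g h i : 0 <= t -> wC strip M 1 t (cs g) -> wC strip M 1 t (cs h) ->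
  wC strip M 1 s (cs (fun d b => g d b - h d b)) ->
  wC strip M 1 (s + t) (cs (fun d b => g d b ^ S (S i) - h d b ^ S (S i))).
Proof.
  intros Ht Hg Hh H. induction i as [|i IH].
  - apply (wCs_ext M _ (fun d b => (g d b - h d b) * (g d b + h d b))); [intros; simpl; ring|].
    apply (wC_product M s t); [easy|now apply wCs_plus|ring].
  - apply (wCs_ext M _ (fun d b => g d b * (g d b ^ S (S i) - h d b ^ S (S i)) + (g d b - h d b) * h d b ^ S (S i)));
      [intros; simpl; ring|].
    apply wCs_plus.
    + apply (wCs_weaken M (t + (s + t))); [lra|]. now apply (wC_product M t (s + t)).
    + apply (wC_product M s t); [easy|now apply wCs_pow|ring].
Qed.

(** As binom_mid has no linear term, differences gain the factor d^t. *)
Lemma wCs_binom_mid_diff M q t s g h i : 0 <= t -> wC strip M 1 t (cs g) -> wC strip M 1 t (cs h) ->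
  wC strip M 1 s (cs (fun d b => g d b - h d b)) ->
  wC strip M 1 (s + t) (cs (fun d b => binom_mid q i (g d b) - binom_mid q i (h d b))).
Proof.
  intros Ht Hg Hh H. induction i as [|i IH].
  - apply (wCs_ext M _ (fun d b => 0 * (g d b ^ 2 - h d b ^ 2))); [intros; simpl; ring|].
    apply wCs_scal. now apply wCs_pow_diff.
  - apply (wCs_ext M _ (fun d b => (binom_mid q i (g d b) - binom_mid q i (h d b))
      + binom_coef q (S (S i)) * (g d b ^ S (S i) - h d b ^ S (S i)))).
    + intros d b _. change (binom_mid q (S i) (g d b)) with (binom_mid q i (g d b) + binom_coef q (S (S i)) * g d b ^ S (S i)).
      change (binom_mid q (S i) (h d b)) with (binom_mid q i (h d b) + binom_coef q (S (S i)) * h d b ^ S (S i)). ring.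
    + apply wCs_plus; [easy|]. apply wCs_scal. now apply wCs_pow_diff.
Qed.

Lemma wCs_of_b M g : smooth1 M g -> wC strip M 1 0 (cs (fun _ b => g b)).
Proof. apply (smooth1_wC strip M g strip_open strip_pos). Qed.

Section Parametrix.
Variables (a q gam : R) (N : nat) (W : R -> R).
Hypothesis Ha : 0 < a.
Hypothesis Hq : a * q = a + 2.
Hypothesis Hgam : 0 < gam <= 1.
Hypothesis HW : forall b, 0 < W b.

(** The correction z relative to the leading term W d^(-a). *)
Definition rescale (z : R -> R -> R) (d b : R) : R := z d b * (Rpower d a * Rpower (W b) (-1)).

(** The d-derivative of the leading term. *)
Definition lead_d (d b : R) : R := - a * (W b * Rpower d (- a - 1)).

(** The right-hand side of the equation for the correction z with d-derivative
    zd.  The power nonlinearity is replaced by its Taylor polynomial, so that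
    source makes sense without bounds on z and is smooth in it. *)
Definition source (z zd : R -> R -> R) (d b : R) : R :=
  - Derive (fun y => lead_d d y + zd d y) b
  + a * (a + 1) * (W b * (Rpower d (- a - 2) * binom_mid q N (rescale z d b))).

Lemma wCs_rescale M s z : smooth1 M W -> wC strip M 1 s (cs z) -> wC strip M 1 (s + a) (cs (rescale z)).
Proof.
  intros HC H. apply (wC_product M s a (s + a) z (fun d b => Rpower d a * Rpower (W b) (-1))); [easy| |easy].
  apply (wC_product M a 0); [apply wC_power| |ring].
  apply wCs_of_b. now apply smooth1_power.
Qed.

Lemma wCs_lead_d M : smooth1 M W -> wC strip M 1 (- a - 1) (cs lead_d).
Proof.
  intros H. apply wCs_scal. apply (wC_product M 0 (- a - 1)); [now apply wCs_of_b|apply wC_power|ring].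
Qed.

(** Both parts of source gain on s - 2: v_db has one d-derivative instead of two,
    i.e. a gain of 1 >= gam, and the quadratic terms gain the size d^gam of the
    relative corrections.  The loss is the b-derivative. *)
Lemma source_diff M s z zd z' zd' : smooth1 (S M) W ->
  wC strip M 1 (gam - a) (cs z) -> wC strip M 1 (gam - a) (cs z') ->
  wC strip M 1 s (cs (fun d b => z' d b - z d b)) ->
  wC strip (S M) 1 (gam - a - 1) (cs zd) -> wC strip (S M) 1 (gam - a - 1) (cs zd') ->
  wC strip (S M) 1 (s - 1) (cs (fun d b => zd' d b - zd d b)) ->
  wC strip M 1 (s + gam - 2) (cs (fun d b => source z' zd' d b - source z zd d b)).
Proof.
  intros HC Hz Hz' Hdz Hzd Hzd' Hdzd.
  apply (wCs_ext M _ (fun d b => -1 * Derive (fun y => zd' d y - zd d y) b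
    + a * (a + 1) * (W b * (Rpower d (- a - 2) * (binom_mid q N (rescale z' d b) - binom_mid q N (rescale z d b)))))).
  - intros d b Hd. unfold source.
    assert (E1 : ex_derive (fun y => zd d y) b) by now apply (wCs_deriv _ _ _ Hzd).
    assert (E2 : ex_derive (fun y => zd' d y) b) by now apply (wCs_deriv _ _ _ Hzd').
    assert (E3 : ex_derive (fun y => lead_d d y) b) by now apply (wCs_deriv _ _ _ (wCs_lead_d _ HC)).
    rewrite !Derive_plus, Derive_minus by easy. ring.
  - apply wCs_plus.
    + apply wCs_scal. apply (wCs_weaken M (s - 1)); [lra|]. now apply wCs_deriv.
    + apply wCs_scal. apply (wC_product M 0 (s + gam - 2)); [apply wCs_of_b; now apply smooth1_pred| |ring].
      apply (wC_product M (- a - 2) (s + a + gam)); [apply wC_power| |ring].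
      apply smooth1_pred in HC. apply wCs_binom_mid_diff; [lra| | |].
      * replace gam with (gam - a + a) by ring. now apply wCs_rescale.
      * replace gam with (gam - a + a) by ring. now apply wCs_rescale.
      * apply (wCs_ext M _ (rescale (fun d b => z' d b - z d b))); [intros; unfold rescale; ring|].
        now apply wCs_rescale.
Qed.

Definition zero_fun (_ _ : R) : R := 0.

Lemma source_zero M : smooth1 (S M) W -> wC strip M 1 (gam - a - 2) (cs (source zero_fun zero_fun)).
Proof.
  intros HC. apply (wCs_ext M _ (fun d b => -1 * Derive (fun y => lead_d d y) b)).
  - intros d b Hd. unfold source, rescale, zero_fun. rewrite Rmult_0_l, binom_mid_zero.
    rewrite (Derive_ext (fun y => lead_d d y + 0) (fun y => lead_d d y)); [ring|intros; ring].
  - apply wCs_scal. apply (wCs_weaken M (- a - 1)); [lra|]. apply wCs_deriv. now apply wCs_lead_d.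
Qed.

(** The triple is the correction, its d-derivative and the error E, that is the
    part of source not yet accounted for.  Each step corrects by the Euler
    inverse of the current error; the new error is the change in source. *)
Fixpoint corrections (j : nat) : (R -> R -> R) * (R -> R -> R) * (R -> R -> R) :=
  match j with
  | O => (zero_fun, zero_fun, source zero_fun zero_fun)
  | S j =>
      let '(z, zd, E) := corrections j in
      let z' := fun d b => z d b + euler_inv a E d b in
      let zd' := fun d b => zd d b + euler_inv_d a E d b in
      (z', zd', fun d b => source z' zd' d b - source z zd d b)
  end.

Definition corrections_spec (j n : nat) : Prop :=
  let '(z, zd, E) := corrections j in
  wC strip (S n) 1 (gam - a) (cs z) /\ wC strip (S n) 1 (gam - a - 1) (cs zd) /\
  wC strip n 1 (INR (S j) * gam - a - 2) (cs E) /\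
  deriv_d strip (cs z) (cs zd) /\
  deriv_d strip (cs zd) (cs (fun d b => (a + 1) * (a + 2) * Rpower d (-2) * z d b + source z zd d b - E d b)).

(** One step raises the exponent of the error by gam and uses one more b-derivative
    of W.  The bound on j gam keeps the exponents in the range of the Euler
    inverse. *)
Lemma corrections_induct j : forall n, INR j * gam < 2 * a + 2 -> smooth1 (S (j + n)) W -> corrections_spec j n.
Proof.
  induction j as [|j IH]; intros n Hj HC.
  - unfold corrections_spec. cbn [corrections]. refine (conj _ (conj _ (conj _ (conj _ _)))).
    + apply (wCs_ext _ _ (fun d b => 0 * Rpower d (gam - a))); [intros; unfold zero_fun; ring|]. apply wCs_scal, wC_power.
    + apply (wCs_ext _ _ (fun d b => 0 * Rpower d (gam - a - 1))); [intros; unfold zero_fun; ring|]. apply wCs_scal, wC_power.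
    + simpl. rewrite Rmult_1_l. now apply source_zero.
    + intros m d b Hd. apply (is_derive_const_R 0).
    + intros m d b Hd. unfold cs. apply (is_derive_val _ _ 0); [apply (is_derive_const_R 0)|unfold zero_fun at 1; ring].
  - rewrite S_INR in Hj. assert (HI : corrections_spec j (S n)).
    { apply IH; [lra|]. now replace (S (j + S n)) with (S (S j + n)) by lia. }
    assert (HC' : smooth1 (S n) W) by (apply (smooth1_le _ (S (S j + n))); [lia|easy]).
    unfold corrections_spec in *. simpl corrections. destruct (corrections j) as [[z zd] E].
    destruct HI as [Hz [Hzd [HE [D1 D2]]]]. pose proof (pos_INR j) as Pj.
    (* s is the exponent of the (j + 1)-st correction *)
    set (s := INR (S j) * gam - a) in *.
    assert (Hs : - a < s < a + 2) by (unfold s; rewrite S_INR; nra).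
    assert (Hsg : gam - a <= s) by (unfold s; rewrite S_INR; nra).
    assert (HL : wC strip (S n) 1 s (cs (euler_inv a E))) by now apply wC_euler_inv.
    assert (HLd : wC strip (S n) 1 (s - 1) (cs (euler_inv_d a E))) by now apply wC_euler_inv_d.
    assert (HE0 : weighted strip 1 (s - 2) (cs E)) by apply (Ck_base false strip (weighted strip) _ _ _ _ HE).
    apply (wCs_le (S (S n)) (S n)) in Hz; [|lia]. apply (wCs_le (S (S n)) (S n)) in Hzd; [|lia].
    assert (Hz' : wC strip (S n) 1 (gam - a) (cs (fun d b => z d b + euler_inv a E d b))).
    { apply wCs_plus; [easy|]. now apply (wCs_weaken _ s). }
    assert (Hzd' : wC strip (S n) 1 (gam - a - 1) (cs (fun d b => zd d b + euler_inv_d a E d b))).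
    { apply wCs_plus; [easy|]. apply (wCs_weaken _ (s - 1)); [lra|easy]. }
    refine (conj Hz' (conj Hzd' (conj _ (conj _ _)))).
    + replace (INR (S (S j)) * gam - a - 2) with (s + gam - 2) by (unfold s; rewrite (S_INR (S j)); ring).
      apply source_diff; try easy; try (apply (wCs_le (S n) n); [lia|easy]).
      * apply (wCs_ext _ _ (euler_inv a E)); [intros; ring|]. apply (wCs_le (S n) n); [lia|easy].
      * apply (wCs_ext _ _ (euler_inv_d a E)); [intros; ring|easy].
    + intros m d b Hd. apply is_derive_plus_R; [now apply (D1 m)|]. apply (euler_inv_deriv a s); [lra|easy|easy].
    + intros m d b Hd. eapply is_derive_val.
      * apply is_derive_plus_R; [now apply (D2 m)|]. apply (euler_inv_d_deriv a Ha s); [lra|easy|easy].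
      * unfold cs. ring.
Qed.

Definition profile (z : R -> R -> R) (d b : R) : R := W b * Rpower d (- a) + z d b.
Definition profile_d (zd : R -> R -> R) (d b : R) : R := lead_d d b + zd d b.

(** The equation satisfied by the approximate solution, with the true power in
    place of its Taylor polynomial: a q = a + 2 turns the linear Taylor term into
    the potential (a + 1) (a + 2) d^-2 of the Euler operator. *)
Lemma profile_deriv z zd E :
  deriv_d strip (cs z) (cs zd) ->
  deriv_d strip (cs zd) (cs (fun d b => (a + 1) * (a + 2) * Rpower d (-2) * z d b + source z zd d b - E d b)) ->
  deriv_d strip (cs (profile z)) (cs (profile_d zd)) /\
  (forall d b, strip d b -> Rabs (rescale z d b) <= / 2 ->
    is_derive (fun y => profile_d zd y b) d
      (a * (a + 1) * (W b * (Rpower d (- a - 2) * (binom_rem q 0 (rescale z d b) - binom_rem q (S (S N)) (rescale z d b))))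
       - E d b - Derive (fun y => profile_d zd d y) b)).
Proof.
  intros D1 D2. split.
  - intros n d b Hd. pose proof (strip_pos d b Hd). apply is_derive_plus_R; [|now apply (D1 n)].
    apply (is_derive_val _ _ (W b * (- a * Rpower d (- a - 1)))).
    + apply (is_derive_scal (fun y => Rpower y (- a))). now apply is_derive_Rpower.
    + unfold lead_d. ring.
  - intros d b Hd Hz. pose proof (strip_pos d b Hd).
    apply (is_derive_val _ _ (- a * (W b * ((- a - 1) * Rpower d (- a - 1 - 1)))
      + ((a + 1) * (a + 2) * Rpower d (-2) * z d b + source z zd d b - E d b))).
    + apply is_derive_plus_R; [|now apply (D2 O)].
      apply (is_derive_scal (fun y => W b * Rpower y (- a - 1))).
      apply (is_derive_scal (fun y => Rpower y (- a - 1))). now apply is_derive_Rpower.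
    + rewrite (binom_split q N). unfold source. fold (profile_d zd).
      replace (- a - 1 - 1) with (- a - 2) by ring.
      assert (Ez : Rpower d (-2) * z d b = W b * (Rpower d (- a - 2) * rescale z d b)).
      { unfold rescale.
        replace (Rpower d (-2)) with (Rpower d (- a - 2) * Rpower d a) by (rewrite <- Rpower_plus; f_equal; ring).
        transitivity ((W b * Rpower (W b) (-1)) * (Rpower d (- a - 2) * Rpower d a * z d b)); [rewrite Rpower_inv_r by easy; ring|ring]. }
      replace ((a + 1) * (a + 2) * Rpower d (-2) * z d b) with ((a + 1) * (a * q) * (Rpower d (-2) * z d b)) by (rewrite Hq; ring).
      rewrite Ez. change (fun y => lead_d d y + zd d y) with (fun y => profile_d zd d y). ring.
Qed.

End Parametrix.

(** * Limits of geometrically convergent sequences *)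

Definition seqlim (h : seqfun) (d b : R) : R := real (Lim_seq (fun n => h n d b)).

Lemma geometric_limit (u : nat -> R) C r : 0 <= r < 1 -> (forall n, Rabs (u (S n) - u n) <= C * r ^ n) ->
  is_lim_seq u (real (Lim_seq u)) /\ forall n, Rabs (u n - real (Lim_seq u)) <= C / (1 - r) * r ^ n.
Proof.
  intros Hr H.
  assert (Hk : forall n k, Rabs (u (n + k)%nat - u n) <= C / (1 - r) * (r ^ n - r ^ (n + k))).
  { intros n k. induction k as [|k IH].
    - rewrite Nat.add_0_r, !Rminus_eq_0, Rabs_R0. lra.
    - rewrite Nat.add_succ_r. replace (u (S (n + k)) - u n) with ((u (S (n + k)) - u (n + k)%nat) + (u (n + k)%nat - u n)) by ring.
      eapply Rle_trans; [apply Rabs_triang|]. specialize (H (n + k)%nat).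
      replace (C / (1 - r) * (r ^ n - r ^ S (n + k))) with (C * r ^ (n + k) + C / (1 - r) * (r ^ n - r ^ (n + k))); [lra|].
      simpl. field. lra. }
  assert (HC : 0 <= C). { specialize (H O). pose proof (Rabs_pos (u 1%nat - u O)). simpl in H. lra. }
  assert (HC' : 0 <= C / (1 - r)) by (apply Rmult_le_pos; [easy|left; apply Rinv_0_lt_compat; lra]).
  assert (Hk' : forall n k, Rabs (u (n + k)%nat - u n) <= C / (1 - r) * r ^ n).
  { intros n k. eapply Rle_trans; [apply Hk|]. apply Rmult_le_compat_l; [easy|]. pose proof (pow_le r (n + k) (proj1 Hr)). lra. }
  assert (Hex : ex_finite_lim_seq u).
  { apply ex_lim_seq_cauchy_corr. intros eps.
    assert (L : is_lim_seq (fun n => C / (1 - r) * r ^ n) 0).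
    { replace (Finite 0) with (Rbar_mult (C / (1 - r)) 0) by (simpl; f_equal; ring).
      apply is_lim_seq_scal_l. apply is_lim_seq_geom. rewrite Rabs_pos_eq; lra. }
    apply is_lim_seq_spec in L. destruct (L eps) as [N HN]. exists N.
    assert (Hnm : forall n m, (N <= n)%nat -> (n <= m)%nat -> Rabs (u m - u n) < eps).
    { intros n m Hn Hm. replace m with (n + (m - n))%nat by lia. eapply Rle_lt_trans; [apply Hk'|].
      specialize (HN n Hn). rewrite Rminus_0_r in HN. eapply Rle_lt_trans; [apply Rle_abs|exact HN]. }
    intros n m Hn Hm. destruct (Nat.le_ge_cases n m) as [L'|L'].
    - rewrite Rabs_minus_sym. now apply Hnm.
    - now apply Hnm. }
  pose proof (Lim_seq_correct' u Hex) as HL. split; [exact HL|].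
  intros n. rewrite Rabs_minus_sym.
  apply (is_lim_seq_le (fun k => Rabs (u (k + n)%nat - u n)) (fun _ => C / (1 - r) * r ^ n)
    (Rabs (real (Lim_seq u) - u n)) (C / (1 - r) * r ^ n)).
  - intros k. rewrite Nat.add_comm. apply Hk'.
  - apply (is_lim_seq_abs _ (Finite (real (Lim_seq u) - u n))).
    apply is_lim_seq_minus'; [|apply is_lim_seq_const]. now apply -> is_lim_seq_incr_n.
  - apply is_lim_seq_const.
Qed.

Section Limit.
Variable D : R -> R -> Prop.
Hypothesis HO : open2 D.
Hypothesis HD : forall d b, D d b -> 0 < d.
Hypothesis HD1 : forall d b, D d b -> d <= 1.
Variable r : R.
Hypothesis Hr : 0 < r < 1.
Let G := weighted_graded D HO.

Definition steps (h : seqfun) : seqfun := fun n d b => h (S n) d b - h n d b.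

Lemma steps_local t h d b : weighted D r t (steps h) -> D d b ->
  exists C, locally_2d (fun u v => D u v /\ forall n, Rabs (h (S n) u v - h n u v) <= C * r ^ n) d b.
Proof.
  intros [_ H] Hd. destruct (H (Rabs b + 3)) as [K HK].
  destruct (HO d b Hd) as [e1 H1].
  assert (Hc : continuity_2d_pt (fun x _ => Rpower x t) d b).
  { apply cont2_power; [now apply (HD d b)|apply continuity_2d_pt_id1]. }
  destruct (cont2_bounded_near _ d b Hc) as [e2 H2].
  exists (Rabs K * (Rabs (Rpower d t) + 1)).
  assert (Hm : 0 < Rmin (Rmin e1 e2) 1) by (repeat apply Rmin_pos; try apply cond_pos; lra).
  exists (mkposreal _ Hm). intros u v Hu Hv. simpl in *.
  pose proof (Rmin_l (Rmin e1 e2) 1). pose proof (Rmin_r (Rmin e1 e2) 1).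
  pose proof (Rmin_l e1 e2). pose proof (Rmin_r e1 e2).
  assert (Duv : D u v) by (apply H1; lra). split; [easy|]. intros n.
  specialize (H2 u v ltac:(lra) ltac:(lra)). pose proof (HD u v Duv). pose proof (HD1 u v Duv).
  apply Rabs_def2 in Hv as Hv'. pose proof (Rle_abs b). pose proof (Rle_abs (- b)). rewrite Rabs_Ropp in *.
  eapply Rle_trans; [apply HK; [easy|easy|lra|lra]|].
  pose proof (pow_le r n ltac:(lra)). pose proof (Rpower_pos u t). rewrite (Rabs_pos_eq (Rpower u t)) in H2 by lra.
  apply Rle_trans with (Rabs K * r ^ n * Rpower u t).
  - apply Rmult_le_compat_r; [lra|]. apply Rmult_le_compat_r; [lra|apply Rle_abs].
  - replace (Rabs K * (Rabs (Rpower d t) + 1) * r ^ n) with (Rabs K * r ^ n * (Rabs (Rpower d t) + 1)) by ring.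
    apply Rmult_le_compat_l; [|lra]. apply Rmult_le_pos; [apply Rabs_pos|lra].
Qed.

Lemma lim_local t h d b : weighted D r t (steps h) -> D d b ->
  exists C, locally_2d (fun u v => D u v /\ forall n, Rabs (h n u v - seqlim h u v) <= C * r ^ n) d b.
Proof.
  intros H Hd. destruct (steps_local t h d b H Hd) as [C [e He]]. exists (C / (1 - r)).
  exists e. intros u v Hu Hv. destruct (He u v Hu Hv) as [Duv Hn]. split; [easy|].
  apply (geometric_limit (fun n => h n u v) C r); [lra|easy].
Qed.

Lemma lim_is_lim t h d b : weighted D r t (steps h) -> D d b -> is_lim_seq (fun n => h n d b) (seqlim h d b).
Proof.
  intros H Hd. destruct (steps_local t h d b H Hd) as [C HC]. apply locally_2d_singleton in HC.
  apply (geometric_limit (fun n => h n d b) C r); [lra|apply HC].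
Qed.

Lemma geom_small C eps : 0 < eps -> exists N, forall n, (N <= n)%nat -> C * r ^ n < eps.
Proof.
  intros He. assert (L : is_lim_seq (fun n => C * r ^ n) 0).
  { replace (Finite 0) with (Rbar_mult C 0) by (simpl; f_equal; ring).
    apply is_lim_seq_scal_l. apply is_lim_seq_geom. rewrite Rabs_pos_eq; lra. }
  apply is_lim_seq_spec in L. destruct (L (mkposreal _ He)) as [N HN]. exists N. intros n Hn.
  specialize (HN n Hn). simpl in HN. rewrite Rminus_0_r in HN. eapply Rle_lt_trans; [apply Rle_abs|exact HN].
Qed.

Lemma weighted_lim t h : weighted D 1 t h -> weighted D r t (steps h) -> weighted D 1 t (cs (seqlim h)).
Proof.
  intros [H1 H2] Hst. split.
  - intros m d b Hd eps. unfold cs. destruct (lim_local t h d b Hst Hd) as [C [e1 He1]].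
    assert (H3 : 0 < eps / 3) by (pose proof (cond_pos eps); lra).
    destruct (geom_small C _ H3) as [N HN]. specialize (HN N (le_n N)).
    destruct (H1 N d b Hd (mkposreal _ H3)) as [e2 He2]. simpl in He2.
    assert (Hm : 0 < Rmin e1 e2) by (apply Rmin_pos; apply cond_pos).
    exists (mkposreal _ Hm). intros u v Hu Hv. simpl in *.
    pose proof (Rmin_l e1 e2). pose proof (Rmin_r e1 e2).
    destruct (He1 u v ltac:(lra) ltac:(lra)) as [_ A1]. specialize (A1 N).
    destruct (He1 d b ltac:(rewrite Rminus_eq_0, Rabs_R0; apply cond_pos) ltac:(rewrite Rminus_eq_0, Rabs_R0; apply cond_pos)) as [_ A2].
    specialize (A2 N). specialize (He2 u v ltac:(lra) ltac:(lra)).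
    replace (seqlim h u v - seqlim h d b) with (- (h N u v - seqlim h u v) + (h N u v - h N d b) + (h N d b - seqlim h d b)) by ring.
    eapply Rle_lt_trans; [apply Rabs_triang|].
    pose proof (Rabs_triang (- (h N u v - seqlim h u v)) (h N u v - h N d b)) as T. rewrite Rabs_Ropp in T. lra.
  - intros L. destruct (H2 L) as [K HK]. exists K. intros n d b Hd H3 H4 H5. unfold cs. rewrite pow1, Rmult_1_r.
    apply (is_lim_seq_le (fun n => Rabs (h n d b)) (fun _ => K * Rpower d t) (Rabs (seqlim h d b)) (K * Rpower d t)).
    + intros k. specialize (HK k d b Hd H3 H4 H5). rewrite pow1, Rmult_1_r in HK. easy.
    + apply (is_lim_seq_abs _ (Finite (seqlim h d b))). now apply (lim_is_lim t).
    + apply is_lim_seq_const.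
Qed.

Lemma lim_CVU h d b (e : posreal) C : (forall v, Rabs (v - b) < e -> forall n, Rabs (h n d v - seqlim h d v) <= C * r ^ n) ->
  CVU_dom (fun n y => h n d y) (fun y => Rabs (y - b) < e).
Proof.
  intros H eps. destruct (geom_small C eps (cond_pos eps)) as [N HN]. exists N. intros n Hn y Hy.
  eapply Rle_lt_trans; [apply (H y Hy)|]. now apply HN.
Qed.

(** Locally uniform convergence of the derivatives lets the limit be differentiated
    term by term. *)
Lemma wC_lim M : forall t h, wC D M 1 t h -> wC D M r t (steps h) -> wC D M 1 t (cs (seqlim h)).
Proof.
  induction M as [|M IH]; intros t h H K.
  - split; [|easy]. apply weighted_lim; [apply H|apply K].
  - pose proof (Ck_base false D (weighted D) _ _ _ _ H) as H0. pose proof (Ck_base false D (weighted D) _ _ _ _ K) as K0.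
    split; [now apply weighted_lim|]. split; [|easy].
    pose proof K as K1. destruct H as [_ [[h' [Hb H]] _]].
    assert (Dst : deriv_b D (steps h) (steps h')) by (intros n d b Hd; apply is_derive_minus_R; now apply Hb).
    assert (K' : wC D M r t (steps h')) by now apply (Ck_deriv_b false D (weighted D) M r t (steps h)).
    exists (cs (seqlim h')). split; [|now apply IH].
    intros n d b Hd. unfold cs.
    pose proof (Ck_base false D (weighted D) _ _ _ _ K') as K0'. pose proof (Ck_base false D (weighted D) _ _ _ _ H) as H0'.
    destruct (lim_local t h d b K0 Hd) as [C1 [e1 E1]]. destruct (lim_local t h' d b K0' Hd) as [C2 [e2 E2]].
    assert (Hm : 0 < Rmin e1 e2) by (apply Rmin_pos; apply cond_pos). set (e := mkposreal _ Hm).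
    assert (A1 : forall v, Rabs (v - b) < e -> forall n, Rabs (h n d v - seqlim h d v) <= C1 * r ^ n).
    { intros v Hv. apply E1; [rewrite Rminus_eq_0, Rabs_R0; apply cond_pos|].
      simpl in Hv. pose proof (Rmin_l e1 e2). lra. }
    assert (A2 : forall v, Rabs (v - b) < e -> D d v /\ forall n, Rabs (h' n d v - seqlim h' d v) <= C2 * r ^ n).
    { intros v Hv. apply E2; [rewrite Rminus_eq_0, Rabs_R0; apply cond_pos|].
      simpl in Hv. pose proof (Rmin_r e1 e2). lra. }
    assert (ED : forall n y, Rabs (y - b) < e -> Derive (fun y => h n d y) y = h' n d y).
    { intros k y Hy. apply is_derive_unique, Hb. now apply A2. }
    assert (Hop : open (fun y => Rabs (y - b) < e)).
    { intros y Hy. assert (H3 : 0 < e - Rabs (y - b)) by lra. exists (mkposreal _ H3). intros z Hz.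
      replace (z - b) with ((z - y) + (y - b)) by ring. eapply Rle_lt_trans; [apply Rabs_triang|].
      unfold ball in Hz; simpl in Hz; unfold AbsRing_ball, abs, minus, plus, opp in Hz; simpl in Hz.
      unfold Rminus at 1. simpl. lra. }
    assert (Hb0 : Rabs (b - b) < e) by (rewrite Rminus_eq_0, Rabs_R0; apply cond_pos).
    assert (Q : is_derive (fun y => real (Lim_seq (fun n => h n d y))) b (real (Lim_seq (fun n => Derive (fun y => h n d y) b)))).
    { apply (CVU_Derive (fun n y => h n d y) (fun y => Rabs (y - b) < e)); [easy| | | | | |easy].
      - intros x y z Hx Hz Hxyz. apply Rabs_def2 in Hx. apply Rabs_def2 in Hz. apply Rabs_def1; lra.
      - now apply (lim_CVU h d b e C1).
      - intros k y Hy. eexists. apply Hb. now apply A2.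
      - intros k y Hy. apply continuity_pt_filterlim.
        apply (continuous_ext_loc _ (fun y => h' k d y)).
        + generalize (Hop y Hy). apply filter_imp. intros z Hz. symmetry. now apply ED.
        + apply (cont2_slice_b (h' k)). apply (proj1 H0'). now apply A2.
      - intros eps. destruct (lim_CVU h' d b e C2 (fun v Hv => proj2 (A2 v Hv)) eps) as [N HN].
        exists N. intros k Hk y Hy. specialize (HN k Hk y Hy).
        rewrite (ED k y Hy), (Lim_seq_ext (fun k => Derive (fun y => h k d y) y) (fun k => h' k d y)); [easy|].
        intros i. now apply ED. }
    unfold seqlim. rewrite (Lim_seq_ext (fun n => h' n d b) (fun n => Derive (fun y => h n d y) b)); [exact Q|].
    intros k. symmetry. now apply ED.
Qed.

End Limit.

(** * Picard iteration in a thin layer *)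

Section Picard.
Variable rho : R -> R.
Hypothesis rho_pos : forall b, 0 < rho b.
Hypothesis rho_lip : forall x y, Rabs (rho x - rho y) <= Rabs (x - y).
Hypothesis rho_le1 : forall b, rho b <= 1.

Let D := layer rho.
Let HO : open2 D := layer_open rho rho_lip.
Let HD : forall d b, D d b -> 0 < d := layer_pos rho.
Let G := weighted_graded D HO.

Variables s theta : R.
Hypothesis Hs : 2 < s.
Hypothesis Htheta : 0 <= theta < 1.

(** Integrands that duhamel turns into functions of size d^s. *)
Let adm (k : R -> R -> R) : Prop := weighted D 1 (s - 2) (cs k).

Lemma adm_cont k : adm k -> forall d b, below rho d b -> continuity_2d_pt (cut k) d b.
Proof. intros H. apply (cut_cont rho rho_lip 1 (s - 2) (cs k) O); [lra|exact H]. Qed.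

Lemma adm_duhamel k : adm k -> weighted D 1 s (cs (duhamel (cut k))).
Proof.
  intros H. replace s with (s - 2 + 2) by ring.
  apply (weighted_duhamel rho rho_pos rho_lip 1 (s - 2) (cs k)); [lra|exact H].
Qed.

Lemma adm_plus k l : adm k -> adm l -> adm (fun d b => k d b + l d b).
Proof. apply (graded_plus D _ G 1 (s - 2) (cs k) (cs l)). Qed.

Lemma adm_mult t k l : weighted D 1 t (cs k) -> weighted D 1 (s - 2 - t) (cs l) -> adm (fun d b => k d b * l d b).
Proof.
  intros H K. unfold adm. replace (s - 2) with (t + (s - 2 - t)) by ring. rewrite <- (Rmult_1_l 1).
  apply (graded_mult D _ G 1 1 t (s - 2 - t) (cs k) (cs l)); easy.
Qed.

(** The backward characteristic triangle of (d, b), on which duhamel at (d, b)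
    depends. *)
Definition triangle (d b e y : R) : Prop := D e y /\ b - d <= y - e /\ y <= b.

Lemma triangle_trans d b e y e' y' : triangle d b e y -> triangle e y e' y' -> triangle d b e' y'.
Proof. unfold triangle. intros (H1 & H2 & H3) (K1 & K2 & K3). repeat split; try apply K1; lra. Qed.

Lemma duhamel_triangle_bound k d b K : adm k -> D d b ->
  (forall e y, triangle d b e y -> Rabs (k e y) <= K * Rpower e (s - 2)) ->
  Rabs (duhamel (cut k) d b) <= K / (s * (s - 1)) * Rpower d s.
Proof.
  intros Hk Hd H.
  replace (K / (s * (s - 1))) with (K / ((s - 2 + 1) * (s - 2 + 2))) by (field; lra).
  replace (Rpower d s) with (Rpower d (s - 2 + 2)) by (f_equal; ring).
  apply (duhamel_bound rho rho_pos rho_lip); [now apply adm_cont|lra|exact Hd|].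
  intros e y He H1 H2. rewrite cut_pos by apply He. apply H. now split.
Qed.

(** The contraction estimate.  If h_{n+1} = duhamel k_n with
    |k_n| <= theta s (s - 1) d^-2 |h_n| + |g_n|, integrating d^(s - 2) twice
    cancels s (s - 1), so the bound X r^n d^s reproduces itself when r > theta and
    X is large compared with the initial value and with g. *)
Lemma lin_base r h k g : theta < r <= 1 ->
  weighted D 1 s (cs (h O)) -> (forall n, adm (k n)) ->
  (forall n d b, D d b -> h (S n) d b = duhamel (cut (k n)) d b) ->
  (forall n d b, D d b -> Rabs (k n d b) <= theta * (s * (s - 1)) * Rpower d (-2) * Rabs (h n d b) + Rabs (g n d b)) ->
  weighted D r (s - 2) g -> weighted D r s h.
Proof.
  intros Hr [C0 H0] Hk Hrec Hb [_ Hg]. split.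
  - intros [|n] d b Hd; [exact (C0 O d b Hd)|].
    apply (continuity_2d_pt_ext_loc (duhamel (cut (k n)))).
    + destruct (HO d b Hd) as [e He]. exists e. intros u v Hu Hv. symmetry. apply Hrec. now apply He.
    + exact (proj1 (adm_duhamel (k n) (Hk n)) O d b Hd).
  - intros L. destruct (H0 L) as [K0 HK0], (Hg L) as [Kg HKg].
    assert (P : 0 < s * (s - 1)) by nra.
    (* the second entry absorbs the forcing into the gap between theta and r *)
    set (X := Rmax (Rabs K0) (Rabs Kg / (s * (s - 1) * (r - theta)))).
    assert (X1 : Rabs K0 <= X) by apply Rmax_l.
    assert (X2 : Rabs Kg <= s * (s - 1) * (r - theta) * X).
    { apply Rmult_le_reg_l with (/ (s * (s - 1) * (r - theta))); [apply Rinv_0_lt_compat; nra|].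
      rewrite <- Rmult_assoc, Rinv_l, Rmult_1_l by nra.
      rewrite Rmult_comm. apply Rmax_r. }
    assert (X0 : 0 <= X) by (pose proof (Rabs_pos K0); lra).
    exists X. intros n. induction n as [|n IH]; intros d b Hd H1 H2 H3.
    + specialize (HK0 O d b Hd H1 H2 H3). unfold cs in HK0. simpl in *. pose proof (Rpower_pos d s).
      pose proof (Rle_abs K0). nra.
    + rewrite Hrec by easy. pose proof (pow_le r n ltac:(lra)) as Pr.
      replace (X * r ^ S n * Rpower d s) with ((s * (s - 1) * (X * r ^ S n)) / (s * (s - 1)) * Rpower d s) by (field; lra).
      apply duhamel_triangle_bound; [apply Hk|easy|]. intros e y (He & H4 & H5). pose proof (HD e y He).
      eapply Rle_trans; [now apply Hb|].
      assert (He1 : e <= 1) by (destruct He; specialize (rho_le1 y); lra).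
      specialize (IH e y He He1 ltac:(lra) ltac:(lra)).
      specialize (HKg n e y He He1 ltac:(lra) ltac:(lra)).
      pose proof (Rpower_pos e (s - 2)) as P2.
      assert (HKg' : Rabs (g n e y) <= Rabs Kg * r ^ n * Rpower e (s - 2)).
      { eapply Rle_trans; [exact HKg|]. pose proof (Rle_abs Kg).
        apply Rmult_le_compat_r; [lra|]. apply Rmult_le_compat_r; lra. }
      assert (E : Rpower e (-2) * Rpower e s = Rpower e (s - 2)) by (rewrite <- Rpower_plus; f_equal; ring).
      assert (A : theta * (s * (s - 1)) * Rpower e (-2) * Rabs (h n e y)
        <= theta * (s * (s - 1)) * X * r ^ n * Rpower e (s - 2)).
      { rewrite <- E. pose proof (Rpower_pos e (-2)).
        replace (theta * (s * (s - 1)) * X * r ^ n * (Rpower e (-2) * Rpower e s))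
          with (theta * (s * (s - 1)) * Rpower e (-2) * (X * r ^ n * Rpower e s)) by ring.
        apply Rmult_le_compat_l; [|easy]. apply Rmult_le_pos; [nra|lra]. }
      assert (B : Rabs Kg * r ^ n * Rpower e (s - 2) <= s * (s - 1) * (r - theta) * X * r ^ n * Rpower e (s - 2)).
      { apply Rmult_le_compat_r; [lra|]. apply Rmult_le_compat_r; lra. }
      replace (s * (s - 1) * (X * r ^ S n) * Rpower e (s - 2))
        with (theta * (s * (s - 1)) * X * r ^ n * Rpower e (s - 2) + s * (s - 1) * (r - theta) * X * r ^ n * Rpower e (s - 2))
        by (simpl; ring).
      lra.
Qed.

Lemma weighted_slice_lt t r h n : 0 < r -> weighted D r t h -> weighted D 1 t (cs (h n)).
Proof.
  intros Hr [H1 H2]. split; [intros m; apply (H1 n)|]. intros L. destruct (H2 L) as [K HK]. exists (K * r ^ n).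
  intros m d b. rewrite pow1, Rmult_1_r. apply HK.
Qed.

(** The formal b-derivative of a linear recursion solves a recursion of the same
    form, with another forcing. *)
Fixpoint rec_lin (h0 : R -> R -> R) (al g : seqfun) (n : nat) : R -> R -> R :=
  match n with
  | O => h0
  | S n => duhamel (cut (fun d b => al n d b * rec_lin h0 al g n d b + g n d b))
  end.

Lemma wC_deriv_ext M r t h h' : wC D (S M) r t h -> deriv_b D h h' -> wC D M r t h'.
Proof. apply Ck_deriv_b. exact G. Qed.

Lemma wC_slice M : forall r t h n, 0 < r -> wC D M r t h -> wC D M 1 t (cs (h n)).
Proof.
  induction M as [|M IH]; intros r t h n Hr [H0 H].
  - split; [now apply (weighted_slice_lt t r)|easy].
  - destruct H as [[h' [Hb H]] _]. split; [now apply (weighted_slice_lt t r)|]. split; [|easy].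
    exists (cs (h' n)). split; [intros m d b Hd; apply (Hb n d b Hd)|now apply (IH r)].
Qed.

Lemma adm_step al h g : weighted D 1 (-2) (cs al) -> weighted D 1 s (cs h) -> adm g ->
  adm (fun d b => al d b * h d b + g d b).
Proof.
  intros Hal Hh Hg. apply (adm_plus (fun d b => al d b * h d b) g); [|easy].
  apply (adm_mult (-2)); [easy|]. replace (s - 2 - -2) with s by ring. easy.
Qed.

(** Differentiating the recursion in b keeps the coefficient al, and thus the rate,
    and moves al_b h, already controlled, into the forcing. *)
Lemma lin_class M : forall r h al g, theta < r <= 1 ->
  wC D M 1 (-2) al -> (forall n d b, D d b -> Rabs (al n d b) <= theta * (s * (s - 1)) * Rpower d (-2)) ->
  wC D M r (s - 2) g -> wC D M 1 s (cs (h O)) ->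
  (forall n d b, D d b -> h (S n) d b = duhamel (cut (fun d b => al n d b * h n d b + g n d b)) d b) ->
  wC D M r s h.
Proof.
  assert (Hslices : forall r h al g, 0 < r -> weighted D 1 (-2) al -> weighted D r (s - 2) g ->
    weighted D 1 s (cs (h O)) ->
    (forall n d b, D d b -> h (S n) d b = duhamel (cut (fun d b => al n d b * h n d b + g n d b)) d b) ->
    forall n, weighted D 1 s (cs (h n))).
  { intros r h al g Hr Hal Hg H0 Hrec n. induction n as [|n IH]; [easy|].
    apply (graded_ext D _ G 1 s (cs (duhamel (cut (fun d b => al n d b * h n d b + g n d b))))).
    - intros m d b Hd. symmetry. apply (Hrec n d b Hd).
    - apply adm_duhamel. apply adm_step; [now apply (weighted_slice_lt (-2) 1); [lra|]|easy|].
      now apply (weighted_slice_lt (s - 2) r). }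
  assert (Hbase : forall r h al g, theta < r <= 1 -> weighted D 1 (-2) al ->
    (forall n d b, D d b -> Rabs (al n d b) <= theta * (s * (s - 1)) * Rpower d (-2)) ->
    weighted D r (s - 2) g -> weighted D 1 s (cs (h O)) ->
    (forall n d b, D d b -> h (S n) d b = duhamel (cut (fun d b => al n d b * h n d b + g n d b)) d b) ->
    weighted D r s h).
  { intros r h al g Hr Hal Hb Hg H0 Hrec.
    apply (lin_base r h (fun n d b => al n d b * h n d b + g n d b) g); try easy.
    - intros n. apply adm_step; [apply (weighted_slice_lt (-2) 1); [lra|easy]| |apply (weighted_slice_lt (s - 2) r); [lra|easy]].
      apply (Hslices r h al g); try easy. lra.
    - intros n d b Hd. eapply Rle_trans; [apply Rabs_triang|]. apply Rplus_le_compat_r.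
      rewrite Rabs_mult. apply Rmult_le_compat_r; [apply Rabs_pos|now apply Hb]. }
  induction M as [|M IH]; intros r h al g Hr Hal Hb Hg H0 Hrec.
  - split; [|easy]. apply (Hbase r h al g); try easy. apply Hal. apply Hg. apply H0.
  - assert (Hh : wC D M r s h).
    { apply (IH r h al g); try easy; now apply Ck_pred. }
    pose proof Hal as Hal0. pose proof Hg as Hg0. pose proof H0 as H00.
    destruct Hal as [Wal [[al' [Dal Hal']] _]], Hg as [Wg [[g' [Dg Hg']] _]], H0 as [Wh [[h0' [Dh Hh0']] _]].
    set (g1 := fun n d b => al' n d b * h n d b + g' n d b).
    set (h' := rec_lin (h0' O) al g1).
    assert (Hg1 : wC D M r (s - 2) g1).
    { apply (Ck_plus false D _ G); [|easy].
      apply (Ck_mult_eq false D _ G M 1 r r (-2) s (s - 2) al' h); [easy|easy|ring|ring]. }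
    assert (Sal : forall n, weighted D 1 (-2) (cs (al n))) by (intros n; apply (weighted_slice_lt (-2) 1); [lra|easy]).
    assert (Ag : forall n, adm (g n)) by (intros n; apply (weighted_slice_lt (s - 2) r); [lra|easy]).
    assert (Ag1 : forall n, adm (g1 n)).
    { intros n; apply (weighted_slice_lt (s - 2) r); [lra|]. apply (Ck_base false D (weighted D) M _ _ _ Hg1). }
    assert (Sh : forall n, weighted D 1 s (cs (h n))).
    { apply (Hslices r h al g); try easy. lra. }
    assert (Wh0' : weighted D 1 s (cs (h' O))).
    { apply (weighted_slice_lt s 1 h0' O); [lra|]. apply (Ck_base false D (weighted D) M _ _ _ Hh0'). }
    assert (Sh' : forall n, weighted D 1 s (cs (h' n))).
    { apply (Hslices r h' al g1); try easy; [lra|]. apply (Ck_base false D (weighted D) M _ _ _ Hg1). }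
    assert (Hd' : forall n d b, D d b -> is_derive (fun y => h n d y) b (h' n d b)).
    { intros n. induction n as [|n IHn]; intros d b Hd; [apply (Dh O d b Hd)|].
      apply (is_derive_ext_loc (fun y => duhamel (cut (fun d b => al n d b * h n d b + g n d b)) d y)).
      - generalize (open2_slice_b D d b HO Hd). apply filter_imp. intros y Hy. symmetry. now apply Hrec.
      - refine (duhamel_seq_deriv_b rho rho_pos rho_lip 1 (s - 2)
          (cs (fun d b => al n d b * h n d b + g n d b)) (cs (fun d b => al n d b * h' n d b + g1 n d b)) _ _ _ _ O d b Hd); [lra| | |].
        + now apply adm_step.
        + now apply adm_step.
        + intros m e y Hey. unfold cs, g1.
          eapply is_derive_val.
          * apply (is_derive_plus_R (fun y => al n e y * h n e y) (fun y => g n e y)); [|now apply Dg].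
            apply (is_derive_mult_R (fun y => al n e y) (fun y => h n e y)); [now apply Dal|now apply IHn].
          * ring. }
    split; [apply (Ck_base false D (weighted D) M _ _ _ Hh)|]. split; [|easy].
    exists h'. split; [intros n d b Hd; now apply Hd'|].
    apply (IH r h' al g1); try easy.
    + now apply Ck_pred.
    + apply (Ck_ext false D _ G M 1 s h0'); [|easy].
      intros n d b Hd. unfold cs, h'. simpl.
      rewrite <- (is_derive_unique _ _ _ (Dh n d b Hd)). apply is_derive_unique, (Dh O d b Hd).
Qed.

(** P is the nonlinearity at the approximate solution, iV the
    inverse of the approximate solution, Rs its residual. *)
Variables (a q eps0 : R) (P iV Rs : R -> R -> R).
Hypothesis Ha : 0 < a.
Hypothesis Heps : 0 < eps0 <= / 2.
Hypothesis HP : weighted D 1 (- a - 2) (cs P).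
Hypothesis HV : weighted D 1 a (cs iV).
Hypothesis HR : adm Rs.
Hypothesis Hcoef : forall d b y, D d b -> Rabs y <= eps0 ->
  Rabs (P d b * (q * Rpower (1 + y) (q - 1)) * iV d b) <= theta * (s * (s - 1)) * Rpower d (-2).
(** The bound X d^s for the iterates has to be compatible with the smallness of
    w iV that the Taylor estimates need; this is where the layer must be thin.
    It is only required on backward triangles, with X depending on the triangle. *)
Hypothesis Hsmall : forall d b, D d b -> exists X, 0 <= X /\ forall e y, triangle d b e y ->
  Rabs (Rs e y) <= (1 - theta) * (s * (s - 1)) * X * Rpower e (s - 2) /\
  X * Rpower e s * Rabs (iV e y) <= eps0.

(** binom_rem q 1 removes the constant term, which belongs to the approximate
    solution; the linear term remains and must be beaten by the contraction. *)
Definition nonlin (w : R -> R -> R) (d b : R) : R := P d b * binom_rem q 1 (w d b * iV d b) + Rs d b.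

Definition tame (w : R -> R -> R) : Prop := forall d b, D d b -> Rabs (w d b * iV d b) <= eps0.

Lemma wC_nonlin M w : tame w -> wC D M 1 (- a - 2) (cs P) -> wC D M 1 a (cs iV) ->
  wC D M 1 (s - 2) (cs Rs) -> wC D M 1 s (cs w) -> wC D M 1 (s - 2) (cs (nonlin w)).
Proof.
  intros Ht CP CV CR Cw.
  apply (Ck_plus false D _ G M 1 (s - 2) (cs (fun d b => P d b * binom_rem q 1 (w d b * iV d b))) (cs Rs)); [|exact CR].
  apply (Ck_mult_eq false D _ G M 1 1 1 (- a - 2) (INR 1 * (s + a)) (s - 2) (cs P) (cs (fun d b => binom_rem q 1 (w d b * iV d b))));
    [exact CP| |ring|simpl; ring].
  apply (wC_binom_rem D HO HD M q 1 (s + a) (cs (fun d b => w d b * iV d b))).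
  - lra.
  - intros m d b Hd. specialize (Ht d b Hd). unfold cs. lra.
  - apply (Ck_mult_eq false D _ G M 1 1 1 s a (s + a) (cs w) (cs iV)); [easy|easy|ring|ring].
Qed.

Lemma adm_nonlin w : weighted D 1 s (cs w) -> tame w -> adm (nonlin w).
Proof.
  intros Hw Ht. apply (Ck_base false D (weighted D) 0). apply wC_nonlin; [easy| | | |]; now split.
Qed.

Lemma nonlin_lip w v d b : D d b -> Rabs (w d b * iV d b) <= eps0 -> Rabs (v d b * iV d b) <= eps0 ->
  Rabs (nonlin w d b - nonlin v d b) <= theta * (s * (s - 1)) * Rpower d (-2) * Rabs (w d b - v d b).
Proof.
  intros Hd Hw Hv. unfold nonlin.
  replace (P d b * binom_rem q 1 (w d b * iV d b) + Rs d b - (P d b * binom_rem q 1 (v d b * iV d b) + Rs d b))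
    with (P d b * binom_rem q 1 (w d b * iV d b) - P d b * binom_rem q 1 (v d b * iV d b)) by ring.
  set (wx := w d b) in *. set (vx := v d b) in *.
  assert (Hmid : forall x, Rmin vx wx <= x <= Rmax vx wx -> Rabs (x * iV d b) <= eps0).
  { intros x Hx. apply Rabs_le_between in Hw. apply Rabs_le_between in Hv. apply Rabs_le_between.
    unfold Rmin, Rmax in Hx. destruct (Rle_dec vx wx); destruct (Rle_dec 0 (iV d b)); nra. }
  apply (MVT_bound (fun x => P d b * binom_rem q 1 (x * iV d b))
    (fun x => P d b * (q * Rpower (1 + x * iV d b) (q - 1)) * iV d b)).
  - intros x Hx. specialize (Hmid x Hx).
    apply (is_derive_val _ _ (P d b * (iV d b * (q * binom_rem (q - 1) 0 (x * iV d b))))); [|simpl; ring].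
    apply (is_derive_scal (fun x => binom_rem q 1 (x * iV d b))).
    apply (is_derive_comp (binom_rem q 1) (fun x => x * iV d b)).
    + apply is_derive_binom_rem. apply half_pos. lra.
    + apply (is_derive_val _ _ (1 * iV d b + x * 0)); [|ring].
      apply (is_derive_mult_R (fun x => x) (fun _ => iV d b)); [apply @is_derive_id|apply is_derive_const_R].
  - intros x Hx. apply Hcoef; [easy|now apply Hmid].
Qed.

Lemma nonlin_bound w d b : D d b -> Rabs (w d b * iV d b) <= eps0 ->
  Rabs (nonlin w d b) <= theta * (s * (s - 1)) * Rpower d (-2) * Rabs (w d b) + Rabs (Rs d b).
Proof.
  intros Hd Hw. replace (nonlin w d b) with ((nonlin w d b - nonlin zero_fun d b) + Rs d b).
  - eapply Rle_trans; [apply Rabs_triang|]. apply Rplus_le_compat_r.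
    assert (H0 : Rabs (zero_fun d b * iV d b) <= eps0) by (unfold zero_fun; rewrite Rmult_0_l, Rabs_R0; lra).
    pose proof (nonlin_lip w zero_fun d b Hd Hw H0) as H.
    replace (w d b - zero_fun d b) with (w d b) in H by (unfold zero_fun; ring). easy.
  - unfold nonlin, zero_fun. rewrite Rmult_0_l, binom_rem_zero. ring.
Qed.

Fixpoint picard (n : nat) : R -> R -> R :=
  match n with O => zero_fun | S n => duhamel (cut (nonlin (picard n))) end.

Lemma weighted_zero r t : weighted D r t (cs zero_fun).
Proof.
  split; [intros n d b _; apply continuity_2d_pt_const|]. intros L. exists 0. intros n d b _ _ _ _.
  unfold cs, zero_fun. rewrite Rabs_R0. lra.
Qed.

(** Both claims have to be proved together: the bound on an iterate makes
    it small relative to the approximate solution, and this smallness gives the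
    bound on the next one. *)
Lemma picard_tame_weighted n : weighted D 1 s (cs (picard n)) /\ tame (picard n).
Proof.
  assert (P0 : 0 < s * (s - 1)) by nra.
  assert (H : weighted D 1 s (cs (picard n)) /\ forall d b X, D d b -> 0 <= X ->
    (forall e y, triangle d b e y -> Rabs (Rs e y) <= (1 - theta) * (s * (s - 1)) * X * Rpower e (s - 2) /\
      X * Rpower e s * Rabs (iV e y) <= eps0) ->
    forall e y, triangle d b e y -> Rabs (picard n e y) <= X * Rpower e s).
  { induction n as [|n [IH1 IH2]].
    - split; [apply weighted_zero|]. intros d b X _ HX _ e y _. simpl. unfold zero_fun. rewrite Rabs_R0.
      pose proof (Rpower_pos e s). nra.
    - assert (Ht : tame (picard n)).
      { intros d b Hd. destruct (Hsmall d b Hd) as [X [HX HH]].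
        assert (Htr : triangle d b d b) by (split; [easy|lra]).
        specialize (IH2 d b X Hd HX HH d b Htr). destruct (HH d b Htr) as [_ H2].
        rewrite Rabs_mult. eapply Rle_trans; [|exact H2]. apply Rmult_le_compat_r; [apply Rabs_pos|easy]. }
      pose proof (adm_nonlin (picard n) IH1 Ht) as Ha'.
      split; [now apply adm_duhamel|]. intros d b X Hd HX HH e y Hey. simpl.
      replace (X * Rpower e s) with ((s * (s - 1) * X) / (s * (s - 1)) * Rpower e s) by (field; lra).
      apply duhamel_triangle_bound; [easy|apply Hey|]. intros e' y' He'.
      pose proof (triangle_trans d b e y e' y' Hey He') as Htr.
      assert (De : D e' y') by apply He'.
      eapply Rle_trans; [apply nonlin_bound; [easy|now apply Ht]|].
      specialize (IH2 d b X Hd HX HH e' y' Htr). destruct (HH e' y' Htr) as [H1 _].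
      assert (E : Rpower e' (-2) * Rpower e' s = Rpower e' (s - 2)) by (rewrite <- Rpower_plus; f_equal; ring).
      assert (A : theta * (s * (s - 1)) * Rpower e' (-2) * Rabs (picard n e' y')
         <= theta * (s * (s - 1)) * X * Rpower e' (s - 2)).
      { rewrite <- E. pose proof (Rpower_pos e' (-2)).
        replace (theta * (s * (s - 1)) * X * (Rpower e' (-2) * Rpower e' s))
          with (theta * (s * (s - 1)) * Rpower e' (-2) * (X * Rpower e' s)) by ring.
        apply Rmult_le_compat_l; [|easy]. apply Rmult_le_pos; [nra|lra]. }
      lra. }
  destruct H as [H1 H2]. split; [easy|].
  intros d b Hd. destruct (Hsmall d b Hd) as [X [HX HH]].
  assert (Htr : triangle d b d b) by (split; [easy|lra]).
  specialize (H2 d b X Hd HX HH d b Htr). destruct (HH d b Htr) as [_ H3].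
  rewrite Rabs_mult. eapply Rle_trans; [|exact H3]. apply Rmult_le_compat_r; [apply Rabs_pos|easy].
Qed.

Lemma picard_slice n : weighted D 1 s (cs (picard n)).
Proof. apply picard_tame_weighted. Qed.

Lemma picard_tame n : tame (picard n).
Proof. apply picard_tame_weighted. Qed.

Lemma picard_adm n : adm (nonlin (picard n)).
Proof. apply adm_nonlin; [apply picard_slice|apply picard_tame]. Qed.

Lemma picard_weighted : weighted D 1 s picard.
Proof.
  apply (lin_base 1 picard (fun n => nonlin (picard n)) (cs Rs)); try easy.
  - apply weighted_zero.
  - apply picard_adm.
  - intros n d b Hd. apply nonlin_bound; [easy|]. now apply picard_tame.
Qed.

Let ratio : seqfun := fun n d b => picard n d b * iV d b.

Lemma ratio_half n d b : D d b -> Rabs (ratio n d b) <= / 2.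
Proof. intros Hd. pose proof (picard_tame n d b Hd). unfold ratio. lra. Qed.

Lemma wC_ratio M : wC D M 1 s picard -> wC D M 1 a (cs iV) -> wC D M 1 (s + a) ratio.
Proof. intros H K. apply (Ck_mult_eq false D _ G M 1 1 1 s a _ picard (cs iV)); [easy|easy|ring|ring]. Qed.

(** The linearisation of nonlin at the n-th iterate. *)
Let alpha : seqfun := fun n d b => P d b * (q * binom_rem (q - 1) 0 (ratio n d b)) * iV d b.

Lemma alpha_bound n d b : D d b -> Rabs (alpha n d b) <= theta * (s * (s - 1)) * Rpower d (-2).
Proof. intros Hd. apply (Hcoef d b (ratio n d b) Hd). now apply picard_tame. Qed.

Lemma wC_binom_rem0 M p : wC D M 1 (s + a) ratio -> wC D M 1 0 (fun n d b => binom_rem p 0 (ratio n d b)).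
Proof.
  intros H. replace 0 with (INR 0 * (s + a)) by (simpl; ring).
  apply (wC_binom_rem D HO HD M p 0 (s + a) ratio); [lra|exact ratio_half|easy].
Qed.

Lemma wC_alpha M : wC D M 1 s picard -> wC D M 1 (- a - 2) (cs P) -> wC D M 1 a (cs iV) ->
  wC D M 1 (-2) alpha.
Proof.
  intros Hw HPM HVM.
  apply (Ck_mult_eq false D _ G M 1 1 1 (- a - 2) a (-2) (fun n d b => P d b * (q * binom_rem (q - 1) 0 (ratio n d b))) (cs iV));
    [|easy|ring|ring].
  apply (Ck_mult_eq false D _ G M 1 1 1 (- a - 2) 0 _ (cs P) (fun n d b => q * binom_rem (q - 1) 0 (ratio n d b)));
    [easy| |ring|ring].
  apply (Ck_scal false D _ G M q 1 0 (fun n d b => binom_rem (q - 1) 0 (ratio n d b))).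
  apply wC_binom_rem0. now apply wC_ratio.
Qed.

Section OneDerivative.
Variables (M : nat) (P' iV' Rs' : R -> R -> R).
Hypothesis DP : deriv_b D (cs P) (cs P').
Hypothesis DV : deriv_b D (cs iV) (cs iV').
Hypothesis DR : deriv_b D (cs Rs) (cs Rs').
Hypothesis CP : wC D (S M) 1 (- a - 2) (cs P).
Hypothesis CV : wC D (S M) 1 a (cs iV).
Hypothesis CR : wC D (S M) 1 (s - 2) (cs Rs).
Hypothesis Cw : wC D M 1 s picard.

(** The part of the b-derivative of nonlin in which P, iV or Rs is
    differentiated, and not the iterate. *)
Definition forcing : seqfun := fun n d b =>
  P' d b * binom_rem q 1 (ratio n d b) + P d b * iV' d b * (q * binom_rem (q - 1) 0 (ratio n d b) * picard n d b) + Rs' d b.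

Definition picard' : seqfun := rec_lin zero_fun alpha forcing.

Lemma wC_ratio_M : wC D M 1 (s + a) ratio.
Proof. apply wC_ratio; [easy|now apply Ck_pred]. Qed.

Lemma wC_P'iV' : wC D M 1 (-2) (fun _ d b => P d b * iV' d b).
Proof.
  apply (Ck_mult_eq false D _ G M 1 1 1 (- a - 2) a (-2) (cs P) (cs iV')); [now apply Ck_pred| |ring|ring].
  apply (wC_deriv_ext M 1 a (cs iV)); easy.
Qed.

Lemma wC_forcing : wC D M 1 (s - 2) forcing.
Proof.
  pose proof wC_ratio_M as Hr.
  apply (Ck_plus false D _ G M 1 (s - 2) (fun n d b => P' d b * binom_rem q 1 (ratio n d b)
    + P d b * iV' d b * (q * binom_rem (q - 1) 0 (ratio n d b) * picard n d b)) (cs Rs')).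
  2:{ apply (wC_deriv_ext M 1 (s - 2) (cs Rs)); easy. }
  apply (Ck_plus false D _ G M 1 (s - 2) (fun n d b => P' d b * binom_rem q 1 (ratio n d b))
    (fun n d b => P d b * iV' d b * (q * binom_rem (q - 1) 0 (ratio n d b) * picard n d b))).
  - apply (Ck_mult_eq false D _ G M 1 1 1 (- a - 2) (INR 1 * (s + a)) (s - 2) (cs P') (fun n d b => binom_rem q 1 (ratio n d b)));
      [apply (wC_deriv_ext M 1 (- a - 2) (cs P)); easy| |ring|simpl; ring].
    apply (wC_binom_rem D HO HD M q 1 (s + a) ratio); [lra|exact ratio_half|easy].
  - apply (Ck_mult_eq false D _ G M 1 1 1 (-2) s (s - 2) (fun _ d b => P d b * iV' d b)
      (fun n d b => q * binom_rem (q - 1) 0 (ratio n d b) * picard n d b)); [apply wC_P'iV'| |ring|ring].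
    apply (Ck_mult_eq false D _ G M 1 1 1 0 s s (fun n d b => q * binom_rem (q - 1) 0 (ratio n d b)) picard); [|easy|ring|ring].
    apply (Ck_scal false D _ G M q 1 0 (fun n d b => binom_rem (q - 1) 0 (ratio n d b))). now apply wC_binom_rem0.
Qed.

Lemma wC_zero M' t : wC D M' 1 t (cs zero_fun).
Proof.
  apply (Ck_ext false D _ G M' 1 t (fun n d b => 0 * Rpower d t)); [intros; unfold cs, zero_fun; ring|].
  apply (Ck_scal false D _ G). apply (wC_Rpower D M' t HO HD).
Qed.

Lemma wC_picard' : wC D M 1 s picard'.
Proof.
  apply (lin_class M 1 picard' alpha forcing); try easy.
  - apply wC_alpha; [easy|now apply Ck_pred|now apply Ck_pred].
  - exact alpha_bound.
  - apply wC_forcing.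
  - apply wC_zero.
Qed.

Lemma picard_deriv : deriv_b D picard picard'.
Proof.
  pose proof (Ck_base false D (weighted D) _ _ _ _ wC_picard') as Hp'.
  pose proof (Ck_base false D (weighted D) _ _ _ _ wC_forcing) as Hf.
  assert (Hal : weighted D 1 (-2) alpha).
  { apply (Ck_base false D (weighted D) M). apply wC_alpha; [easy|now apply Ck_pred|now apply Ck_pred]. }
  intros n. induction n as [|n IH]; intros d b Hd; [apply (is_derive_const_R 0)|].
  refine (duhamel_seq_deriv_b rho rho_pos rho_lip 1 (s - 2) (cs (nonlin (picard n)))
    (cs (fun d b => alpha n d b * picard' n d b + forcing n d b)) _ _ _ _ O d b Hd); [lra|apply picard_adm| |].
  - apply adm_step; [apply (weighted_slice_lt (-2) 1); [lra|easy]|apply (weighted_slice_lt s 1); [lra|easy]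
      |apply (weighted_slice_lt (s - 2) 1); [lra|easy]].
  - intros m e y Hey. unfold cs, nonlin, forcing, alpha.
    apply (is_derive_val _ _ ((P' e y * binom_rem q 1 (ratio n e y)
      + P e y * ((picard' n e y * iV e y + picard n e y * iV' e y) * (q * binom_rem (q - 1) 0 (ratio n e y)))) + Rs' e y)); [|ring].
    apply (is_derive_plus_R (fun y => P e y * binom_rem q 1 (picard n e y * iV e y)) (fun y => Rs e y)); [|apply (DR O e y Hey)].
    apply (is_derive_mult_R (fun y => P e y) (fun y => binom_rem q 1 (picard n e y * iV e y))); [apply (DP O e y Hey)|].
    apply (is_derive_comp (binom_rem q 1) (fun y => picard n e y * iV e y)).
    + apply is_derive_binom_rem, half_pos. now apply ratio_half.
    + apply (is_derive_mult_R (fun y => picard n e y) (fun y => iV e y)); [now apply IH|apply (DV O e y Hey)].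
Qed.

End OneDerivative.

Lemma wC_split M t h : wC D (S M) 1 t (cs h) -> exists h', deriv_b D (cs h) (cs h').
Proof. intros [_ [[h' [Hb _]] _]]. exists (h' O). intros n d b Hd. apply (Hb O d b Hd). Qed.

Lemma wC_picard M : wC D M 1 (- a - 2) (cs P) -> wC D M 1 a (cs iV) -> wC D M 1 (s - 2) (cs Rs) ->
  wC D M 1 s picard.
Proof.
  induction M as [|M IH]; intros CP CV CR.
  - split; [apply picard_weighted|easy].
  - destruct (wC_split _ _ _ CP) as [P' DP], (wC_split _ _ _ CV) as [V' DV], (wC_split _ _ _ CR) as [R' DR].
    assert (Cw : wC D M 1 s picard) by (apply IH; now apply Ck_pred).
    split; [apply picard_weighted|]. split; [|easy].
    exists (picard' P' V' R'). split.
    + now apply (picard_deriv M).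
    + now apply wC_picard'.
Qed.

Lemma adm_minus k l : adm k -> adm l -> adm (fun d b => k d b - l d b).
Proof. intros Hk Hl. apply (Ck_base false D (weighted D) 0).
  apply (Ck_minus false D _ G 0 1 (s - 2) (cs k) (cs l)); now split. Qed.

Lemma duhamel_minus k l d b : adm k -> adm l -> D d b ->
  duhamel (cut (fun d b => k d b - l d b)) d b = duhamel (cut k) d b - duhamel (cut l) d b.
Proof.
  intros Hk Hl Hd. pose proof (adm_cont k Hk) as Ck. pose proof (adm_cont l Hl) as Ck'.
  assert (Hb : below rho d b) by apply Hd.
  unfold duhamel. rewrite <- RInt_minus_R.
  - apply RInt_ext_R. intros e He. assert (He' : below rho e b).
    { apply (below_seg rho rho_pos d b Hb). lra. }
    unfold char_int. rewrite <- RInt_minus_R; [|now apply (char_int_ex rho rho_pos rho_lip)|now apply (char_int_ex rho rho_pos rho_lip)].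
    apply RInt_ext_R. intros x _. unfold cut. destruct Rlt_dec; ring.
  - apply (prim_ex (below rho) 0 (below_seg rho rho_pos) (char_int (cut k))); [|easy]. now apply (char_int_cont rho rho_pos rho_lip).
  - apply (prim_ex (below rho) 0 (below_seg rho rho_pos) (char_int (cut l))); [|easy]. now apply (char_int_cont rho rho_pos rho_lip).
Qed.

Variable r : R.
Hypothesis Hr : theta < r < 1.

Definition increment : seqfun := fun n d b => picard (S n) d b - picard n d b.

Lemma increment_weighted : weighted D r s increment.
Proof.
  apply (lin_base r increment (fun n d b => nonlin (picard (S n)) d b - nonlin (picard n) d b) (cs zero_fun)).
  - lra.
  - apply (Ck_base false D (weighted D) 0).
    apply (Ck_minus false D _ G 0 1 s (cs (picard 1)) (cs (picard 0))); split; try easy; apply picard_slice.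
  - intros n. apply adm_minus; apply picard_adm.
  - intros n d b Hd. unfold increment. symmetry. apply duhamel_minus; [apply picard_adm|apply picard_adm|easy].
  - intros n d b Hd. unfold cs, zero_fun. rewrite Rabs_R0, Rplus_0_r. apply nonlin_lip; [easy| |]; now apply picard_tame.
  - apply weighted_zero.
Qed.

Lemma wC_ratio_increment M : wC D M r s increment -> wC D M 1 a (cs iV) ->
  wC D M r (s + a) (fun n d b => ratio (S n) d b - ratio n d b).
Proof.
  intros H K. apply (Ck_ext false D _ G M r (s + a) (fun n d b => increment n d b * iV d b)).
  - intros n d b _. unfold ratio, increment. ring.
  - apply (Ck_mult_eq false D _ G M r 1 r s a _ increment (cs iV)); [easy|easy|ring|ring].
Qed.

Lemma wC_binom_rem_increment M p : wC D M 1 s picard -> wC D M r s increment -> wC D M 1 a (cs iV) ->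
  wC D M r (s + a) (fun n d b => binom_rem p 0 (ratio (S n) d b) - binom_rem p 0 (ratio n d b)).
Proof.
  intros H K L. pose proof (wC_ratio M H L) as Hr'.
  apply (wC_binom_rem_diff D HO HD M p r (s + a) (s + a) (fun n => ratio (S n)) ratio); try lra.
  - intros n d b Hd. now apply ratio_half.
  - exact ratio_half.
  - now apply (wC_shift D M 1 (s + a) ratio).
  - easy.
  - now apply wC_ratio_increment.
Qed.

(** Increments of the derivatives solve a linear recursion whose forcing consists of
    increments with one derivative less, so the rate r propagates from order M to
    order M + 1. *)
Lemma wC_increment M : wC D M 1 (- a - 2) (cs P) -> wC D M 1 a (cs iV) -> wC D M 1 (s - 2) (cs Rs) ->
  wC D M r s increment.
Proof.
  induction M as [|M IH]; intros CP CV CR.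
  - split; [apply increment_weighted|easy].
  - destruct (wC_split _ _ _ CP) as [P' DP], (wC_split _ _ _ CV) as [V' DV], (wC_split _ _ _ CR) as [R' DR].
    assert (CP0 : wC D M 1 (- a - 2) (cs P)) by now apply Ck_pred.
    assert (CV0 : wC D M 1 a (cs iV)) by now apply Ck_pred.
    assert (CR0 : wC D M 1 (s - 2) (cs Rs)) by now apply Ck_pred.
    assert (Cw : wC D M 1 s picard) by now apply wC_picard.
    assert (Ci : wC D M r s increment) by now apply IH.
    set (w' := picard' P' V' R').
    assert (Dw : deriv_b D picard w') by now apply (picard_deriv M).
    assert (Cw' : wC D M 1 s w') by now apply wC_picard'.
    assert (Cf : wC D M 1 (s - 2) (forcing P' V' R')) by now apply wC_forcing.
    assert (Cal : wC D M 1 (-2) alpha) by now apply wC_alpha.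
    split; [apply increment_weighted|]. split; [|easy].
    exists (fun n d b => w' (S n) d b - w' n d b). split.
    { intros n d b Hd. apply is_derive_minus_R; now apply Dw. }
    set (f := forcing P' V' R') in *.
    assert (Wslice : forall n, adm (fun d b => alpha n d b * w' n d b + f n d b)).
    { intros n. apply adm_step.
      - apply (weighted_slice_lt (-2) 1); [lra|]. apply (Ck_base false D (weighted D) _ _ _ _ Cal).
      - apply (weighted_slice_lt s 1); [lra|]. apply (Ck_base false D (weighted D) _ _ _ _ Cw').
      - apply (weighted_slice_lt (s - 2) 1); [lra|]. apply (Ck_base false D (weighted D) _ _ _ _ Cf). }
    apply (lin_class M r _ (fun n => alpha (S n))
      (fun n d b => (alpha (S n) d b - alpha n d b) * w' n d b + (f (S n) d b - f n d b))).
    + lra.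
    + now apply (wC_shift D M 1 (-2) alpha).
    + intros n. apply alpha_bound.
    + apply (Ck_plus false D _ G M r (s - 2) (fun n d b => (alpha (S n) d b - alpha n d b) * w' n d b)
        (fun n d b => f (S n) d b - f n d b)).
      * apply (wC_weaken D M r (s - 2 + a + s)); [exact HD|lra|lra|].
        apply (Ck_mult_eq false D _ G M r 1 r (s - 2 + a) s _ (fun n d b => alpha (S n) d b - alpha n d b) w');
          [|easy|ring|ring].
        apply (Ck_ext false D _ G M r (s - 2 + a)
          (fun n d b => (P d b * (q * (binom_rem (q - 1) 0 (ratio (S n) d b) - binom_rem (q - 1) 0 (ratio n d b)))) * iV d b));
          [intros n d b _; unfold alpha; ring|].
        apply (Ck_mult_eq false D _ G M r 1 r (s - 2) a _
          (fun n d b => P d b * (q * (binom_rem (q - 1) 0 (ratio (S n) d b) - binom_rem (q - 1) 0 (ratio n d b)))) (cs iV)); [|easy|ring|ring].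
        apply (Ck_mult_eq false D _ G M 1 r r (- a - 2) (s + a) _ (cs P)
          (fun n d b => q * (binom_rem (q - 1) 0 (ratio (S n) d b) - binom_rem (q - 1) 0 (ratio n d b)))); [easy| |ring|ring].
        apply (Ck_scal false D _ G). now apply wC_binom_rem_increment.
      * apply (Ck_ext false D _ G M r (s - 2)
          (fun n d b => P' d b * (binom_rem q 0 (ratio (S n) d b) - binom_rem q 0 (ratio n d b))
            + P d b * V' d b * (q * ((binom_rem (q - 1) 0 (ratio (S n) d b) - binom_rem (q - 1) 0 (ratio n d b)) * picard (S n) d b
                + binom_rem (q - 1) 0 (ratio n d b) * increment n d b)))).
        { intros n d b _. unfold f, forcing, increment. change (binom_rem q 1 (ratio (S n) d b)) with (binom_rem q 0 (ratio (S n) d b) - 1 * 1).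
          change (binom_rem q 1 (ratio n d b)) with (binom_rem q 0 (ratio n d b) - 1 * 1). ring. }
        apply (Ck_plus false D _ G M r (s - 2) (fun n d b => P' d b * (binom_rem q 0 (ratio (S n) d b) - binom_rem q 0 (ratio n d b)))
          (fun n d b => P d b * V' d b * (q * ((binom_rem (q - 1) 0 (ratio (S n) d b) - binom_rem (q - 1) 0 (ratio n d b)) * picard (S n) d b
                + binom_rem (q - 1) 0 (ratio n d b) * increment n d b)))).
        -- apply (Ck_mult_eq false D _ G M 1 r r (- a - 2) (s + a) _ (cs P') (fun n d b => binom_rem q 0 (ratio (S n) d b) - binom_rem q 0 (ratio n d b)));
             [apply (wC_deriv_ext M 1 (- a - 2) (cs P)); easy|now apply wC_binom_rem_increment|ring|ring].
        -- apply (Ck_mult_eq false D _ G M 1 r r (-2) s _ (fun _ d b => P d b * V' d b)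
             (fun n d b => q * ((binom_rem (q - 1) 0 (ratio (S n) d b) - binom_rem (q - 1) 0 (ratio n d b)) * picard (S n) d b
                + binom_rem (q - 1) 0 (ratio n d b) * increment n d b))); [now apply wC_P'iV'| |ring|ring].
           apply (Ck_scal false D _ G M q r s (fun n d b => (binom_rem (q - 1) 0 (ratio (S n) d b) - binom_rem (q - 1) 0 (ratio n d b)) * picard (S n) d b
                + binom_rem (q - 1) 0 (ratio n d b) * increment n d b)).
           apply (Ck_plus false D _ G M r s (fun n d b => (binom_rem (q - 1) 0 (ratio (S n) d b) - binom_rem (q - 1) 0 (ratio n d b)) * picard (S n) d b)
             (fun n d b => binom_rem (q - 1) 0 (ratio n d b) * increment n d b)).
           ++ apply (wC_weaken D M r (s + a + s)); [exact HD|lra|lra|].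
              apply (Ck_mult_eq false D _ G M r 1 r (s + a) s _ (fun n d b => binom_rem (q - 1) 0 (ratio (S n) d b) - binom_rem (q - 1) 0 (ratio n d b))
                (fun n => picard (S n))); [now apply wC_binom_rem_increment|now apply (wC_shift D M 1 s picard)|ring|ring].
           ++ apply (Ck_mult_eq false D _ G M 1 r r 0 s s (fun n d b => binom_rem (q - 1) 0 (ratio n d b)) increment); [|easy|ring|ring].
              apply wC_binom_rem0. now apply wC_ratio.
    + apply (Ck_minus false D _ G M 1 s (cs (w' 1%nat)) (cs (w' O))); apply (wC_slice M 1); [lra|easy|lra|easy].
    + intros n d b Hd.
      change (w' (S (S n))) with (duhamel (cut (fun d b => alpha (S n) d b * w' (S n) d b + f (S n) d b))).
      change (w' (S n) d b) with (duhamel (cut (fun d b => alpha n d b * w' n d b + f n d b)) d b) at 1.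
      rewrite <- duhamel_minus; [|apply Wslice|apply Wslice|easy]. f_equal. f_equal.
      apply functional_extensionality. intros x. apply functional_extensionality. intros y. ring.
Qed.

Definition sol : R -> R -> R := seqlim picard.

Lemma layer_le1 d b : D d b -> d <= 1.
Proof. intros [_ H]. specialize (rho_le1 b). lra. Qed.

Lemma sol_weighted : weighted D 1 s (cs sol).
Proof.
  apply (weighted_lim D HO HD layer_le1 r ltac:(lra) s picard picard_weighted). exact increment_weighted.
Qed.

Lemma wC_sol M : wC D M 1 (- a - 2) (cs P) -> wC D M 1 a (cs iV) -> wC D M 1 (s - 2) (cs Rs) ->
  wC D M 1 s (cs sol).
Proof.
  intros CP CV CR. apply (wC_lim D HO HD layer_le1 r ltac:(lra) M s picard).
  - now apply wC_picard.
  - now apply wC_increment.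
Qed.

Lemma sol_is_lim d b : D d b -> is_lim_seq (fun n => picard n d b) (sol d b).
Proof. apply (lim_is_lim D HO HD layer_le1 r ltac:(lra) s picard). exact increment_weighted. Qed.

Lemma sol_tame : tame sol.
Proof.
  intros d b Hd.
  apply (is_lim_seq_le (fun n => Rabs (picard n d b * iV d b)) (fun _ => eps0) (Rabs (sol d b * iV d b)) eps0).
  - intros n. now apply picard_tame.
  - apply (is_lim_seq_abs _ (Finite (sol d b * iV d b))).
    apply (is_lim_seq_mult' _ _ (sol d b) (iV d b)); [now apply sol_is_lim|apply is_lim_seq_const].
  - apply is_lim_seq_const.
Qed.

Lemma sol_adm : adm (nonlin sol).
Proof. apply adm_nonlin; [exact sol_weighted|exact sol_tame]. Qed.

(** Both sides are limits of the same sequence. *)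
Lemma sol_fixed d b : D d b -> sol d b = duhamel (cut (nonlin sol)) d b.
Proof.
  intros Hd. pose proof increment_weighted as [_ HI]. destruct (HI (Rabs b + 2)) as [K HK].
  pose proof (HD d b Hd) as Hd0. pose proof (layer_le1 d b Hd) as Hd1.
  pose proof (Rle_abs b). pose proof (Rle_abs (- b)). rewrite Rabs_Ropp in *.
  assert (Hn : forall n e y, triangle d b e y -> Rabs (picard n e y - sol e y) <= K * Rpower e s / (1 - r) * r ^ n).
  { intros n e y (De & H1 & H2). apply (geometric_limit (fun n => picard n e y) (K * Rpower e s) r); [lra|].
    intros k. specialize (HK k e y De (layer_le1 e y De)). pose proof (HD e y De). unfold increment in HK.
    replace (K * Rpower e s * r ^ k) with (K * r ^ k * Rpower e s) by ring. apply HK; lra. }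
  assert (HT : forall n, Rabs (picard (S n) d b - duhamel (cut (nonlin sol)) d b) <= theta * K / (1 - r) * Rpower d s * r ^ n).
  { intros n. simpl picard. rewrite <- duhamel_minus; [|apply picard_adm|apply sol_adm|easy].
    replace (theta * K / (1 - r) * Rpower d s * r ^ n)
      with ((theta * (s * (s - 1)) * (K / (1 - r) * r ^ n)) / (s * (s - 1)) * Rpower d s) by (field; nra).
    apply duhamel_triangle_bound; [apply adm_minus; [apply picard_adm|apply sol_adm]|easy|]. intros e y Hey.
    assert (De : D e y) by apply Hey.
    eapply Rle_trans; [apply nonlin_lip; [easy|now apply picard_tame|now apply sol_tame]|].
    specialize (Hn n e y Hey). pose proof (Rpower_pos e (-2)).
    assert (E : Rpower e (-2) * Rpower e s = Rpower e (s - 2)) by (rewrite <- Rpower_plus; f_equal; ring).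
    rewrite <- E. replace (theta * (s * (s - 1)) * (K / (1 - r) * r ^ n) * (Rpower e (-2) * Rpower e s))
      with (theta * (s * (s - 1)) * Rpower e (-2) * (K * Rpower e s / (1 - r) * r ^ n)) by (field; lra).
    apply Rmult_le_compat_l; [|easy]. apply Rmult_le_pos; [apply Rmult_le_pos; [lra|nra]|lra]. }
  assert (L1 : is_lim_seq (fun n => picard (S n) d b) (sol d b)).
  { apply -> (is_lim_seq_incr_1 (fun n => picard n d b)). now apply sol_is_lim. }
  assert (L2 : is_lim_seq (fun n => picard (S n) d b) (duhamel (cut (nonlin sol)) d b)).
  { apply is_lim_seq_spec. intros eps. destruct (geom_small r ltac:(lra) (theta * K / (1 - r) * Rpower d s) eps (cond_pos eps)) as [N HN].
    exists N. intros n Hn'. eapply Rle_lt_trans; [apply HT|now apply HN]. }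
  apply is_lim_seq_unique in L1. apply is_lim_seq_unique in L2. rewrite L1 in L2. now injection L2.
Qed.

End Picard.

Lemma fixed_point_exists rho (rho_pos : forall b, 0 < rho b)
  (rho_lip : forall x y, Rabs (rho x - rho y) <= Rabs (x - y)) (rho_le1 : forall b, rho b <= 1)
  s theta (Hs : 2 < s) (Htheta : 0 <= theta < 1) a q eps0 P iV Rs (Ha : 0 < a) (Heps : 0 < eps0 <= / 2)
  (HP : weighted (layer rho) 1 (- a - 2) (cs P)) (HV : weighted (layer rho) 1 a (cs iV))
  (HR : weighted (layer rho) 1 (s - 2) (cs Rs))
  (Hcoef : forall d b y, layer rho d b -> Rabs y <= eps0 ->
     Rabs (P d b * (q * Rpower (1 + y) (q - 1)) * iV d b) <= theta * (s * (s - 1)) * Rpower d (-2))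
  (Hsmall : forall d b, layer rho d b -> exists X, 0 <= X /\ forall e y, triangle rho d b e y ->
     Rabs (Rs e y) <= (1 - theta) * (s * (s - 1)) * X * Rpower e (s - 2) /\
     X * Rpower e s * Rabs (iV e y) <= eps0) :
  exists w, (forall d b, layer rho d b -> Rabs (w d b * iV d b) <= eps0) /\
    weighted (layer rho) 1 s (cs w) /\
    weighted (layer rho) 1 (s - 2) (cs (nonlin q P iV Rs w)) /\
    (forall d b, layer rho d b -> w d b = duhamel (cut (nonlin q P iV Rs w)) d b) /\
    forall M, wC (layer rho) M 1 (- a - 2) (cs P) -> wC (layer rho) M 1 a (cs iV) ->
      wC (layer rho) M 1 (s - 2) (cs Rs) ->
      wC (layer rho) M 1 s (cs w) /\ wC (layer rho) M 1 (s - 2) (cs (nonlin q P iV Rs w)).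
Proof.
  assert (Hr : theta < (1 + theta) / 2 < 1) by lra.
  pose proof (sol_tame rho rho_pos rho_lip rho_le1 s theta Hs Htheta a q eps0 P iV Rs Ha Heps HP HV HR Hcoef Hsmall _ Hr) as T.
  exists (sol q P iV Rs). split; [exact T|]. split; [|split; [|split]].
  - exact (sol_weighted rho rho_pos rho_lip rho_le1 s theta Hs Htheta a q eps0 P iV Rs Ha Heps HP HV HR Hcoef Hsmall _ Hr).
  - exact (sol_adm rho rho_pos rho_lip rho_le1 s theta Hs Htheta a q eps0 P iV Rs Ha Heps HP HV HR Hcoef Hsmall _ Hr).
  - exact (sol_fixed rho rho_pos rho_lip rho_le1 s theta Hs Htheta a q eps0 P iV Rs Ha Heps HP HV HR Hcoef Hsmall _ Hr).
  - intros M CP CV CR.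
    pose proof (wC_sol rho rho_pos rho_lip rho_le1 s theta Hs Htheta a q eps0 P iV Rs Ha Heps HP HV HR Hcoef Hsmall _ Hr M CP CV CR) as Cw.
    split; [exact Cw|].
    apply (wC_nonlin rho rho_lip s Hs a q eps0); try assumption.
Qed.

(** * Lipschitz minorants and derivatives along the diagonal *)

(** A property that holds near each point at some positive scale holds at a scale
    varying in a 1-Lipschitz way: take half of the supremum of the t such that P
    holds at scale t throughout the interval of radius t. *)
Lemma lipschitz_minorant (P : R -> R -> Prop) :
  (forall x t t', 0 < t' <= t -> P x t -> P x t') ->
  (forall x0, exists t, 0 < t /\ forall x, Rabs (x - x0) < t -> P x t) ->
  exists rho : R -> R, (forall x, 0 < rho x) /\ (forall x, rho x <= 1) /\
    (forall x y, Rabs (rho x - rho y) <= Rabs (x - y)) /\ (forall x, P x (rho x)).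
Proof.
  intros Hdown Hloc.
  set (E := fun x t => 0 < t <= 1 /\ forall y, Rabs (y - x) < t -> P y t).
  assert (Hne : forall x, exists t, E x t).
  { intros x. destruct (Hloc x) as [t [Ht H]]. exists (Rmin t 1).
    assert (0 < Rmin t 1) by (apply Rmin_pos; lra).
    split; [split; [easy|apply Rmin_r]|]. intros y Hy. pose proof (Rmin_l t 1).
    apply (Hdown y t); [lra|]. apply H. lra. }
  assert (Hb : forall x, bound (E x)) by (intros x; exists 1; intros t [Ht _]; lra).
  set (r := fun x => proj1_sig (completeness (E x) (Hb x) (Hne x))).
  assert (Hr : forall x, is_lub (E x) (r x)) by (intros x; exact (proj2_sig (completeness (E x) (Hb x) (Hne x)))).
  assert (Hpos : forall x, 0 < r x).
  { intros x. destruct (Hne x) as [t Ht]. destruct (Hr x) as [H _]. specialize (H t Ht). destruct Ht. lra. }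
  assert (Hlip : forall x y, r x - r y <= Rabs (x - y)).
  { intros x y. assert (r x <= r y + Rabs (x - y)); [|lra].
    apply (proj2 (Hr x)). intros t [Ht HP]. destruct (Rlt_dec 0 (t - Rabs (x - y))) as [L|L].
    - assert (t - Rabs (x - y) <= r y); [|lra]. apply (proj1 (Hr y)). split; [pose proof (Rabs_pos (x - y)); lra|].
      intros z Hz. apply (Hdown z t); [pose proof (Rabs_pos (x - y)); lra|]. apply HP.
      replace (z - x) with ((z - y) + - (x - y)) by ring. eapply Rle_lt_trans; [apply Rabs_triang|].
      rewrite Rabs_Ropp. lra.
    - specialize (Hpos y). lra. }
  (* half, because the supremum itself may not be attained *)
  exists (fun x => r x / 2). split; [|split; [|split]].
  - intros x. specialize (Hpos x). lra.
  - intros x. assert (r x <= 1); [|lra]. apply (proj2 (Hr x)). intros t [Ht _]. lra.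
  - intros x y. pose proof (Hlip x y). pose proof (Hlip y x). rewrite (Rabs_minus_sym y x) in *.
    pose proof (Rabs_pos (x - y)). apply Rabs_le. lra.
  - intros x. destruct (classic (exists t, E x t /\ r x / 2 < t)) as [[t [[Ht H] L]]|Hn].
    + apply (Hdown x t); [specialize (Hpos x); lra|]. apply H. rewrite Rminus_eq_0, Rabs_R0. lra.
    + exfalso. assert (r x <= r x / 2); [|specialize (Hpos x); lra].
      apply (proj2 (Hr x)). intros t Ht. apply Rnot_lt_le. intros L. apply Hn. now exists t.
Qed.

Lemma diag_part (f fb : R -> R -> R) d b :
  locally_2d (fun u v => is_derive (fun y => f u y) v (fb u v)) d b -> continuity_2d_pt fb d b ->
  is_derive (fun z => f (d + z) (b + z) - f (d + z) b) 0 (fb d b).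
Proof.
  intros [e1 H1] Hc. apply is_derive_Reals. intros eps He.
  destruct (Hc (mkposreal _ He)) as [e2 H2]. simpl in H2.
  assert (Hm : 0 < Rmin e1 e2) by (apply Rmin_pos; apply cond_pos).
  exists (mkposreal _ Hm). intros h Hh Hh'. simpl in Hh'.
  pose proof (Rmin_l e1 e2). pose proof (Rmin_r e1 e2).
  rewrite !Rplus_0_l, !Rplus_0_r, Rminus_eq_0, Rminus_0_r.
  destruct (MVT_gen (fun y => f (d + h) y) b (b + h) (fb (d + h))) as [x [Hx E]].
  - intros x Hx. apply H1; replace (d + h - d) with h by ring; [lra|].
    unfold Rmin, Rmax in Hx. apply Rabs_def2 in Hh'. apply Rabs_def1; destruct Rle_dec; lra.
  - intros x Hx. apply derivable_continuous_pt. exists (fb (d + h) x). apply is_derive_Reals.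
    apply H1; replace (d + h - d) with h by ring; [lra|].
    unfold Rmin, Rmax in Hx. apply Rabs_def2 in Hh'. apply Rabs_def1; destruct Rle_dec; lra.
  - rewrite E. replace (fb (d + h) x * (b + h - b) / h) with (fb (d + h) x) by (field; easy).
    apply H2; replace (d + h - d) with h by ring; [lra|].
    unfold Rmin, Rmax in Hx. apply Rabs_def2 in Hh'. apply Rabs_def1; destruct Rle_dec; lra.
Qed.

Lemma is_derive_shift (g : R -> R) d l : is_derive g d l <-> is_derive (fun z => g (d + z)) 0 l.
Proof.
  split; intros H.
  - apply (is_derive_val _ _ (1 * l)); [|ring]. apply (is_derive_comp g (fun z => d + z)).
    + now rewrite Rplus_0_r.
    + apply (is_derive_val _ _ (0 + 1)); [|ring].
      apply is_derive_plus_R; [apply is_derive_const_R|apply @is_derive_id].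
  - apply (is_derive_ext_R (fun y => g (d + (y - d)))); [intros; f_equal; ring|].
    apply (is_derive_val _ _ (1 * l)); [|ring]. apply (is_derive_comp (fun z => g (d + z)) (fun y => y - d)).
    + now rewrite Rminus_eq_0.
    + apply (is_derive_val _ _ (1 - 0)); [|ring].
      apply is_derive_minus_R; [apply @is_derive_id|apply is_derive_const_R].
Qed.

(** This and its converse d_of_diag trade the derivative along (1, 1) for the
    partial derivative in d.  The mean value theorem is applied in b alone, so only
    the b-derivative has to be continuous. *)
Lemma diag_of_d (f fb : R -> R -> R) d b l :
  locally_2d (fun u v => is_derive (fun y => f u y) v (fb u v)) d b -> continuity_2d_pt fb d b ->
  is_derive (fun y => f y b) d l -> is_derive (fun z => f (d + z) (b + z)) 0 (l + fb d b).
Proof.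
  intros H1 H2 H. apply is_derive_shift in H.
  apply (is_derive_ext_R (fun z => f (d + z) b + (f (d + z) (b + z) - f (d + z) b))); [intros; ring|].
  apply is_derive_plus_R; [easy|now apply diag_part].
Qed.

Lemma d_of_diag (f fb : R -> R -> R) d b l :
  locally_2d (fun u v => is_derive (fun y => f u y) v (fb u v)) d b -> continuity_2d_pt fb d b ->
  is_derive (fun z => f (d + z) (b + z)) 0 l -> is_derive (fun y => f y b) d (l - fb d b).
Proof.
  intros H1 H2 H. apply is_derive_shift.
  apply (is_derive_ext_R (fun z => f (d + z) (b + z) - (f (d + z) (b + z) - f (d + z) b))); [intros; ring|].
  apply is_derive_minus_R; [easy|now apply diag_part].
Qed.

(** * The exact solution in a layer *)

Lemma Rpower_near_one lam c : 1 < lam -> 0 < c -> exists e, 0 < e <= / 2 /\ Rpower (1 + e) c < lam.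
Proof.
  intros Hl Hc.
  assert (L : 0 < ln lam) by (rewrite <- ln_1; apply ln_increasing; lra).
  assert (Hx : 0 < ln lam / (2 * c)) by (apply Rdiv_lt_0_compat; lra).
  assert (He : 0 < exp (ln lam / (2 * c)) - 1) by (pose proof (exp_ineq1 (ln lam / (2 * c)) ltac:(lra)); lra).
  exists (Rmin (/ 2) (exp (ln lam / (2 * c)) - 1)). split.
  - split; [apply Rmin_pos; lra|apply Rmin_l].
  - set (e := Rmin _ _). assert (0 < e) by (apply Rmin_pos; lra).
    assert (e <= exp (ln lam / (2 * c)) - 1) by apply Rmin_r.
    rewrite <- (exp_ln lam) by lra. unfold Rpower. apply exp_increasing.
    assert (ln (1 + e) <= ln lam / (2 * c)).
    { rewrite <- (ln_exp (ln lam / (2 * c))). apply Rcomplements.ln_le; lra. }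
    apply Rle_lt_trans with (c * (ln lam / (2 * c))); [apply Rmult_le_compat_l; lra|].
    replace (c * (ln lam / (2 * c))) with (ln lam / 2) by (field; lra). lra.
Qed.

Section Core.
Variables (a q gam : R) (N : nat) (W : R -> R).
Hypothesis Ha : 0 < a.
Hypothesis Hq : a * q = a + 2.
Hypothesis Hgam : 0 < gam <= 1.
Hypothesis HN1 : INR N * gam < 2 * a + 2.
Hypothesis HN2 : 2 * a + 2 < INR (S N) * gam.
Hypothesis HW : forall b, 0 < W b.
Hypothesis HWs : smooth1 (S N) W.

(** The exponent of the remainder. *)
Let s := INR (S N) * gam - a.

Lemma q_gt1 : 1 < q.
Proof. nra. Qed.

Lemma s_large : a + 2 < s.
Proof. unfold s. lra. Qed.

Section WithCorrection.
(** z is the total correction with derivative zd, and E its error. *)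
Variables (z zd E : R -> R -> R).
Hypothesis Hreg : forall M, smooth1 (S (N + M)) W ->
  wC strip (S M) 1 (gam - a) (cs z) /\ wC strip (S M) 1 (gam - a - 1) (cs zd) /\ wC strip M 1 (s - 2) (cs E).
Hypothesis HD1 : deriv_d strip (cs z) (cs zd).
Hypothesis HD2 : deriv_d strip (cs zd)
  (cs (fun d b => (a + 1) * (a + 2) * Rpower d (-2) * z d b + source a q N W z zd d b - E d b)).

Let zr := rescale a W z.

Lemma W_smooth0 : smooth1 (S (N + 0)) W.
Proof. now rewrite Nat.add_0_r. Qed.

Lemma smooth_part M : smooth1 (S (N + M)) W -> smooth1 M W.
Proof. apply smooth1_le. lia. Qed.

Lemma wC_zz M : smooth1 (S (N + M)) W -> wC strip M 1 gam (cs zr).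
Proof.
  intros H. replace gam with (gam - a + a) by ring. apply wCs_rescale; [easy|now apply smooth_part|].
  apply Ck_pred. now apply Hreg.
Qed.

Variable eps0 : R.
Hypothesis Heps : 0 < eps0 <= / 2.

(** Where the approximate solution is comparable to its leading term. *)
Definition good (d b : R) : Prop := strip d b /\ Rabs (zr d b) < eps0.

Lemma good_open : open2 good.
Proof.
  intros d b [H1 H2]. destruct (strip_open d b H1) as [e1 E1].
  pose proof (Ck_base false strip (weighted strip) _ _ _ _ (wC_zz 0 W_smooth0)) as [Hc _].
  assert (He : 0 < eps0 - Rabs (zr d b)) by lra.
  destruct (Hc O d b H1 (mkposreal _ He)) as [e2 E2]. unfold cs in E2. simpl in E2.
  assert (Hm : 0 < Rmin e1 e2) by (apply Rmin_pos; apply cond_pos).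
  exists (mkposreal _ Hm). intros u v Hu Hv. simpl in *.
  pose proof (Rmin_l e1 e2). pose proof (Rmin_r e1 e2). split; [apply E1; lra|].
  specialize (E2 u v ltac:(lra) ltac:(lra)).
  replace (zr u v) with ((zr u v - zr d b) + zr d b) by ring.
  eapply Rle_lt_trans; [apply Rabs_triang|]. lra.
Qed.

Lemma good_pos d b : good d b -> 0 < d.
Proof. intros [H _]. now apply strip_pos in H. Qed.

Let GG := weighted_graded good good_open.

Lemma restrict D D' M t h : (forall d b, D d b -> D' d b) -> wC D' M 1 t (cs h) -> wC D M 1 t (cs h).
Proof.
  intros HD. apply Ck_map; [easy|easy|]. intros k [H1 H2]. split; [intros n d b Hd; apply H1; auto|].
  intros L. destruct (H2 L) as [K HK]. exists K. intros n d b Hd. apply HK. auto.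
Qed.

Lemma wCg_product M s1 s2 t g h : wC good M 1 s1 (cs g) -> wC good M 1 s2 (cs h) -> t = s1 + s2 ->
  wC good M 1 t (cs (fun d b => g d b * h d b)).
Proof.
  intros Hg Hh ->. apply (Ck_mult_eq false good _ GG M 1 1 1 s1 s2 _ (cs g) (cs h)); [easy|easy|ring|ring].
Qed.

Lemma wCg_power M t : wC good M 1 t (cs (fun d _ => Rpower d t)).
Proof. apply (wC_Rpower good M t good_open good_pos). Qed.

Lemma wCg_W M p : smooth1 M W -> wC good M 1 0 (cs (fun _ b => Rpower (W b) p)).
Proof. intros H. apply (smooth1_wC good M (fun b => Rpower (W b) p) good_open good_pos). now apply smooth1_power. Qed.

Lemma wCg_binom_rem M p i : smooth1 (S (N + M)) W -> wC good M 1 (INR i * gam) (cs (fun d b => binom_rem p i (zr d b))).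
Proof.
  intros H. apply (wC_binom_rem good good_open good_pos M p i gam (cs zr)); [lra| |].
  - intros n d b [_ Hd]. unfold cs. lra.
  - apply (restrict _ strip); [now intros d b []|now apply wC_zz].
Qed.

(** The Taylor tail left out of source, and the error of the last correction. *)
Definition resid (d b : R) : R :=
  a * (a + 1) * (W b * (Rpower d (- a - 2) * binom_rem q (S (S N)) (zr d b))) + E d b.

Definition bulk (d b : R) : R := a * (a + 1) * (W b * (Rpower d (- a - 2) * binom_rem q 0 (zr d b))).

(** The inverse of the approximate solution W d^(-a) (1 + zr). *)
Definition inv_profile (d b : R) : R := Rpower (W b) (-1) * (Rpower d a * binom_rem (-1) 0 (zr d b)).

Lemma wCg_resid M : smooth1 (S (N + M)) W -> wC good M 1 (s - 2) (cs resid).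
Proof.
  intros H. apply (Ck_plus false good _ GG M 1 (s - 2)
    (cs (fun d b => a * (a + 1) * (W b * (Rpower d (- a - 2) * binom_rem q (S (S N)) (zr d b))))) (cs E)).
  - apply (Ck_scal false good _ GG M (a * (a + 1)) 1 (s - 2) (cs (fun d b => W b * (Rpower d (- a - 2) * binom_rem q (S (S N)) (zr d b))))).
    apply (wC_weaken good M 1 (- a - 2 + INR (S (S N)) * gam)); [exact good_pos|lra| |].
    + unfold s. rewrite (S_INR (S N)). nra.
    + apply (wCg_product M 0 (- a - 2 + INR (S (S N)) * gam)); [|apply (wCg_product M (- a - 2) (INR (S (S N)) * gam)); [apply wCg_power|now apply wCg_binom_rem|ring]|ring].
      apply (smooth1_wC good M W good_open good_pos). now apply smooth_part.
  - apply (restrict _ strip); [now intros d b []|now apply Hreg].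
Qed.

Lemma wCg_bulk M : smooth1 (S (N + M)) W -> wC good M 1 (- a - 2) (cs bulk).
Proof.
  intros H. apply (Ck_scal false good _ GG M (a * (a + 1)) 1 (- a - 2) (cs (fun d b => W b * (Rpower d (- a - 2) * binom_rem q 0 (zr d b))))).
  apply (wCg_product M 0 (- a - 2)); [|apply (wCg_product M (- a - 2) (INR 0 * gam)); [apply wCg_power|now apply wCg_binom_rem|simpl; ring]|ring].
  apply (smooth1_wC good M W good_open good_pos). now apply smooth_part.
Qed.

Lemma wCg_inv M : smooth1 (S (N + M)) W -> wC good M 1 a (cs inv_profile).
Proof.
  intros H. apply (wCg_product M 0 a); [|apply (wCg_product M a (INR 0 * gam)); [apply wCg_power|now apply wCg_binom_rem|simpl; ring]|ring].
  apply wCg_W. now apply smooth_part.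
Qed.

(** mu is the coefficient of the linearised potential and lam > 1 the ratio to it of
    the factor s (s - 1) gained by duhamel.  Perturbing the potential by relative errors eps0
    costs the factor (1 + eps0)^(2 (q - 1)), which eps0 is chosen to keep below
    lam. *)
Let mu := (a + 1) * (a + 2).
Let lam := s * (s - 1) / mu.
Hypothesis Heps_lam : Rpower (1 + eps0) (2 * (q - 1)) < lam.
Let theta := Rpower (1 + eps0) (2 * (q - 1)) / lam.

Lemma mu_pos : 0 < mu.
Proof. unfold mu. nra. Qed.

Lemma lam_pos : 0 < lam.
Proof. pose proof mu_pos. pose proof s_large. apply Rdiv_lt_0_compat; [nra|easy]. Qed.

Lemma theta_range : 0 <= theta < 1.
Proof.
  pose proof lam_pos. pose proof (Rpower_pos (1 + eps0) (2 * (q - 1))). unfold theta. split.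
  - left. now apply Rdiv_lt_0_compat.
  - apply Rlt_div_l; lra.
Qed.

Lemma theta_mu : theta * (s * (s - 1)) = mu * Rpower (1 + eps0) (2 * (q - 1)).
Proof.
  pose proof mu_pos. pose proof s_large. unfold theta, lam. field. repeat split; nra.
Qed.

Lemma coefficient_bound d b y : good d b -> Rabs y <= eps0 ->
  Rabs (bulk d b * (q * Rpower (1 + y) (q - 1)) * inv_profile d b) <= theta * (s * (s - 1)) * Rpower d (-2).
Proof.
  intros [Hd Hz] Hy. rewrite theta_mu. pose proof q_gt1.
  pose proof (Rpower_inv_r (W b) (HW b)) as HWW.
  assert (Hdd : Rpower d (- a - 2) * Rpower d a = Rpower d (-2)) by (rewrite <- Rpower_plus; f_equal; ring).
  assert (HZZ : binom_rem q 0 (zr d b) * binom_rem (-1) 0 (zr d b) = Rpower (1 + zr d b) (q - 1)).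
  { simpl. rewrite <- Rpower_plus. f_equal. }
  assert (EE : bulk d b * (q * Rpower (1 + y) (q - 1)) * inv_profile d b
    = mu * Rpower d (-2) * (Rpower (1 + zr d b) (q - 1) * Rpower (1 + y) (q - 1))).
  { unfold bulk, inv_profile.
    transitivity ((a + 1) * (a * q) * (W b * Rpower (W b) (-1)) * (Rpower d (- a - 2) * Rpower d a)
      * ((binom_rem q 0 (zr d b) * binom_rem (-1) 0 (zr d b)) * Rpower (1 + y) (q - 1))); [ring|].
    rewrite HWW, Hdd, HZZ, Hq. unfold mu. ring. }
  rewrite EE. pose proof mu_pos. pose proof (Rpower_pos d (-2)).
  pose proof (Rpower_pos (1 + zr d b) (q - 1)). pose proof (Rpower_pos (1 + y) (q - 1)).
  rewrite Rabs_pos_eq by (apply Rmult_le_pos; [apply Rmult_le_pos; lra|apply Rmult_le_pos; lra]).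
  replace (mu * Rpower (1 + eps0) (2 * (q - 1)) * Rpower d (-2))
    with (mu * Rpower d (-2) * (Rpower (1 + eps0) (q - 1) * Rpower (1 + eps0) (q - 1))).
  2:{ rewrite <- Rpower_plus. replace (q - 1 + (q - 1)) with (2 * (q - 1)) by ring. ring. }
  apply Rmult_le_compat_l; [apply Rmult_le_pos; lra|].
  apply Rabs_def2 in Hz. apply Rabs_le_between in Hy.
  apply Rmult_le_compat; try lra; apply Rle_Rpower_l; lra.
Qed.

(** Near each b the relative correction and the ratio of the remainder to the
    approximate solution are O(d^gam) and O(d^(s + a)), so both conditions hold
    for small d; lipschitz_minorant makes the choice of scale 1-Lipschitz. *)
Lemma small_layer : exists rho : R -> R, (forall x, 0 < rho x) /\ (forall x, rho x <= 1) /\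
  (forall x y, Rabs (rho x - rho y) <= Rabs (x - y)) /\
  (forall d b, layer rho d b -> good d b) /\
  (forall d b, layer rho d b -> exists X, 0 <= X /\ forall e y, triangle rho d b e y ->
     Rabs (resid e y) <= (1 - theta) * (s * (s - 1)) * X * Rpower e (s - 2) /\
     X * Rpower e s * Rabs (inv_profile e y) <= eps0).
Proof.
  pose proof s_large as s_large. pose proof theta_range as Ht.
  set (c := (1 - theta) * (s * (s - 1))). assert (Hc : 0 < c) by (unfold c; apply Rmult_lt_0_compat; nra).
  destruct (lipschitz_minorant (fun b t => t <= 1 /\ (forall e, 0 < e < t -> good e b) /\
    exists X, 0 <= X /\ forall e y, good e y -> b - t <= y - e -> y <= b ->
      Rabs (resid e y) <= c * X * Rpower e (s - 2) /\ X * Rpower e s * Rabs (inv_profile e y) <= eps0))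
    as [rho [R1 [R2 [R3 R4]]]].
  - intros b t t' Htt [H1 [H2 [X [HX H3]]]]. split; [lra|]. split; [intros e He; apply H2; lra|].
    exists X. split; [easy|]. intros e y Hg H4 H5. apply H3; [easy|lra|lra].
  - intros b0.
    pose proof (Ck_base false strip (weighted strip) _ _ _ _ (wC_zz 0 W_smooth0)) as [_ BZ].
    pose proof (Ck_base false good (weighted good) _ _ _ _ (wCg_resid 0 W_smooth0)) as [_ BR].
    pose proof (Ck_base false good (weighted good) _ _ _ _ (wCg_inv 0 W_smooth0)) as [_ BV].
    set (L := Rabs b0 + 3). destruct (BZ L) as [KZ HZ], (BR L) as [KR HR], (BV L) as [KV HV].
    (* any X with |resid| <= c X e^(s - 2) on the triangle bounds the iterates *)
    set (X := Rabs KR / c).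
    assert (HX : 0 <= X) by (apply Rmult_le_pos; [apply Rabs_pos|left; now apply Rinv_0_lt_compat]).
    destruct (Rpower_small gam (Rabs KZ) eps0 ltac:(lra) (Rabs_pos _) ltac:(lra)) as [d1 [Hd1 S1]].
    destruct (Rpower_small (s + a) (X * Rabs KV) eps0 ltac:(lra) (Rmult_le_pos _ _ HX (Rabs_pos _)) ltac:(lra)) as [d2 [Hd2 S2]].
    set (t := Rmin (Rmin (d1 / 2) (d2 / 2)) 1).
    assert (Ht0 : 0 < t) by (unfold t; repeat apply Rmin_pos; lra).
    assert (Ht1 : t <= d1 / 2 /\ t <= d2 / 2 /\ t <= 1).
    { unfold t. pose proof (Rmin_l (Rmin (d1 / 2) (d2 / 2)) 1). pose proof (Rmin_r (Rmin (d1 / 2) (d2 / 2)) 1).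
      pose proof (Rmin_l (d1 / 2) (d2 / 2)). pose proof (Rmin_r (d1 / 2) (d2 / 2)). lra. }
    exists t. split; [easy|]. intros b Hb.
    assert (Hbb : - Rabs b0 - 1 < b < Rabs b0 + 1).
    { apply Rabs_def2 in Hb. pose proof (Rle_abs b0). pose proof (Rle_abs (- b0)). rewrite Rabs_Ropp in *. lra. }
    split; [easy|]. split.
    + intros e He. assert (Hst : strip e b) by (split; [easy|unfold two; lra]). split; [easy|].
      specialize (HZ O e b Hst). rewrite pow1, Rmult_1_r in HZ. unfold cs, L in HZ.
      eapply Rle_lt_trans; [apply HZ; lra|]. eapply Rle_lt_trans; [|apply (S1 e); lra].
      apply Rmult_le_compat_r; [left; apply Rpower_pos|apply Rle_abs].
    + exists X. split; [easy|]. intros e y Hg H4 H5. pose proof (good_pos e y Hg) as He.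
      specialize (HR O e y Hg). specialize (HV O e y Hg). rewrite pow1, Rmult_1_r in *. unfold cs, L in *.
      specialize (HR ltac:(lra) ltac:(lra) ltac:(lra)). specialize (HV ltac:(lra) ltac:(lra) ltac:(lra)). split.
      * eapply Rle_trans; [exact HR|]. apply Rmult_le_compat_r; [left; apply Rpower_pos|].
        unfold X. replace (c * (Rabs KR / c)) with (Rabs KR) by (field; lra). apply Rle_abs.
      * left. eapply Rle_lt_trans; [|apply (S2 e); lra].
        rewrite Rpower_plus. pose proof (Rpower_pos e s). pose proof (Rpower_pos e a).
        replace (X * Rabs KV * (Rpower e s * Rpower e a)) with (X * Rpower e s * (Rabs KV * Rpower e a)) by ring.
        apply Rmult_le_compat_l; [apply Rmult_le_pos; lra|]. eapply Rle_trans; [exact HV|].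
        apply Rmult_le_compat_r; [lra|apply Rle_abs].
  - exists rho. split; [easy|]. split; [easy|]. split; [easy|].
    assert (HG : forall d b, layer rho d b -> good d b) by (intros d b [H1 H2]; now apply (R4 b)).
    split; [exact HG|]. intros d b [H1 H2]. destruct (R4 b) as [_ [_ [X [HX H3]]]].
    exists X. split; [easy|]. intros e y (H4 & H5 & H6). apply H3; [now apply HG|lra|easy].
Qed.

(** The equation is stated for the derivative of vd along the characteristic
    direction (1, 1), which exists even when the second partial derivatives of v
    do not. *)
Definition solves_in_layer (rho : R -> R) (v vd : R -> R -> R) : Prop :=
  (forall d b, layer rho d b -> 0 < v d b) /\
  (forall M, smooth1 (S (N + M)) W -> Ck false (layer rho) (cont_class (layer rho)) M 1 0 (cs v) /\
     Ck false (layer rho) (cont_class (layer rho)) M 1 0 (cs vd)) /\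
  (forall d b, layer rho d b -> is_derive (fun y => v y b) d (vd d b)) /\
  (forall d b, layer rho d b -> is_derive (fun x => vd (d + x) (b + x)) 0
     (a * (a + 1) * (Rpower (W b) (1 - q) * Rpower (v d b) q))) /\
  (forall L, exists K, forall d b, layer rho d b -> - L <= b - d -> b <= L ->
     Rabs (v d b - W b * Rpower d (- a)) <= K * Rpower d (gam - a)).

Lemma wC_cont D M t h : wC D M 1 t (cs h) -> Ck false D (cont_class D) M 1 0 (cs h).
Proof. apply Ck_map; auto. intros k [H _]. exact H. Qed.

Lemma profile_factor d b : strip d b -> profile a W z d b = W b * (Rpower d (- a) * (1 + zr d b)).
Proof.
  intros Hd. unfold profile, zr, rescale.
  pose proof (Rpower_inv_r (W b) (HW b)) as HWW.
  pose proof (Rpower_cancel d a) as Hdd.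
  transitivity (W b * Rpower d (- a) + (W b * Rpower (W b) (-1)) * (Rpower d (- a) * Rpower d a) * z d b); [rewrite HWW, Hdd; ring|ring].
Qed.

(** The solution factors as W d^(-a) (1 + zr) (1 + w iV), with both brackets
    positive; its q-th power is then the product of the powers of the factors, which
    is the form in which the nonlinearity was expanded. *)
Lemma solution_in_layer : exists rho v vd, (forall x, 0 < rho x) /\ (forall x, rho x <= 1) /\
  (forall x y, Rabs (rho x - rho y) <= Rabs (x - y)) /\ solves_in_layer rho v vd.
Proof.
  destruct small_layer as [rho [R1 [R2 [R3 [HG Hsm]]]]].
  pose proof s_large as s_large. pose proof q_gt1 as q_gt1.
  assert (HP : forall M, smooth1 (S (N + M)) W -> wC (layer rho) M 1 (- a - 2) (cs bulk))
    by (intros M H; apply (restrict _ good); [easy|now apply wCg_bulk]).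
  assert (HV : forall M, smooth1 (S (N + M)) W -> wC (layer rho) M 1 a (cs inv_profile))
    by (intros M H; apply (restrict _ good); [easy|now apply wCg_inv]).
  assert (HR : forall M, smooth1 (S (N + M)) W -> wC (layer rho) M 1 (s - 2) (cs resid))
    by (intros M H; apply (restrict _ good); [easy|now apply wCg_resid]).
  destruct (fixed_point_exists rho R1 R3 R2 s theta ltac:(lra) theta_range a q eps0 bulk inv_profile resid Ha Heps
    (Ck_base _ _ _ _ _ _ _ (HP O W_smooth0)) (Ck_base _ _ _ _ _ _ _ (HV O W_smooth0)) (Ck_base _ _ _ _ _ _ _ (HR O W_smooth0))
    (fun d b y Hd => coefficient_bound d b y (HG d b Hd)) Hsm)
    as [w [W1 [W2 [W3 [W4 W5]]]]].
  set (g := nonlin q bulk inv_profile resid w) in *.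
  assert (HS : forall d b, layer rho d b -> strip d b) by (intros d b H; now apply HG).
  pose proof (layer_open rho R3) as HO.
  assert (Gc := cont_class_graded (layer rho) HO).
  destruct (profile_deriv a q N W Hq HW z zd E HD1 HD2) as [Pd1 Pd2].
  pose proof (adm_cont rho R3 s ltac:(lra) g W3) as Cg.
  exists rho, (fun d b => profile a W z d b + w d b), (fun d b => profile_d a W zd d b + char_int (cut g) d b).
  split; [easy|]. split; [easy|]. split; [easy|].
  assert (Vfac : forall d b, layer rho d b ->
    profile a W z d b + w d b = W b * (Rpower d (- a) * ((1 + zr d b) * (1 + w d b * inv_profile d b)))).
  { intros d b Hd. pose proof (HS d b Hd) as Hst. rewrite (profile_factor d b Hst). unfold inv_profile.
    pose proof (Rpower_inv_r (W b) (HW b)) as HWW.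
    pose proof (Rpower_cancel d a) as Hdd.
    assert (Hz : (1 + zr d b) * binom_rem (-1) 0 (zr d b) = 1).
    { simpl. destruct (HG d b Hd) as [_ Hz]. apply Rabs_def2 in Hz.
      apply Rpower_inv_r. lra. }
    transitivity (W b * (Rpower d (- a) * (1 + zr d b)) + w d b * (W b * Rpower (W b) (-1))
      * (Rpower d (- a) * Rpower d a) * ((1 + zr d b) * binom_rem (-1) 0 (zr d b))); [rewrite HWW, Hdd, Hz; ring|ring]. }
  split; [|split; [|split; [|split]]].
  - intros d b Hd. rewrite Vfac by easy. destruct (HG d b Hd) as [_ Hz]. apply Rabs_def2 in Hz.
    specialize (W1 d b Hd). apply Rabs_le_between in W1. pose proof (Rpower_pos d (- a)). pose proof (HW b).
    repeat apply Rmult_lt_0_compat; lra.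
  - intros M HM. destruct (W5 M (HP M HM) (HV M HM) (HR M HM)) as [Cw Cgg].
    destruct (Hreg M HM) as [Cz [Czd _]]. apply Ck_pred in Cz. apply Ck_pred in Czd.
    pose proof (smooth_part M HM) as HM'. split.
    + apply (Ck_plus false _ _ Gc M 1 0 (cs (profile a W z)) (cs w)); [|now apply (wC_cont _ _ s)].
      apply (Ck_plus false _ _ Gc M 1 0 (cs (fun d b => W b * Rpower d (- a))) (cs z)).
      * apply (wC_cont _ _ (- a)). apply (restrict _ strip); [easy|].
        apply (wC_product M 0 (- a)); [now apply wCs_of_b|apply wC_power|ring].
      * apply (wC_cont _ _ (gam - a)). now apply (restrict _ strip).
    + apply (Ck_plus false _ _ Gc M 1 0 (cs (profile_d a W zd)) (cs (char_int (cut g)))).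
      * apply (Ck_plus false _ _ Gc M 1 0 (cs (lead_d a W)) (cs zd)).
        -- apply (wC_cont _ _ (- a - 1)). apply (restrict _ strip); [easy|]. now apply wCs_lead_d.
        -- apply (wC_cont _ _ (gam - a - 1)). now apply (restrict _ strip).
      * apply (wC_cont _ _ (s - 2 + 1)). apply (wC_char_int rho R1 R3 M 1 (s - 2) (cs g)); [lra|easy].
  - intros d b Hd. apply is_derive_plus_R; [apply (Pd1 O d b (HS d b Hd))|].
    apply (is_derive_ext_loc (fun y => duhamel (cut g) y b)).
    + generalize (open2_slice_d _ d b HO Hd). apply filter_imp. intros y Hy. symmetry. now apply W4.
    + apply (duhamel_deriv_d rho R1 R3 (cut g) Cg). apply Hd.
  - intros d b Hd. pose proof (HS d b Hd) as Hst.
    assert (Hpd : wC strip 1 1 (- a - 1) (cs (profile_d a W zd))).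
    { apply wCs_plus; [apply wCs_lead_d; apply (smooth1_le 1 (S N)); [lia|easy]|].
      destruct (Hreg O W_smooth0) as [_ [H _]]. apply (wCs_weaken _ (gam - a - 1)); [lra|easy]. }
    destruct (wCs_deriv O _ _ Hpd) as [Cpd Epd].
    assert (HDp : is_derive (fun x => profile_d a W zd (d + x) (b + x)) 0
      (a * (a + 1) * (W b * (Rpower d (- a - 2) * (binom_rem q 0 (zr d b) - binom_rem q (S (S N)) (zr d b)))) - E d b)).
    { destruct (HG d b Hd) as [_ Hz].
      eapply is_derive_val; [apply (diag_of_d (profile_d a W zd) (fun d b => Derive (fun y => profile_d a W zd d y) b) d b)|].
      - destruct (strip_open d b Hst) as [e He]. exists e. intros u v Hu Hv. apply Derive_correct, Epd. now apply He.
      - apply (proj1 (Ck_base false strip (weighted strip) _ _ _ _ Cpd) O d b Hst).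
      - apply Pd2; [easy|]. fold zr. lra.
      - unfold zr. ring. }
    eapply is_derive_val; [apply is_derive_plus_R; [exact HDp|apply (char_int_diag rho R1 R3 (cut g) Cg); apply Hd]|].
    rewrite cut_pos by apply Hd. unfold g, nonlin, resid.
    change (binom_rem q 1 (w d b * inv_profile d b)) with (binom_rem q 0 (w d b * inv_profile d b) - 1 * 1).
    rewrite Vfac by easy. destruct (HG d b Hd) as [_ Hz]. apply Rabs_def2 in Hz.
    specialize (W1 d b Hd). apply Rabs_le_between in W1. pose proof (HW b) as HWb. pose proof (Rpower_pos d (- a)).
    set (x := 1 + zr d b) in *. set (y := 1 + w d b * inv_profile d b) in *.
    assert (0 < x) by (unfold x; lra). assert (0 < y) by (unfold y; lra).
    rewrite <- (Rpower_mult_distr (W b)), <- (Rpower_mult_distr (Rpower d (- a))), <- (Rpower_mult_distr x)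
      by (try easy; repeat apply Rmult_lt_0_compat; easy).
    rewrite Rpower_mult. replace (- a * q) with (- a - 2) by lra.
    assert (HWq : Rpower (W b) (1 - q) * Rpower (W b) q = W b).
    { rewrite <- Rpower_plus. replace (1 - q + q) with 1 by ring. now apply Rpower_1. }
    transitivity (a * (a + 1) * ((Rpower (W b) (1 - q) * Rpower (W b) q) * (Rpower d (- a - 2) * (Rpower x q * Rpower y q)))); [|ring].
    rewrite HWq. unfold bulk. change (binom_rem q 0 (zr d b)) with (Rpower x q).
    change (binom_rem q 0 (w d b * inv_profile d b)) with (Rpower y q). ring.
  - intros L.
    destruct (Hreg O W_smooth0) as [Cz _]. destruct (Ck_base false strip (weighted strip) _ _ _ _ Cz) as [_ Bz].
    destruct (Bz L) as [K1 H1]. destruct W2 as [_ Bw]. destruct (Bw L) as [K2 H2]. exists (Rabs K1 + Rabs K2).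
    intros d b Hd H3 H4. assert (Hd1 : d <= 1) by (destruct Hd; specialize (R2 b); lra).
    specialize (H1 O d b (HS d b Hd) Hd1 H3 H4). specialize (H2 O d b Hd Hd1 H3 H4).
    rewrite pow1, Rmult_1_r in *. unfold cs in *. unfold profile.
    replace (W b * Rpower d (- a) + z d b + w d b - W b * Rpower d (- a)) with (z d b + w d b) by ring.
    eapply Rle_trans; [apply Rabs_triang|].
    assert (A : Rpower d s <= Rpower d (gam - a)).
    { apply Rpower_exp_anti; [destruct Hd; lra|]. lra. }
    pose proof (Rpower_pos d s). pose proof (Rpower_pos d (gam - a)). pose proof (Rle_abs K1). pose proof (Rle_abs K2).
    pose proof (Rabs_pos K2).
    assert (K1 * Rpower d (gam - a) <= Rabs K1 * Rpower d (gam - a)) by (apply Rmult_le_compat_r; lra).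
    assert (K2 * Rpower d s <= Rabs K2 * Rpower d (gam - a)) by nra.
    lra.
Qed.

End WithCorrection.

Theorem layer_solution : exists rho v vd, (forall x, 0 < rho x) /\ (forall x, rho x <= 1) /\
  (forall x y, Rabs (rho x - rho y) <= Rabs (x - y)) /\ solves_in_layer rho v vd.
Proof.
  assert (Hcorr : forall M, smooth1 (S (N + M)) W -> corrections_spec a q gam N W N M)
    by (intros M HM; now apply corrections_induct).
  unfold corrections_spec in Hcorr. destruct (corrections a q N W N) as [[z zd] E] eqn:EC.
  pose proof s_large. pose proof q_gt1.
  assert (Hl : 1 < s * (s - 1) / ((a + 1) * (a + 2))).
  { apply Rlt_div_r; nra. }
  (* s (s - 1) > (a + 1) (a + 2) leaves room for a relative error eps0 *)
  destruct (Rpower_near_one _ (2 * (q - 1)) Hl ltac:(lra)) as [eps0 [He1 He2]].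
  destruct (Hcorr O) as [_ [_ [_ [D1 D2]]]]; [now rewrite Nat.add_0_r|].
  apply (solution_in_layer z zd E) with (eps0 := eps0); try easy.
  intros M HM. destruct (Hcorr M HM) as [C1 [C2 [C3 _]]]. exact (conj C1 (conj C2 C3)).
Qed.

End Core.

(** * Regularity in all directions *)

Definition box (d b e u y : R) : Prop := Rabs (u - d) < e /\ Rabs (y - b) < e.

Lemma box_open d b e : open2 (box d b e).
Proof.
  intros u y [H1 H2].
  assert (Hm : 0 < Rmin (e - Rabs (u - d)) (e - Rabs (y - b))) by (apply Rmin_pos; lra).
  exists (mkposreal _ Hm). intros u' y' Hu Hy. simpl in *.
  pose proof (Rmin_l (e - Rabs (u - d)) (e - Rabs (y - b))). pose proof (Rmin_r (e - Rabs (u - d)) (e - Rabs (y - b))).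
  split.
  - replace (u' - d) with ((u' - u) + (u - d)) by ring. eapply Rle_lt_trans; [apply Rabs_triang|]. lra.
  - replace (y' - b) with ((y' - y) + (y - b)) by ring. eapply Rle_lt_trans; [apply Rabs_triang|]. lra.
Qed.

Lemma box_seg d b e u y : box d b e u y -> forall x, Rmin d u <= x <= Rmax d u -> box d b e x y.
Proof.
  intros [H1 H2] x Hx. split; [|easy]. apply Rabs_def2 in H1. unfold Rmin, Rmax in Hx.
  apply Rabs_def1; destruct Rle_dec; lra.
Qed.

(** A symmetry of mixed derivatives that yields the existence of h_bd from that of
    h_db: write h as an integral of hd in d and differentiate under the integral. *)
Lemma mixed_partials (D : R -> R -> Prop) (h hb hd hdb : R -> R -> R) : open2 D ->
  (forall d b, D d b -> is_derive (fun y => h d y) b (hb d b)) ->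
  (forall d b, D d b -> is_derive (fun y => h y b) d (hd d b)) ->
  (forall d b, D d b -> is_derive (fun y => hd d y) b (hdb d b)) ->
  (forall d b, D d b -> continuity_2d_pt hd d b) ->
  (forall d b, D d b -> continuity_2d_pt hdb d b) ->
  forall d b, D d b -> is_derive (fun y => hb y b) d (hdb d b).
Proof.
  intros HO Hb Hd Hdb Cd Cdb d b H. destruct (HO d b H) as [e He].
  assert (HB : forall u y, box d b e u y -> D u y) by (intros u y [H1 H2]; now apply He).
  assert (H0 : box d b e d b) by (split; rewrite Rminus_eq_0, Rabs_R0; apply cond_pos).
  assert (E : forall u y, box d b e u y -> h u y - h d y = prim d hd u y).
  { intros u y Huy. symmetry. apply is_RInt_unique_R. apply (is_RInt_derive_R (fun x => h x y)).
    - intros x Hx. apply Hd, HB. now apply (box_seg d b e u y).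
    - intros x Hx. apply cont2_slice_d, Cd, HB. now apply (box_seg d b e u y). }
  assert (Eb : forall u, box d b e u b -> hb u b = hb d b + prim d hdb u b).
  { intros u Hu.
    assert (Q1 : is_derive (fun y => h u y - h d y) b (hb u b - hb d b)).
    { apply is_derive_minus_R; apply Hb; [now apply HB|easy]. }
    assert (Q2 : is_derive (fun y => h u y - h d y) b (prim d hdb u b)).
    { apply (is_derive_ext_loc (fun y => prim d hd u y)).
      - generalize (open2_slice_b _ u b (box_open d b e) Hu). apply filter_imp. intros y Hy. symmetry. now apply E.
      - apply (prim_deriv_b (box d b e) d (box_open d b e) (box_seg d b e)); [| | |easy].
        + intros x y Hxy. apply Cd. now apply HB.
        + intros x y Hxy. apply Cdb. now apply HB.
        + intros x y Hxy. apply Hdb. now apply HB. }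
    apply is_derive_unique in Q1. apply is_derive_unique in Q2. rewrite Q1 in Q2. lra. }
  apply (is_derive_ext_loc (fun u => hb d b + prim d hdb u b)).
  - generalize (open2_slice_d _ d b (box_open d b e) H0). apply filter_imp. intros u Hu. symmetry. now apply Eb.
  - apply (is_derive_val _ _ (0 + hdb d b)); [|ring].
    apply is_derive_plus_R; [apply is_derive_const_R|].
    apply (prim_deriv_d (box d b e) d (box_open d b e) (box_seg d b e)); [|easy].
    intros x y Hxy. apply Cdb. now apply HB.
Qed.

Section FullRegularity.
Variable D : R -> R -> Prop.
Hypothesis HO : open2 D.
Let G := cont_class_graded D HO.

Definition jet (M : nat) : R -> R -> seqfun -> Prop := Ck true D (cont_class D) M.

Lemma jet_graded M : graded D (jet M).
Proof.
  split.
  - exact HO.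
  - intros r s h k. apply (Ck_plus true D _ G).
  - intros r1 r2 s1 s2 h k. apply (Ck_mult true D _ G).
  - intros r s h k. apply (Ck_ext true D _ G).
  - intros c. apply (Ck_const true D _ G).
Qed.

Lemma jet_cont M r s h : jet M r s h -> cont_class D r s h.
Proof. apply (Ck_base true D (cont_class D) M). Qed.

(** I derivatives in b whose results are C^M in both variables; the two orders are
    traded against each other. *)
Definition mixed (I M : nat) : seqfun -> Prop := Ck false D (jet M) I 1 0.

Lemma mixed_base I M h : mixed I M h -> jet M 1 0 h.
Proof. apply (Ck_base false D (jet M) I). Qed.

(** One b-derivative of h can be exchanged for one order of joint regularity once the
    d-derivative hd is known to be as regular. *)
Lemma raise I : forall M h hd, mixed (S I) M h -> mixed I M hd -> deriv_d D h hd -> mixed I (S M) h.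
Proof.
  induction I as [|I IH]; intros M h hd Hh Hhd Dd.
  - destruct Hh as [H0 [[hb [Db Hb]] _]]. split; [|easy]. split; [now apply (jet_cont M 1 0)|]. split.
    + exists hb. split; [easy|exact (mixed_base O M hb Hb)].
    + intros _. exists hd. split; [easy|exact (mixed_base O M hd Hhd)].
  - pose proof (mixed_base _ _ _ Hhd) as Hhd0. pose proof Hh as [H0 [[hb [Db Hb]] _]].
    pose proof Hhd as [_ [[hdb [Ddb Hdb]] _]].
    split.
    + split; [now apply (jet_cont M 1 0)|]. split.
      * exists hb. split; [easy|]. exact (mixed_base (S I) M hb Hb).
      * intros _. exists hd. split; [easy|exact Hhd0].
    + split; [|easy]. exists hb. split; [easy|]. apply (IH M hb hdb); [easy|easy|].
      intros n. apply (mixed_partials D (h n) (hb n) (hd n) (hdb n)); [easy|apply Db|apply Dd|apply Ddb| |].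
      * now apply (jet_cont M 1 0).
      * apply (jet_cont M 1 0). exact (mixed_base I M hdb Hdb).
Qed.

Variables (v vd : R -> R -> R) (c : R -> R) (q : R) (M : nat).
Hypothesis v_pos : forall d b, D d b -> 0 < v d b.
Hypothesis Cv : Ck false D (cont_class D) M 1 0 (cs v).
Hypothesis Cvd : Ck false D (cont_class D) M 1 0 (cs vd).
Hypothesis Dv : forall d b, D d b -> is_derive (fun y => v y b) d (vd d b).
Hypothesis Dvd : forall d b, D d b -> is_derive (fun x => vd (d + x) (b + x)) 0 (c b * Rpower (v d b) q).
Hypothesis Sc : smooth1 M c.

Lemma jet_power K : jet K 1 0 (cs v) -> forall p, jet K 1 0 (cs (fun d b => Rpower (v d b) p)).
Proof.
  intros H p. apply (Ck_power true D _ G K p (cs v)); [intros n d b Hd; now apply v_pos| |easy].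
  intros q' n d b Hd. apply cont2_power; [now apply v_pos|]. apply (jet_cont _ _ _ _ H n d b Hd).
Qed.

(** The equation expresses the d-derivative of vd through v and the b-derivative of
    vd, so v and vd climb together. *)
Lemma mixed_induct K : forall I, (I + K <= M)%nat -> mixed I K (cs v) /\ mixed I K (cs vd).
Proof.
  assert (Hmix0 : forall h, Ck false D (cont_class D) M 1 0 (cs h) -> forall I, (I <= M)%nat -> mixed I 0 (cs h)).
  { intros h H I HI. apply (Ck_le false D _ I M) in H; [|easy].
    revert H. apply Ck_map; [easy|easy|]. intros k Hk. now split. }
  induction K as [|K IH]; intros I HI.
  - split; apply Hmix0; try easy; lia.
  - destruct (IH (S I) ltac:(lia)) as [Hv Hvd]. destruct (IH I ltac:(lia)) as [Hv0 Hvd0]. split.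
    + apply (raise I K (cs v) (cs vd)); [easy|easy|]. intros n. exact Dv.
    + pose proof Hvd as [_ [[vdb [Db Hb]] _]].
      apply (raise I K (cs vd) (fun n d b => c b * Rpower (v d b) q - vdb n d b)); [easy| |].
      * apply (Ck_minus false D _ (jet_graded K) I 1 0 (cs (fun d b => c b * Rpower (v d b) q)) vdb); [|easy].
        apply (Ck_mult_eq false D _ (jet_graded K) I 1 1 1 0 0 0 (of_b c) (cs (fun d b => Rpower (v d b) q))); try ring.
        -- assert (HI' : (I + K <= M)%nat) by lia. clear -HO Sc HI'. revert HI'.
           assert (Hc : forall I c, smooth1 (I + K) c -> mixed I K (of_b c)).
           { clear c Sc I. induction I as [|I IH]; intros c Hc.
             - split; [|easy]. now apply smooth1_Ck.
             - split; [apply smooth1_Ck; [easy|apply (smooth1_le K (S I + K)); [lia|easy]]|]. split; [|easy].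
               destruct Hc as [_ [c' [Dc Hc]]]. exists (of_b c'). split; [|now apply IH].
               intros n d b _. apply Dc. }
           intros HI'. apply Hc. now apply (smooth1_le _ M).
        -- apply (Ck_power false D _ (jet_graded K) I q (cs v)); [intros n d b Hd; now apply v_pos| |easy].
           apply jet_power. now apply (mixed_base I).
      * intros n d b Hd. apply (d_of_diag vd (vdb n)).
        -- destruct (HO d b Hd) as [e He]. exists e. intros u y Hu Hy. apply (Db n). now apply He.
        -- apply (jet_cont K 1 0 vdb); [now apply (mixed_base I)|easy].
        -- now apply Dvd.
Qed.

Lemma full_regularity : Ck true D (cont_class D) M 1 0 (cs v).
Proof. apply (mixed_base O). apply mixed_induct. lia. Qed.

End FullRegularity.

(** * Composition of jets *)

(** One continuous partial derivative suffices for differentiability. *)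
Lemma differentiable_of_partials (f fb : R -> R -> R) d b l :
  locally_2d (fun u v => is_derive (fun y => f u y) v (fb u v)) d b -> continuity_2d_pt fb d b ->
  is_derive (fun y => f y b) d l -> differentiable_pt_lim f d b l (fb d b).
Proof.
  intros [e1 H1] Hc Hd eps.
  assert (He : 0 < eps / 2) by (pose proof (cond_pos eps); lra).
  destruct (Hc (mkposreal _ He)) as [e2 H2]. simpl in H2.
  apply is_derive_Reals in Hd. destruct (Hd (eps / 2) He) as [e3 H3].
  assert (Hm : 0 < Rmin (Rmin e1 e2) e3) by (repeat apply Rmin_pos; apply cond_pos).
  exists (mkposreal _ Hm). intros u v Hu Hv. simpl in Hu, Hv.
  pose proof (Rmin_l (Rmin e1 e2) e3). pose proof (Rmin_r (Rmin e1 e2) e3).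
  pose proof (Rmin_l e1 e2). pose proof (Rmin_r e1 e2).
  assert (Hin : forall x, Rmin b v <= x <= Rmax b v -> Rabs (x - b) <= Rabs (v - b)).
  { intros x Hx. unfold Rmin, Rmax in Hx. destruct Rle_dec.
    - rewrite !Rabs_pos_eq; lra.
    - rewrite !Rabs_left1; lra. }
  destruct (MVT_gen (fun y => f u y) b v (fb u)) as [x [Hx E]].
  - intros x Hx. apply H1; [lra|]. specialize (Hin x ltac:(lra)). lra.
  - intros x Hx. apply derivable_continuous_pt. exists (fb u x). apply is_derive_Reals.
    apply H1; [lra|]. specialize (Hin x Hx). lra.
  - specialize (Hin x Hx).
    assert (A : Rabs (f u b - f d b - l * (u - d)) <= eps / 2 * Rabs (u - d)).
    { destruct (Req_dec u d) as [->|Hn].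
      - replace (f d b - f d b - l * (d - d)) with 0 by ring. rewrite Rminus_eq_0, !Rabs_R0. lra.
      - specialize (H3 (u - d) ltac:(lra) ltac:(lra)). replace (d + (u - d)) with u in H3 by ring.
        replace (f u b - f d b - l * (u - d)) with (((f u b - f d b) / (u - d) - l) * (u - d)) by (field; lra).
        rewrite Rabs_mult. apply Rmult_le_compat_r; [apply Rabs_pos|lra]. }
    assert (B : Rabs ((fb u x - fb d b) * (v - b)) <= eps / 2 * Rabs (v - b)).
    { rewrite Rabs_mult. apply Rmult_le_compat_r; [apply Rabs_pos|]. left. apply H2; lra. }
    replace (f u v - f d b - (l * (u - d) + fb d b * (v - b)))
      with ((f u b - f d b - l * (u - d)) + (fb u x - fb d b) * (v - b)).
    2:{ replace (f u v) with ((f u v - f u b) + f u b) by ring. rewrite E. ring. }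
    eapply Rle_trans; [apply Rabs_triang|].
    pose proof (Rmax_l (Rabs (u - d)) (Rabs (v - b))). pose proof (Rmax_r (Rabs (u - d)) (Rabs (v - b))).
    assert (eps / 2 * Rabs (u - d) <= eps / 2 * Rmax (Rabs (u - d)) (Rabs (v - b))) by (apply Rmult_le_compat_l; lra).
    assert (eps / 2 * Rabs (v - b) <= eps / 2 * Rmax (Rabs (u - d)) (Rabs (v - b))) by (apply Rmult_le_compat_l; lra).
    lra.
Qed.

(** The chain rule needs joint differentiability of f, which follows from its
    continuous partial derivatives. *)
Lemma jet_comp (U D : R -> R -> Prop) (HU : open2 U) (HD : open2 D) M : forall f g h,
  (forall t x, U t x -> D (g t x) (h t x)) ->
  jet D M 1 0 (cs f) -> jet U M 1 0 (cs g) -> jet U M 1 0 (cs h) ->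
  jet U M 1 0 (cs (fun t x => f (g t x) (h t x))).
Proof.
  pose proof (cont_class_graded U HU) as GU.
  induction M as [|M IH]; intros f g h HUD Hf Hg Hh.
  - split; [|easy]. intros n t x Htx. apply (cont2_comp f g h).
    + apply (jet_cont D 0 1 0 _ Hf n). now apply HUD.
    + now apply (jet_cont U 0 1 0 _ Hg n).
    + now apply (jet_cont U 0 1 0 _ Hh n).
  - assert (C0 : cont_class U 1 0 (cs (fun t x => f (g t x) (h t x)))).
    { intros n t x Htx. apply (cont2_comp f g h).
      - apply (jet_cont D (S M) 1 0 _ Hf n). now apply HUD.
      - now apply (jet_cont U (S M) 1 0 _ Hg n).
      - now apply (jet_cont U (S M) 1 0 _ Hh n). }
    pose proof (Ck_pred _ _ _ _ _ _ _ Hg) as Hg0. pose proof (Ck_pred _ _ _ _ _ _ _ Hh) as Hh0.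
    destruct Hf as [F0 [[fb [Dfb Fb]] Fd]]. destruct (Fd eq_refl) as [fd [Dfd Fd']]. clear Fd.
    destruct Hg as [G0 [[gb [Dgb Gb]] Gd]]. destruct (Gd eq_refl) as [gd [Dgd Gd']]. clear Gd.
    destruct Hh as [H0 [[hb [Dhb Hb]] Hd]]. destruct (Hd eq_refl) as [hd [Dhd Hd']]. clear Hd.
    assert (Cfb : cont_class D 1 0 fb) by now apply (jet_cont D M).
    assert (Df : forall d b, D d b -> differentiable_pt_lim f d b (fd O d b) (fb O d b)).
    { intros d b Hdb. apply differentiable_of_partials; [|now apply Cfb|now apply (Dfd O)].
      destruct (HD d b Hdb) as [e He]. exists e. intros u v Hu Hv. apply (Dfb O). now apply He. }
    assert (Sl : forall k, jet D M 1 0 k -> jet D M 1 0 (cs (k O))).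
    { clear. induction M as [|M IH]; intros k [K0 K].
      - split; [|easy]. intros n. apply (K0 O).
      - destruct K as [[kb [Db Kb]] Kd]. split; [intros n; apply (K0 O)|]. split.
        + exists (cs (kb O)). split; [intros n; apply (Db O)|now apply IH].
        + intros F. destruct (Kd F) as [kd [Dd Kd']]. exists (cs (kd O)). split; [intros n; apply (Dd O)|now apply IH]. }
    split; [exact C0|]. split.
    + exists (fun n t x => fd O (g t x) (h t x) * gb n t x + fb O (g t x) (h t x) * hb n t x). split.
      * intros n t x Htx. unfold cs. apply is_derive_Reals.
        apply (derivable_pt_lim_comp_2d f (fun y => g t y) (fun y => h t y)); [now apply Df, HUD| |];
          apply is_derive_Reals; [now apply (Dgb n)|now apply (Dhb n)].
      * apply (Ck_plus true U _ GU M 1 0 (fun n t x => fd O (g t x) (h t x) * gb n t x) (fun n t x => fb O (g t x) (h t x) * hb n t x)).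
        -- apply (Ck_mult_eq true U _ GU M 1 1 1 0 0 0 (cs (fun t x => fd O (g t x) (h t x))) gb); try ring; [|easy].
           apply IH; try easy. now apply Sl.
        -- apply (Ck_mult_eq true U _ GU M 1 1 1 0 0 0 (cs (fun t x => fb O (g t x) (h t x))) hb); try ring; [|easy].
           apply IH; try easy. now apply Sl.
    + intros _. exists (fun n t x => fd O (g t x) (h t x) * gd n t x + fb O (g t x) (h t x) * hd n t x). split.
      * intros n t x Htx. unfold cs. apply is_derive_Reals.
        apply (derivable_pt_lim_comp_2d f (fun y => g y x) (fun y => h y x)); [now apply Df, HUD| |];
          apply is_derive_Reals; [now apply (Dgd n)|now apply (Dhd n)].
      * apply (Ck_plus true U _ GU M 1 0 (fun n t x => fd O (g t x) (h t x) * gd n t x) (fun n t x => fb O (g t x) (h t x) * hd n t x)).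
        -- apply (Ck_mult_eq true U _ GU M 1 1 1 0 0 0 (cs (fun t x => fd O (g t x) (h t x))) gd); try ring; [|easy].
           apply IH; try easy. now apply Sl.
        -- apply (Ck_mult_eq true U _ GU M 1 1 1 0 0 0 (cs (fun t x => fb O (g t x) (h t x))) hd); try ring; [|easy].
           apply IH; try easy. now apply Sl.
Qed.

Lemma jet_ex_diff_n U (HU : open2 U) M : forall h n, jet U M 1 0 h ->
  forall t x, U t x -> ex_diff_n (h n) M t x.
Proof.
  induction M as [|M IH]; intros h n H t x Htx.
  - split; [|easy]. now apply (jet_cont U O 1 0 h H).
  - pose proof (jet_cont U _ _ _ _ H) as H0.
    destruct H as [_ [[hb [Db Hb]] Hd]]. destruct (Hd eq_refl) as [hd [Dd Hd']].
    split; [now apply H0|]. split; [exists (hd n t x); now apply Dd|]. split; [exists (hb n t x); now apply Db|].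
    destruct (HU t x Htx) as [e He]. split.
    + apply (ex_diff_n_ext_loc (hd n)); [|now apply IH].
      exists e. intros u v Hu Hv. symmetry. apply is_derive_unique, Dd. now apply He.
    + apply (ex_diff_n_ext_loc (hb n)); [|now apply IH].
      exists e. intros u v Hu Hv. symmetry. apply is_derive_unique, Db. now apply He.
Qed.

Lemma smooth1_of_derivs M : forall f,
  (forall n x, (n <= M)%nat -> ex_derive_n f n x /\ continuous (Derive_n f n) x) -> smooth1 M f.
Proof.
  induction M as [|M IH]; intros f H.
  - split; [|easy]. intros x. apply continuity_pt_filterlim. apply (H O x). lia.
  - split; [intros x; apply continuity_pt_filterlim; apply (H O x); lia|].
    exists (Derive f). split.
    + intros x. apply Derive_correct. apply (H 1%nat x). lia.
    + assert (E : forall n, Derive_n (Derive f) n = Derive_n f (S n)).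
      { intros n. apply functional_extensionality. intros x.
        replace (S n) with (n + 1)%nat by lia. rewrite <- (Derive_n_comp f n 1). reflexivity. }
      apply IH. intros n x Hn. destruct (H (S n) x ltac:(lia)) as [H1 H2]. split.
      * destruct n as [|n]; [easy|]. simpl. rewrite E. exact H1.
      * now rewrite E.
Qed.

(** * Inverse functions in one variable *)

Section Inverse.
Variables (g g' : R -> R) (c0 : R).
Hypothesis Hc0 : 0 < c0.
Hypothesis Dg : forall x, is_derive g x (g' x).
Hypothesis Cg' : forall x, continuity_pt g' x.
Hypothesis Hg' : forall x, c0 <= g' x.

Lemma increasing_slope x y : x <= y -> c0 * (y - x) <= g y - g x.
Proof.
  intros H. destruct (MVT_gen g x y g') as [z [_ E]].
  - intros z _. apply Dg.
  - intros z _. apply derivable_continuous_pt. exists (g' z). apply is_derive_Reals. apply Dg.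
  - rewrite E. apply Rmult_le_compat_r; [lra|apply Hg'].
Qed.

Lemma g_continuity : continuity g.
Proof. intros x. apply derivable_continuous_pt. exists (g' x). apply is_derive_Reals. apply Dg. Qed.

Lemma g_surjective y : { x | g x = y }.
Proof.
  set (r := Rabs (y - g 0) / c0).
  assert (Hr : c0 * r = Rabs (y - g 0)) by (unfold r; field; lra).
  assert (Hr0 : 0 <= r) by (apply Rmult_le_pos; [apply Rabs_pos|left; now apply Rinv_0_lt_compat]).
  pose proof (increasing_slope 0 r Hr0) as H1. pose proof (increasing_slope (- r) 0 ltac:(lra)) as H2.
  pose proof (Rle_abs (y - g 0)). pose proof (Rle_abs (- (y - g 0))). rewrite Rabs_Ropp in *.
  destruct (IVT_gen g (- r) r y g_continuity) as [x [_ E]].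
  - assert (g (- r) <= y <= g r) by lra. rewrite Rmin_left, Rmax_right; lra.
  - now exists x.
Qed.

Definition inverse (y : R) : R := proj1_sig (g_surjective y).

Lemma g_inverse y : g (inverse y) = y.
Proof. exact (proj2_sig (g_surjective y)). Qed.

Lemma g_injective x y : g x = g y -> x = y.
Proof.
  intros H. destruct (Rle_dec x y) as [L|L].
  - pose proof (increasing_slope x y L). nra.
  - pose proof (increasing_slope y x ltac:(lra)). nra.
Qed.

Lemma inverse_g x : inverse (g x) = x.
Proof. apply g_injective. apply g_inverse. Qed.

Lemma inverse_lipschitz x y : c0 * Rabs (inverse y - inverse x) <= Rabs (y - x).
Proof.
  rewrite <- (g_inverse y) at 2. rewrite <- (g_inverse x) at 2.
  destruct (Rle_dec (inverse x) (inverse y)) as [L|L].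
  - pose proof (increasing_slope _ _ L). rewrite !Rabs_pos_eq; [lra|nra|lra].
  - pose proof (increasing_slope (inverse y) (inverse x) ltac:(lra)). rewrite !Rabs_left1; [lra|nra|lra].
Qed.

Lemma inverse_deriv y : is_derive inverse y (/ g' (inverse y)).
Proof.
  apply is_derive_Reals. intros eps He.
  assert (He' : 0 < eps * (c0 * c0)) by (apply Rmult_lt_0_compat; nra).
  assert (Hc : continuous g' (inverse y)) by (apply continuity_pt_filterlim, Cg').
  destruct (Hc _ (locally_ball (g' (inverse y)) (mkposreal _ He'))) as [e E].
  assert (Hd : 0 < c0 * e) by (apply Rmult_lt_0_compat; [easy|apply cond_pos]).
  exists (mkposreal _ Hd). intros h Hh Hhe. simpl in Hhe.
  set (x := inverse y) in *. set (x' := inverse (y + h)).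
  destruct (MVT_gen g x x' g') as [z [Hz Ez]].
  { intros z _. apply Dg. }
  { intros z _. apply g_continuity. }
  assert (Gx : g x = y) by apply g_inverse. assert (Gx' : g x' = y + h) by apply g_inverse.
  rewrite Gx, Gx' in Ez. assert (Eh : h = g' z * (x' - x)) by lra.
  assert (Hzz : Rabs (z - x) < e).
  { pose proof (inverse_lipschitz y (y + h)) as L. fold x x' in L. replace (y + h - y) with h in L by ring.
    assert (Rabs (z - x) <= Rabs (x' - x)).
    { unfold Rmin, Rmax in Hz. destruct Rle_dec; [rewrite !Rabs_pos_eq|rewrite !Rabs_left1]; lra. }
    assert (c0 * Rabs (x' - x) < c0 * e) by lra. apply Rmult_lt_reg_l in H0; lra. }
  specialize (E z Hzz). unfold ball in E; simpl in E; unfold AbsRing_ball, abs, minus, plus, opp in E; simpl in E.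
  pose proof (Hg' z). pose proof (Hg' x).
  replace ((x' - x) / h - / g' x) with (/ g' z * / g' x * (g' x - g' z)).
  2:{ assert (x' - x <> 0) by (intros A; apply Hh; rewrite Eh, A; ring).
      rewrite Eh. field. repeat split; lra. }
  rewrite Rabs_mult, Rabs_minus_sym.
  assert (Hi : Rabs (/ g' z * / g' x) <= / (c0 * c0)).
  { rewrite Rabs_mult, !Rabs_pos_eq by (left; apply Rinv_0_lt_compat; lra). rewrite Rinv_mult.
    apply Rmult_le_compat; try (left; apply Rinv_0_lt_compat; lra); apply Rinv_le_contravar; lra. }
  apply Rle_lt_trans with (/ (c0 * c0) * Rabs (g' z - g' x)); [apply Rmult_le_compat_r; [apply Rabs_pos|easy]|].
  apply Rlt_le_trans with (/ (c0 * c0) * (eps * (c0 * c0))).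
  - apply Rmult_lt_compat_l; [apply Rinv_0_lt_compat; nra|exact E].
  - right. field. lra.
Qed.

Lemma inverse_smooth M : smooth1 M g' -> smooth1 (S M) inverse.
Proof.
  assert (C0 : forall x, continuity_pt inverse x).
  { intros x. apply derivable_continuous_pt. eexists. apply is_derive_Reals, inverse_deriv. }
  induction M as [|M IH]; intros H.
  - split; [easy|]. exists (fun y => / g' (inverse y)). split; [apply inverse_deriv|]. split; [|easy].
    intros x. apply (continuity_pt_inv (fun y => g' (inverse y))).
    + now apply (continuity_pt_comp inverse g').
    + pose proof (Hg' (inverse x)). lra.
  - split; [easy|]. exists (fun y => / g' (inverse y)). split; [apply inverse_deriv|].
    assert (Hinv : smooth1 (S M) inverse) by (apply IH; now apply smooth1_pred).
    assert (Hp : forall x, 0 < g' (inverse x)) by (intros x; pose proof (Hg' (inverse x)); lra).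
    apply (smooth1_ext _ (fun y => Rpower (g' (inverse y)) (-1))).
    + intros x. rewrite (Rpower_Ropp _ 1), Rpower_1; easy.
    + apply smooth1_power; [easy|]. now apply (smooth1_comp (S M) g' inverse).
Qed.

End Inverse.

(** * Null coordinates *)

(** At a regular point this is h^2 (u_tt - u_xx) up to o(h^2); it is a mixed
    difference in the null variables t + x and x - t. *)
Definition cross (u : R -> R -> R) (h t x : R) : R :=
  u (t + h) x + u (t - h) x - u t (x + h) - u t (x - h).

Lemma jet_snd U (HU : open2 U) M : jet U M 1 0 (cs (fun _ x => x)).
Proof. apply (smooth1_Ck true U M 1 0 (fun x => x) HU). apply smooth1_id. Qed.

Lemma jet_fst U (HU : open2 U) M : jet U M 1 0 (cs (fun t _ => t)).
Proof.
  pose proof (cont_class_graded U HU) as G. assert (C0 : cont_class U 1 0 (cs (fun t _ => t))) by (intros n t x _; apply continuity_2d_pt_id1).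
  destruct M as [|M]; [now split|]. split; [easy|]. split.
  - exists (fun _ _ _ => 0). split; [intros n t x _; apply (is_derive_const_R t)|]. exact (Ck_const true U _ G M 0).
  - intros _. exists (fun _ _ _ => 1). split; [intros n t x _; apply @is_derive_id|]. exact (Ck_const true U _ G M 1).
Qed.

Section NullCoordinates.
Variables (sigma sigma' : R -> R) (kappa : R).
Hypothesis Hkappa : 0 <= kappa < 1.
Hypothesis Dsigma : forall x, is_derive sigma x (sigma' x).
Hypothesis Csigma' : forall x, continuity_pt sigma' x.
Hypothesis Bsigma' : forall x, Rabs (sigma' x) <= kappa.

(** The values of x + t and x - t on the surface. *)
Definition out (x : R) : R := x + sigma x.
Definition out' (x : R) : R := 1 + sigma' x.
Definition inn (x : R) : R := x - sigma x.
Definition inn' (x : R) : R := 1 - sigma' x.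

Lemma slope_pos : 0 < 1 - kappa.
Proof. lra. Qed.

Lemma out_deriv x : is_derive out x (out' x).
Proof. apply is_derive_plus_R; [apply @is_derive_id|apply Dsigma]. Qed.

Lemma inn_deriv x : is_derive inn x (inn' x).
Proof. apply is_derive_minus_R; [apply @is_derive_id|apply Dsigma]. Qed.

Lemma out'_cont x : continuity_pt out' x.
Proof. apply (continuity_pt_plus (fun _ => 1) sigma'); [apply continuity_pt_const; easy|apply Csigma']. Qed.

Lemma inn'_cont x : continuity_pt inn' x.
Proof. apply (continuity_pt_minus (fun _ => 1) sigma'); [apply continuity_pt_const; easy|apply Csigma']. Qed.

Lemma out'_bound x : 1 - kappa <= out' x <= 1 + kappa.
Proof. pose proof (Bsigma' x) as H. apply Rabs_le_between in H. unfold out'. lra. Qed.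

Lemma inn'_bound x : 1 - kappa <= inn' x <= 1 + kappa.
Proof. pose proof (Bsigma' x) as H. apply Rabs_le_between in H. unfold inn'. lra. Qed.

Definition out_inv : R -> R := inverse out out' (1 - kappa) slope_pos out_deriv (fun x => proj1 (out'_bound x)).
Definition inn_inv : R -> R := inverse inn inn' (1 - kappa) slope_pos inn_deriv (fun x => proj1 (inn'_bound x)).

Definition psi (y : R) : R := out (inn_inv y).
Definition psi' (y : R) : R := out' (inn_inv y) / inn' (inn_inv y).
(** The inverse of the derivative of psi, as a function of b. *)
Definition weight (b : R) : R := inn' (out_inv b) / out' (out_inv b).

Lemma psi_deriv y : is_derive psi y (psi' y).
Proof.
  apply (is_derive_val _ _ (/ inn' (inn_inv y) * out' (inn_inv y))); [|unfold psi'; field; pose proof (inn'_bound (inn_inv y)); lra].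
  apply (is_derive_comp out inn_inv); [apply out_deriv|apply inverse_deriv; apply inn'_cont].
Qed.

Lemma psi'_pos y : 0 < psi' y.
Proof. pose proof (inn'_bound (inn_inv y)). pose proof (out'_bound (inn_inv y)). apply Rdiv_lt_0_compat; lra. Qed.

Lemma psi'_lower y : (1 - kappa) / (1 + kappa) <= psi' y.
Proof.
  pose proof (inn'_bound (inn_inv y)). pose proof (out'_bound (inn_inv y)). unfold psi', Rdiv.
  apply Rmult_le_compat; try lra; [left; apply Rinv_0_lt_compat; lra|apply Rinv_le_contravar; lra].
Qed.

Lemma weight_pos b : 0 < weight b.
Proof. pose proof (inn'_bound (out_inv b)). pose proof (out'_bound (out_inv b)). apply Rdiv_lt_0_compat; lra. Qed.

Lemma psi_inn x : psi (inn x) = out x.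
Proof. unfold psi, inn_inv. now rewrite inverse_g. Qed.

Lemma weight_psi y : weight (psi y) * psi' y = 1.
Proof.
  unfold weight, psi, psi', out_inv. rewrite inverse_g.
  pose proof (inn'_bound (inn_inv y)). pose proof (out'_bound (inn_inv y)). field. lra.
Qed.

Lemma psi_increasing y1 y2 : y1 < y2 -> psi y1 < psi y2.
Proof.
  intros H. assert (Hc : 0 < (1 - kappa) / (1 + kappa)) by (apply Rdiv_lt_0_compat; lra).
  pose proof (increasing_slope psi psi' ((1 - kappa) / (1 + kappa)) psi_deriv psi'_lower y1 y2 ltac:(lra)). nra.
Qed.

Lemma psi_smooth M : smooth1 M sigma' -> smooth1 (S M) psi.
Proof.
  intros H.
  assert (Hs : smooth1 (S M) sigma) by (split; [intros x; apply derivable_continuous_pt; exists (sigma' x); apply is_derive_Reals, Dsigma|now exists sigma']).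
  apply (smooth1_comp (S M) out inn_inv).
  - now apply (smooth1_plus (S M) (fun x => x) sigma); [apply smooth1_id|].
  - apply inverse_smooth; [apply inn'_cont|].
    apply (smooth1_ext _ (fun x => 1 + (-1) * sigma' x)); [intros x; unfold inn'; ring|].
    apply (smooth1_plus M (fun _ => 1)); [apply smooth1_const|now apply smooth1_scal].
Qed.

Lemma weight_smooth M : smooth1 M sigma' -> smooth1 M weight.
Proof.
  intros H.
  assert (Ho : smooth1 M out') by (apply (smooth1_plus M (fun _ => 1)); [apply smooth1_const|easy]).
  assert (Hi : smooth1 M inn').
  { apply (smooth1_ext _ (fun x => 1 + (-1) * sigma' x)); [intros x; unfold inn'; ring|].
    apply (smooth1_plus M (fun _ => 1)); [apply smooth1_const|now apply smooth1_scal]. }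
  assert (Hv : smooth1 M out_inv) by (apply smooth1_pred, inverse_smooth; [apply out'_cont|easy]).
  apply (smooth1_ext _ (fun b => inn' (out_inv b) * Rpower (out' (out_inv b)) (-1))).
  - intros b. unfold weight, Rdiv. f_equal. pose proof (out'_bound (out_inv b)).
    rewrite (Rpower_Ropp _ 1), Rpower_1; [easy|lra].
  - apply smooth1_mult; [now apply smooth1_comp|]. apply smooth1_power.
    + intros b. pose proof (out'_bound (out_inv b)). lra.
    + now apply (smooth1_comp M out' out_inv).
Qed.

(** The two null variables x - t and t + x, the first one reparametrised by psi so
    that the surface is where they agree. *)
Definition depth (t x : R) : R := psi (x - t) - (t + x).
Definition foot (t x : R) : R := psi (x - t).

Lemma depth_zero x : depth (sigma x) x = 0.
Proof. unfold depth. change (x - sigma x) with (inn x). rewrite psi_inn. unfold out. ring. Qed.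

Lemma depth_pos t x : t < sigma x -> 0 < depth t x.
Proof.
  intros H. pose proof (depth_zero x) as Z. unfold depth in *.
  pose proof (psi_increasing (x - sigma x) (x - t) ltac:(lra)). lra.
Qed.

Lemma psi_cont y : continuity_pt psi y.
Proof. apply derivable_continuous_pt. exists (psi' y). apply is_derive_Reals, psi_deriv. Qed.

Lemma cont2_diff t x : continuity_2d_pt (fun t x => x - t) t x.
Proof. apply continuity_2d_pt_minus; [apply continuity_2d_pt_id2|apply continuity_2d_pt_id1]. Qed.

Lemma foot_cont t x : continuity_2d_pt foot t x.
Proof. apply (continuity_1d_2d_pt_comp psi (fun t x => x - t)); [apply psi_cont|apply cont2_diff]. Qed.

Lemma depth_cont t x : continuity_2d_pt depth t x.
Proof.
  apply continuity_2d_pt_minus; [apply foot_cont|].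
  apply continuity_2d_pt_plus; [apply continuity_2d_pt_id1|apply continuity_2d_pt_id2].
Qed.

Lemma foot_jet U (HU : open2 U) M : smooth1 M sigma' -> jet U (S M) 1 0 (cs foot).
Proof.
  intros H. pose proof (cont_class_graded U HU) as G.
  assert (Hy : jet U (S M) 1 0 (cs (fun t x => x - t))).
  { apply (Ck_minus true U _ G (S M) 1 0 (cs (fun _ x => x)) (cs (fun t _ => t))); [now apply jet_snd|now apply jet_fst]. }
  apply (jet_comp U everywhere HU everywhere_open (S M) (fun _ y => psi y) (fun t x => x - t) (fun t x => x - t)); try easy.
  apply (smooth1_Ck true everywhere (S M) 1 0 psi everywhere_open). now apply psi_smooth.
Qed.

Lemma depth_jet U (HU : open2 U) M : smooth1 M sigma' -> jet U (S M) 1 0 (cs depth).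
Proof.
  intros H. pose proof (cont_class_graded U HU) as G.
  apply (Ck_minus true U _ G (S M) 1 0 (cs foot) (cs (fun t x => t + x))); [now apply foot_jet|].
  apply (Ck_plus true U _ G (S M) 1 0 (cs (fun t _ => t)) (cs (fun _ x => x))); [now apply jet_fst|now apply jet_snd].
Qed.

(** * From the layer to the wave equation *)

Section Transfer.
Variables (p gam : R) (N : nat) (rho : R -> R) (v vd : R -> R -> R).
Hypothesis Hp : 0 < p.
Hypothesis Hgam : 0 < gam.
Hypothesis rho_pos : forall b, 0 < rho b.
Hypothesis rho_lip : forall x y, Rabs (rho x - rho y) <= Rabs (x - y).

(** The power is chosen so that W^(- p) = weight / 4 (amplitude_power), which turns the
    coefficient of the equation in null coordinates into that of the wave
    equation. *)
Definition amplitude (b : R) : R := Rpower (4 / weight b) (1 / p).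
Hypothesis Hsol : solves_in_layer (2 / p) (p + 1) gam N amplitude rho v vd.

Definition near_surface (t x : R) : Prop := layer rho (depth t x) (foot t x).
Definition wave (t x : R) : R := v (depth t x) (foot t x).

Lemma amplitude_smooth M : smooth1 M sigma' -> smooth1 M amplitude.
Proof.
  intros H. apply smooth1_power.
  - intros b. pose proof (weight_pos b). apply Rdiv_lt_0_compat; lra.
  - apply (smooth1_ext _ (fun b => 4 * Rpower (weight b) (-1))).
    + intros b. unfold Rdiv. now rewrite (Rpower_Ropp _ 1), Rpower_1 by apply weight_pos.
    + apply smooth1_scal. apply smooth1_power; [apply weight_pos|now apply weight_smooth].
Qed.

Lemma near_surface_open : open2 near_surface.
Proof.
  intros t x H. destruct (layer_open rho rho_lip _ _ H) as [e He].
  destruct (depth_cont t x e) as [e1 H1]. destruct (foot_cont t x e) as [e2 H2].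
  assert (Hm : 0 < Rmin e1 e2) by (apply Rmin_pos; apply cond_pos).
  exists (mkposreal _ Hm). intros t' x' Ht Hx. simpl in *.
  pose proof (Rmin_l e1 e2). pose proof (Rmin_r e1 e2).
  apply He; [apply H1|apply H2]; lra.
Qed.

Lemma wave_pos t x : near_surface t x -> 0 < wave t x.
Proof. intros H. now apply (proj1 Hsol). Qed.

Lemma wave_jet M : smooth1 M sigma' -> smooth1 (S (N + M)) amplitude ->
  jet near_surface M 1 0 (cs wave).
Proof.
  intros Hs HA. destruct Hsol as [Vp [Vr [Vd [Vdd _]]]].
  destruct (Vr M HA) as [Cv Cvd].
  apply (jet_comp near_surface (layer rho) near_surface_open (layer_open rho rho_lip) M v depth foot).
  - easy.
  - apply (full_regularity (layer rho) (layer_open rho rho_lip) v vd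
      (fun b => 2 / p * (2 / p + 1) * Rpower (amplitude b) (1 - (p + 1))) (p + 1) M); try easy.
    + intros d b Hd. eapply is_derive_val; [now apply Vdd|ring].
    + apply smooth1_scal. apply smooth1_power; [intros b; apply Rpower_pos|].
      apply (smooth1_le M (S (N + M))); [lia|easy].
  - apply Ck_pred. apply depth_jet; [apply near_surface_open|easy].
  - apply Ck_pred. apply foot_jet; [apply near_surface_open|easy].
Qed.

Lemma amplitude_power b : Rpower (amplitude b) (1 - (p + 1)) = weight b / 4.
Proof.
  pose proof (weight_pos b). unfold amplitude. rewrite Rpower_mult.
  replace (1 / p * (1 - (p + 1))) with (- (1)) by (field; lra).
  rewrite Rpower_Ropp, Rpower_1 by (apply Rdiv_lt_0_compat; lra). field. lra.
Qed.

(** In the null variables al = t + x and y = x - t, cross is a mixed difference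
    over a square.  The mean value theorem in al produces vd, and a second one in
    y the derivative of vd along (1, 1), that is the equation. *)
Lemma cross_wave t x h : 0 < h ->
  (forall t' x', Rabs (t' - t) <= h -> Rabs (x' - x) <= h -> near_surface t' x') ->
  exists t' x', Rabs (t' - t) <= h /\ Rabs (x' - x) <= h /\
    cross wave h t x = h ^ 2 * nonlinearity p (wave t' x').
Proof.
  intros Hh HD. destruct Hsol as [Vp [_ [Vd [Vdd _]]]].
  set (al := t + x). set (y := x - t).
  assert (Hlay : forall al' y', al - h <= al' <= al + h -> y - h <= y' <= y + h -> layer rho (psi y' - al') (psi y')).
  { intros al' y' H1 H2. specialize (HD ((al' - y') / 2) ((al' + y') / 2)).
    assert (H3 : Rabs ((al' - y') / 2 - t) <= h) by (apply Rabs_le; unfold al, y in *; lra).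
    assert (H4 : Rabs ((al' + y') / 2 - x) <= h) by (apply Rabs_le; unfold al, y in *; lra).
    specialize (HD H3 H4). unfold near_surface, depth, foot in HD.
    replace ((al' + y') / 2 - (al' - y') / 2) with y' in HD by field.
    replace ((al' - y') / 2 + (al' + y') / 2) with al' in HD by field. exact HD. }
  assert (Da : forall al' y', al - h <= al' <= al + h -> y - h <= y' <= y + h ->
    is_derive (fun z => v (psi y' - z) (psi y')) al' (- vd (psi y' - al') (psi y'))).
  { intros al' y' H1 H2. apply (is_derive_val _ _ ((0 - 1) * vd (psi y' - al') (psi y'))); [|ring].
    apply (is_derive_comp (fun d => v d (psi y')) (fun z => psi y' - z)); [now apply Vd, Hlay|].
    apply (is_derive_minus_R (fun _ => psi y') (fun z => z)); [apply is_derive_const_R|apply @is_derive_id]. }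
  assert (Dy : forall al' y', al - h <= al' <= al + h -> y - h <= y' <= y + h ->
    is_derive (fun z => vd (psi z - al') (psi z)) y'
      (2 / p * (2 / p + 1) / 4 * Rpower (v (psi y' - al') (psi y')) (p + 1))).
  { intros al' y' H1 H2.
    apply (is_derive_ext_R (fun z => vd (psi y' - al' + (psi z - psi y')) (psi y' + (psi z - psi y')))).
    { intros z. f_equal; ring. }
    apply (is_derive_val _ _ (psi' y' * (2 / p * (2 / p + 1) * (Rpower (amplitude (psi y')) (1 - (p + 1))
      * Rpower (v (psi y' - al') (psi y')) (p + 1))))).
    - apply (is_derive_comp (fun s => vd (psi y' - al' + s) (psi y' + s)) (fun z => psi z - psi y')).
      + rewrite Rminus_eq_0. now apply Vdd, Hlay.
      + apply (is_derive_val _ _ (psi' y' - 0)); [|ring].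
        apply is_derive_minus_R; [apply psi_deriv|apply (is_derive_const_R (psi y'))].
    - rewrite amplitude_power. pose proof (weight_psi y') as E.
      transitivity ((weight (psi y') * psi' y') * (2 / p * (2 / p + 1) / 4 * Rpower (v (psi y' - al') (psi y')) (p + 1)));
        [field; lra|rewrite E; ring]. }
  destruct (MVT_gen (fun z => v (psi (y - h) - z) (psi (y - h)) - v (psi (y + h) - z) (psi (y + h))) (al - h) (al + h)
    (fun z => - vd (psi (y - h) - z) (psi (y - h)) - - vd (psi (y + h) - z) (psi (y + h)))) as [al' [Hal E1]].
  - intros z Hz. rewrite Rmin_left, Rmax_right in Hz by lra. apply is_derive_minus_R; apply Da; lra.
  - intros z Hz. rewrite Rmin_left, Rmax_right in Hz by lra. apply derivable_continuous_pt.
    eexists. apply is_derive_Reals. apply is_derive_minus_R; apply Da; lra.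
  - rewrite Rmin_left, Rmax_right in Hal by lra.
    destruct (MVT_gen (fun z => vd (psi z - al') (psi z)) (y - h) (y + h)
      (fun z => 2 / p * (2 / p + 1) / 4 * Rpower (v (psi z - al') (psi z)) (p + 1))) as [y' [Hy E2]].
    + intros z Hz. rewrite Rmin_left, Rmax_right in Hz by lra. apply Dy; lra.
    + intros z Hz. rewrite Rmin_left, Rmax_right in Hz by lra. apply derivable_continuous_pt.
      eexists. apply is_derive_Reals. apply Dy; lra.
    + rewrite Rmin_left, Rmax_right in Hy by lra.
      assert (HL : layer rho (psi y' - al') (psi y')) by (apply Hlay; lra).
      exists ((al' - y') / 2), ((al' + y') / 2).
      split; [apply Rabs_le; unfold al, y in *; lra|]. split; [apply Rabs_le; unfold al, y in *; lra|].
      assert (EW : wave ((al' - y') / 2) ((al' + y') / 2) = v (psi y' - al') (psi y')).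
      { unfold wave, depth, foot. f_equal; [f_equal|]; try f_equal; field. }
      rewrite EW. pose proof (Vp _ _ HL) as Hv. unfold nonlinearity. rewrite (Rabs_pos_eq (v _ _)) by lra.
      assert (EC : cross wave h t x = (v (psi (y - h) - (al + h)) (psi (y - h)) - v (psi (y + h) - (al + h)) (psi (y + h)))
        - (v (psi (y - h) - (al - h)) (psi (y - h)) - v (psi (y + h) - (al - h)) (psi (y + h)))).
      { unfold cross, wave, depth, foot, al, y.
        replace (x - (t + h)) with (x - t - h) by ring. replace (x - (t - h)) with (x - t + h) by ring.
        replace (x + h - t) with (x - t + h) by ring. replace (x - h - t) with (x - t - h) by ring.
        replace (t + h + x) with (t + x + h) by ring. replace (t - h + x) with (t + x - h) by ring.
        replace (t + (x + h)) with (t + x + h) by ring. replace (t + (x - h)) with (t + x - h) by ring. ring. }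
      rewrite EC, E1.
      replace (- vd (psi (y - h) - al') (psi (y - h)) - - vd (psi (y + h) - al') (psi (y + h)))
        with (vd (psi (y + h) - al') (psi (y + h)) - vd (psi (y - h) - al') (psi (y - h))) by ring.
      rewrite E2. rewrite Rpower_plus, Rpower_1 by easy. field. lra.
Qed.

Lemma sigma_lipschitz x y : Rabs (sigma x - sigma y) <= kappa * Rabs (x - y).
Proof.
  apply (MVT_bound sigma sigma'); [intros z _; apply Dsigma|intros z _; apply Bsigma'].
Qed.

(** The layer contains a neighbourhood of the surface from below, of a
    width that can be taken 1-Lipschitz in x; a small multiple of this width leaves
    the slope below 1. *)
Lemma initial_surface : exists sigma0 : R -> R, space_like sigma0 /\
  (forall x, sigma0 x < sigma x) /\ (forall x, continuity_pt sigma0 x) /\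
  (forall t x, sigma0 x <= t < sigma x -> near_surface t x).
Proof.
  destruct (lipschitz_minorant (fun x e => forall t, sigma x - e <= t < sigma x -> near_surface t x))
    as [th [T1 [T2 [T3 T4]]]].
  - intros x e e' He H t Ht. apply H. lra.
  - intros x0.
    assert (Hb : below rho (depth (sigma x0) x0) (foot (sigma x0) x0)).
    { rewrite depth_zero. apply rho_pos. }
    destruct (below_open rho rho_lip _ _ Hb) as [e He].
    destruct (depth_cont (sigma x0) x0 e) as [e1 H1]. destruct (foot_cont (sigma x0) x0 e) as [e2 H2].
    set (m := Rmin e1 e2). assert (Hm : 0 < m) by (apply Rmin_pos; apply cond_pos).
    assert (M1 : m <= e1) by apply Rmin_l. assert (M2 : m <= e2) by apply Rmin_r.
    exists (m / 3). split; [lra|]. intros x Hx t Ht.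
    assert (Hs : Rabs (sigma x - sigma x0) < m / 3).
    { eapply Rle_lt_trans; [apply sigma_lipschitz|]. pose proof (Rabs_pos (x - x0)). nra. }
    assert (Htt : Rabs (t - sigma x0) < m) by (apply Rabs_def2 in Hs; apply Rabs_def1; lra).
    split; [now apply depth_pos|]. apply He; [apply H1|apply H2]; lra.
  (* the slope of sigma - c th is at most kappa + c = (1 + kappa) / 2 *)
  - set (c := (1 - kappa) / 2). assert (Hc : 0 < c < 1) by (unfold c; lra).
    assert (Hlip : forall x y, Rabs ((sigma x - c * th x) - (sigma y - c * th y)) <= (kappa + c) * Rabs (x - y)).
    { intros x y. replace ((sigma x - c * th x) - (sigma y - c * th y)) with ((sigma x - sigma y) + - (c * (th x - th y))) by ring.
      eapply Rle_trans; [apply Rabs_triang|]. rewrite Rabs_Ropp, Rabs_mult, (Rabs_pos_eq c) by lra.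
      pose proof (sigma_lipschitz x y). specialize (T3 x y).
      assert (c * Rabs (th x - th y) <= c * Rabs (x - y)) by (apply Rmult_le_compat_l; lra). lra. }
    exists (fun x => sigma x - c * th x). split; [|split; [|split]].
    + intros x. unfold limsup_at.
      set (F := fun d : R => Lub_Rbar (fun q => exists y, y <> x /\ Rabs (y - x) < d /\
        q = Rabs (sigma x - c * th x - (sigma y - c * th y)) / Rabs (x - y))).
      apply Rbar_le_lt_trans with (F 1).
      * unfold Rbar_glb. destruct (Rbar_ex_glb _) as [l Hl]. simpl. apply (proj1 Hl). now exists (mkposreal 1 Rlt_0_1).
      * apply Rbar_le_lt_trans with (Finite (kappa + c)); [|simpl; unfold c; lra].
        apply (proj2 (Lub_Rbar_correct _)). intros r [y [Hy [_ ->]]]. simpl.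
        assert (0 < Rabs (x - y)) by (apply Rabs_pos_lt; lra).
        apply Rle_div_l; [easy|]. apply Hlip.
    + intros x. specialize (T1 x). nra.
    + intros x. apply continuity_pt_filterlim. intros P [e He].
      exists e. intros y Hy. apply He.
      unfold ball in *; simpl in *; unfold AbsRing_ball, abs, minus, plus, opp in *; simpl in *.
      eapply Rle_lt_trans; [apply (Hlip y x)|]. pose proof (Rabs_pos (y - x)).
      assert (Rabs (y - x) < e) by exact Hy. unfold c. nra.
    + intros t x Ht. apply (T4 x). specialize (T1 x). nra.
Qed.

Lemma at_left_intro (P : R -> Prop) x e : 0 < e -> (forall t, x - e < t < x -> P t) -> at_left x P.
Proof.
  intros He H. exists (mkposreal e He). intros t Ht Htx. apply H.
  unfold ball in Ht; simpl in Ht; unfold AbsRing_ball, abs, minus, plus, opp in Ht; simpl in Ht.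
  apply Rabs_def2 in Ht. lra.
Qed.

Lemma filterlim_at_left_intro (f : R -> R) x l :
  (forall eps : posreal, exists e, 0 < e /\ forall t, x - e < t < x -> Rabs (f t - l) < eps) ->
  filterlim f (at_left x) (locally l).
Proof.
  intros H P [eps HP]. destruct (H eps) as [e [He H']].
  apply (at_left_intro _ x e He). intros t Ht. apply HP. now apply H'.
Qed.

Lemma depth_slope x : is_derive (fun t => depth t x) (sigma x) (- (psi' (inn x) + 1)).
Proof.
  apply (is_derive_val _ _ ((0 - 1) * psi' (inn x) - (1 + 0))); [|ring].
  apply (is_derive_minus_R (fun t => psi (x - t)) (fun t => t + x)).
  - apply (is_derive_comp psi (fun t => x - t)); [apply psi_deriv|].
    apply (is_derive_minus_R (fun _ => x) (fun t => t)); [apply is_derive_const_R|apply @is_derive_id].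
  - apply (is_derive_plus_R (fun t => t) (fun _ => x)); [apply @is_derive_id|apply is_derive_const_R].
Qed.

Lemma depth_ratio x : filterlim (fun t => (sigma x - t) / depth t x) (at_left (sigma x))
  (locally (/ (psi' (inn x) + 1))).
Proof.
  set (m := psi' (inn x) + 1). assert (Hm : 0 < m) by (pose proof (psi'_pos (inn x)); unfold m; lra).
  apply (filterlim_ext_loc (fun t => / (depth t x / (sigma x - t)))).
  { apply (at_left_intro _ (sigma x) 1 Rlt_0_1). intros t Ht. pose proof (depth_pos t x ltac:(lra)). field. lra. }
  apply (filterlim_comp _ _ _ _ Rinv _ (locally m)).
  - apply filterlim_at_left_intro. intros eps. pose proof (depth_slope x) as HD. apply is_derive_Reals in HD.
    destruct (HD eps (cond_pos eps)) as [e He]. exists e. split; [apply cond_pos|]. intros t Ht.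
    specialize (He (t - sigma x) ltac:(lra) ltac:(rewrite Rabs_left1; lra)).
    replace (sigma x + (t - sigma x)) with t in He by ring. rewrite depth_zero in He.
    replace (depth t x / (sigma x - t) - m) with (- ((depth t x - 0) / (t - sigma x) - - m)) by (field; lra).
    now rewrite Rabs_Ropp.
  - apply continuity_pt_filterlim. apply (continuity_pt_inv (fun y => y)); [apply continuity_pt_id|lra].
Qed.

(** The error in solves_in_layer is smaller than the leading term by d^gam, and the
    foot of a point approaching (sigma x, x) tends to out x. *)
Lemma wave_leading x : filterlim (fun t => Rpower (depth t x) (2 / p) * wave t x) (at_left (sigma x))
  (locally (amplitude (out x))).
Proof.
  destruct Hsol as [_ [_ [_ [_ Hasy]]]]. set (L := Rabs (out x) + 2). destruct (Hasy L) as [K HK].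
  destruct initial_surface as [s0 [_ [S1 [_ S2]]]].
  apply filterlim_at_left_intro. intros eps.
  assert (He : 0 < eps / 2) by (pose proof (cond_pos eps); lra).
  destruct (Rpower_small gam (Rabs K) (eps / 2) Hgam (Rabs_pos K) He) as [del [Hdel Hsm]].
  assert (CA : continuity_pt amplitude (out x)).
  { apply (smooth1_cont 0). apply amplitude_smooth. now split. }
  apply continuity_pt_filterlim in CA.
  destruct (CA _ (locally_ball (amplitude (out x)) (mkposreal _ He))) as [e1 E1].
  set (r := Rmin (Rmin del 1) (Rmin e1 1)).
  assert (Hr : 0 < r) by (unfold r; repeat apply Rmin_pos; try apply cond_pos; lra).
  assert (Hr' : r <= del /\ r <= 1 /\ r <= e1).
  { unfold r. pose proof (Rmin_l (Rmin del 1) (Rmin e1 1)). pose proof (Rmin_r (Rmin del 1) (Rmin e1 1)).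
    pose proof (Rmin_l del 1). pose proof (Rmin_r del 1). pose proof (Rmin_l e1 1). lra. }
  destruct (depth_cont (sigma x) x (mkposreal _ Hr)) as [e2 E2]. destruct (foot_cont (sigma x) x (mkposreal _ Hr)) as [e3 E3].
  simpl in E2, E3. rewrite depth_zero in E2.
  assert (EF : foot (sigma x) x = out x) by (apply psi_inn). rewrite EF in E3.
  set (e := Rmin (Rmin e2 e3) (sigma x - s0 x)).
  assert (He0 : 0 < e) by (unfold e; specialize (S1 x); repeat apply Rmin_pos; try apply cond_pos; lra).
  exists e. split; [easy|]. intros t Ht.
  assert (He' : e <= e2 /\ e <= e3 /\ e <= sigma x - s0 x).
  { unfold e. pose proof (Rmin_l (Rmin e2 e3) (sigma x - s0 x)). pose proof (Rmin_r (Rmin e2 e3) (sigma x - s0 x)).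
    pose proof (Rmin_l e2 e3). pose proof (Rmin_r e2 e3). lra. }
  assert (Hn : near_surface t x) by (apply S2; lra).
  assert (Hx0 : Rabs (x - x) < e2 /\ Rabs (x - x) < e3) by (rewrite Rminus_eq_0, Rabs_R0; split; apply cond_pos).
  assert (Ht2 : Rabs (t - sigma x) < e) by (apply Rabs_def1; lra).
  specialize (E2 t x ltac:(lra) (proj1 Hx0)). specialize (E3 t x ltac:(lra) (proj2 Hx0)).
  pose proof (layer_pos rho _ _ Hn) as HD. rewrite Rminus_0_r, Rabs_pos_eq in E2 by lra.
  pose proof (Rle_abs (out x)). pose proof (Rle_abs (- out x)). rewrite Rabs_Ropp in *.
  apply Rabs_def2 in E3 as E3'.
  specialize (HK _ _ Hn ltac:(unfold L; lra) ltac:(unfold L; lra)).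
  assert (HA : Rabs (amplitude (foot t x) - amplitude (out x)) < eps / 2).
  { apply (E1 (foot t x)). eapply Rlt_le_trans; [exact E3|]. lra. }
  assert (HB : Rabs (Rpower (depth t x) (2 / p) * wave t x - amplitude (foot t x)) < eps / 2).
  { replace (Rpower (depth t x) (2 / p) * wave t x - amplitude (foot t x))
      with (Rpower (depth t x) (2 / p) * (v (depth t x) (foot t x) - amplitude (foot t x) * Rpower (depth t x) (- (2 / p)))).
    - rewrite Rabs_mult, (Rabs_pos_eq (Rpower _ _)) by (left; apply Rpower_pos).
      eapply Rle_lt_trans; [apply Rmult_le_compat_l; [left; apply Rpower_pos|exact HK]|].
      replace (Rpower (depth t x) (2 / p) * (K * Rpower (depth t x) (gam - 2 / p))) with (K * Rpower (depth t x) gam).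
      + eapply Rle_lt_trans; [|apply (Hsm (depth t x)); lra]. apply Rmult_le_compat_r; [left; apply Rpower_pos|apply Rle_abs].
      + replace gam with (2 / p + (gam - 2 / p)) at 1 by ring. rewrite Rpower_plus. ring.
    - assert (E : Rpower (depth t x) (2 / p) * Rpower (depth t x) (- (2 / p)) = 1).
      { rewrite <- Rpower_plus, Rplus_opp_r. apply Rpower_zero. }
      unfold wave.
      transitivity (Rpower (depth t x) (2 / p) * v (depth t x) (foot t x) - amplitude (foot t x) * (Rpower (depth t x) (2 / p) * Rpower (depth t x) (- (2 / p)))); [ring|rewrite E; ring]. }
  replace (Rpower (depth t x) (2 / p) * wave t x - amplitude (out x))
    with ((Rpower (depth t x) (2 / p) * wave t x - amplitude (foot t x)) + (amplitude (foot t x) - amplitude (out x))) by ring.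
  eapply Rle_lt_trans; [apply Rabs_triang|]. lra.
Qed.

(** The depth is (psi' + 1) (sigma x - t) to first order, with
    psi' + 1 = 2 / (1 - sigma'); together with the amplitude this gives the factor
    ((1 - sigma')^2 / 4 * 4 (1 + sigma') / (1 - sigma'))^(1 / p). *)
Lemma wave_blows_up : blows_up_on p sigma wave.
Proof.
  intros x. rewrite (is_derive_unique _ _ _ (Dsigma x)).
  set (m := psi' (inn x) + 1). assert (Hm : 0 < m) by (pose proof (psi'_pos (inn x)); unfold m; lra).
  replace (Rpower (1 - Rabs (sigma' x) ^ 2) (1 / p)) with (Rpower (/ m) (2 / p) * amplitude (out x)).
  - apply (filterlim_ext_loc (fun t => Rpower ((sigma x - t) / depth t x) (2 / p) * (Rpower (depth t x) (2 / p) * wave t x))).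
    + apply (at_left_intro _ (sigma x) 1 Rlt_0_1). intros t Ht. pose proof (depth_pos t x ltac:(lra)) as HD.
      rewrite <- Rmult_assoc, Rpower_mult_distr; [|apply Rdiv_lt_0_compat; lra|easy].
      f_equal. f_equal. field. lra.
    + apply (filterlim_comp_2 (G := locally (Rpower (/ m) (2 / p))) (H := locally (amplitude (out x)))
        (fun t => Rpower ((sigma x - t) / depth t x) (2 / p)) (fun t => Rpower (depth t x) (2 / p) * wave t x) Rmult).
      * apply (filterlim_comp _ _ _ (fun t => (sigma x - t) / depth t x) (fun z => Rpower z (2 / p)) _ (locally (/ m))).
        -- apply depth_ratio.
        -- apply (proj1 (continuity_pt_filterlim (fun z => Rpower z (2 / p)) (/ m))). apply derivable_continuous_pt. eexists. apply derivable_pt_lim_power.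
           now apply Rinv_0_lt_compat.
      * apply wave_leading.
      * apply (filterlim_mult (K := R_AbsRing)).
  - unfold amplitude. replace (2 / p) with (2 * (1 / p)) by (field; lra). rewrite <- Rpower_mult.
    pose proof (out'_bound x). pose proof (inn'_bound x).
    assert (EW : weight (out x) = inn' x / out' x) by (unfold weight, out_inv; now rewrite inverse_g).
    assert (Em : m = 2 / inn' x).
    { unfold m, psi', inn_inv. rewrite inverse_g. unfold out', inn' in *. field. lra. }
    rewrite EW, Em, Rpower_mult_distr.
    + assert (E2 : forall z, 0 < z -> Rpower z 2 = z ^ 2).
      { intros z Hz. replace 2 with (INR 2) at 1 by (simpl; ring). now apply Rpower_pow. }
      f_equal. rewrite E2 by (apply Rinv_0_lt_compat, Rdiv_lt_0_compat; lra).
      rewrite pow2_abs. unfold out', inn' in *. field. lra.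
    + apply Rpower_pos.
    + apply Rdiv_lt_0_compat; [lra|]. apply Rdiv_lt_0_compat; lra.
Qed.

End Transfer.

End NullCoordinates.

(** * Classical solutions from second differences *)

(** Subtracting h^2 l reduces the claim to a function with small second derivative,
    to which the mean value theorem is applied twice. *)
Lemma second_difference (g g1 g2 : R -> R) x h l eps : 0 < h ->
  (forall z, Rabs (z - x) <= h -> is_derive g z (g1 z)) ->
  (forall z, Rabs (z - x) <= h -> is_derive g1 z (g2 z)) ->
  (forall z, Rabs (z - x) <= h -> Rabs (g2 z - l) <= eps) ->
  Rabs (g (x + h) + g (x - h) - 2 * g x - h ^ 2 * l) <= 2 * eps * h ^ 2.
Proof.
  intros Hh H1 H2 H3.
  assert (He : 0 <= eps).
  { specialize (H3 x). rewrite Rminus_eq_0, Rabs_R0 in H3. pose proof (Rabs_pos (g2 x - l)). lra. }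
  set (k := fun s => g (x + s) + g (x - s) - 2 * g x - s ^ 2 * l).
  set (k' := fun s => g1 (x + s) - g1 (x - s) - 2 * s * l).
  assert (Hk : forall s, 0 <= s <= h -> is_derive k s (k' s)).
  { intros s Hs. apply (is_derive_val _ _ (1 * g1 (x + s) + (0 - 1) * g1 (x - s) - 0 - (2 * s) * l)); [|unfold k'; ring].
    apply is_derive_minus_R; [apply is_derive_minus_R; [apply is_derive_plus_R|]|].
    - apply (is_derive_comp g (fun s => x + s)); [apply H1; apply Rabs_le; lra|].
      apply (is_derive_val _ _ (0 + 1)); [|ring]. apply is_derive_plus_R; [apply is_derive_const_R|apply @is_derive_id].
    - apply (is_derive_comp g (fun s => x - s)); [apply H1; apply Rabs_le; lra|].
      apply is_derive_minus_R; [apply is_derive_const_R|apply @is_derive_id].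
    - apply (is_derive_const_R (2 * g x)).
    - apply (is_derive_val _ _ (2 * s * l + s ^ 2 * 0)); [|ring].
      apply (is_derive_mult_R (fun s => s ^ 2) (fun _ => l)); [|apply is_derive_const_R].
      apply (is_derive_val _ _ (INR 2 * 1 * s ^ pred 2)); [|simpl; ring].
      apply (is_derive_pow (fun s => s) 2 s 1). apply @is_derive_id. }
  assert (Hk' : forall s, 0 <= s <= h -> Rabs (k' s) <= eps * (2 * h)).
  { intros s Hs.
    replace (k' s) with ((fun z => g1 z - z * l) (x + s) - (fun z => g1 z - z * l) (x - s)) by (unfold k'; ring).
    apply Rle_trans with (eps * Rabs ((x + s) - (x - s))).
    - apply (MVT_bound (fun z => g1 z - z * l) (fun z => g2 z - l)).
      + intros z Hz. rewrite Rmin_left, Rmax_right in Hz by lra.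
        apply (is_derive_val _ _ (g2 z - (1 * l + z * 0))); [|ring].
        apply is_derive_minus_R; [apply H2; apply Rabs_le; lra|].
        apply (is_derive_mult_R (fun z => z) (fun _ => l)); [apply @is_derive_id|apply is_derive_const_R].
      + intros z Hz. rewrite Rmin_left, Rmax_right in Hz by lra. apply H3; apply Rabs_le; lra.
    - apply Rmult_le_compat_l; [easy|]. rewrite Rabs_pos_eq; lra. }
  change (Rabs (k h) <= 2 * eps * h ^ 2).
  replace (k h) with (k h - k 0) by (unfold k; rewrite Rplus_0_r, Rminus_0_r; ring).
  eapply Rle_trans; [apply (MVT_bound k k' 0 h (eps * (2 * h)))|].
  - intros s Hs. rewrite Rmin_left, Rmax_right in Hs by lra. now apply Hk.
  - intros s Hs. rewrite Rmin_left, Rmax_right in Hs by lra. now apply Hk'.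
  - rewrite Rminus_0_r, Rabs_pos_eq by lra. right. ring.
Qed.

Lemma cross_limit (u ut utt ux uxx : R -> R -> R) t x h eps : 0 < h ->
  (forall z, Rabs (z - t) <= h -> is_derive (fun y => u y x) z (ut z x)) ->
  (forall z, Rabs (z - t) <= h -> is_derive (fun y => ut y x) z (utt z x)) ->
  (forall z, Rabs (z - x) <= h -> is_derive (fun y => u t y) z (ux t z)) ->
  (forall z, Rabs (z - x) <= h -> is_derive (fun y => ux t y) z (uxx t z)) ->
  (forall z, Rabs (z - t) <= h -> Rabs (utt z x - utt t x) <= eps) ->
  (forall z, Rabs (z - x) <= h -> Rabs (uxx t z - uxx t x) <= eps) ->
  Rabs (cross u h t x - h ^ 2 * (utt t x - uxx t x)) <= 4 * eps * h ^ 2.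
Proof.
  intros Hh H1 H2 H3 H4 H5 H6.
  pose proof (second_difference (fun y => u y x) (fun y => ut y x) (fun y => utt y x) t h (utt t x) eps Hh H1 H2 H5) as A.
  pose proof (second_difference (fun y => u t y) (fun y => ux t y) (fun y => uxx t y) x h (uxx t x) eps Hh H3 H4 H6) as B.
  cbv beta in A, B. unfold cross.
  replace (u (t + h) x + u (t - h) x - u t (x + h) - u t (x - h) - h ^ 2 * (utt t x - uxx t x))
    with ((u (t + h) x + u (t - h) x - 2 * u t x - h ^ 2 * utt t x)
      + - (u t (x + h) + u t (x - h) - 2 * u t x - h ^ 2 * uxx t x)) by ring.
  eapply Rle_trans; [apply Rabs_triang|]. rewrite Rabs_Ropp. lra.
Qed.

Lemma nonlinearity_cont p w : 0 < w -> continuity_pt (nonlinearity p) w.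
Proof.
  intros Hw. unfold nonlinearity.
  apply (continuity_pt_mult (fun _ => 2 * (p + 2) / p ^ 2) (fun v => Rpower (Rabs v) p * v)); [apply continuity_pt_const; easy|].
  apply (continuity_pt_mult (fun v => Rpower (Rabs v) p) (fun v => v)); [|apply continuity_pt_id].
  apply (continuity_pt_comp Rabs (fun v => Rpower v p)); [apply Rcontinuity_abs|].
  apply derivable_continuous_pt. eexists. apply derivable_pt_lim_power. apply Rabs_pos_lt. lra.
Qed.

Section Solutions.
Variables (p : R) (U : R -> R -> Prop) (u : R -> R -> R).
Hypothesis HU : open2 U.
Hypothesis u_cont : forall t x, U t x -> continuity_2d_pt u t x.
Hypothesis u_pos : forall t x, U t x -> 0 < u t x.
Hypothesis u_cross : forall t x h, 0 < h ->
  (forall t' x', Rabs (t' - t) <= h -> Rabs (x' - x) <= h -> U t' x') ->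
  exists t' x', Rabs (t' - t) <= h /\ Rabs (x' - x) <= h /\ cross u h t x = h ^ 2 * nonlinearity p (u t' x').

Lemma nonlinear_cont t x : U t x -> continuity_2d_pt (fun t x => nonlinearity p (u t x)) t x.
Proof.
  intros H. apply (continuity_1d_2d_pt_comp (nonlinearity p) u); [apply nonlinearity_cont; now apply u_pos|now apply u_cont].
Qed.

Lemma partial_tt (f ft ftt : R -> R -> R) t x : locally t (fun s => is_derive (fun y => f y x) s (ft s x)) ->
  is_derive (fun y => ft y x) t (ftt t x) -> partial_derive 2 0 f t x = ftt t x.
Proof.
  intros H1 H2. unfold partial_derive. simpl.
  apply is_derive_unique. apply (is_derive_ext_loc (fun y => ft y x)); [|easy].
  revert H1. apply filter_imp. intros s Hs. symmetry. now apply is_derive_unique.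
Qed.

Lemma partial_xx (f fx fxx : R -> R -> R) t x : locally x (fun s => is_derive (fun y => f t y) s (fx t s)) ->
  is_derive (fun y => fx t y) x (fxx t x) -> partial_derive 0 2 f t x = fxx t x.
Proof.
  intros H1 H2. unfold partial_derive. simpl.
  apply is_derive_unique. apply (is_derive_ext_loc (fun y => fx t y)); [|easy].
  revert H1. apply filter_imp. intros s Hs. symmetry. now apply is_derive_unique.
Qed.

(** The two descriptions of cross, by the second derivatives and by the
    nonlinearity, have to agree in the limit h -> 0. *)
Lemma classical_of_cross (S : R * R -> Prop) : (forall t x, S (t, x) -> U t x) -> jet U 2 1 0 (cs u) ->
  classical_solution p S u.
Proof.
  intros HS [_ [[ux [Dx [_ [[uxx [Dxx Cxx]] _]]]] Hd]] t x Htx. apply HS in Htx. clear HS.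
  destruct (Hd eq_refl) as [ut [Dt [_ [_ Hd']]]]. destruct (Hd' eq_refl) as [utt [Dtt Ctt]]. clear Hd Hd'.
  apply (jet_cont U O) in Cxx. apply (jet_cont U O) in Ctt.
  rewrite (partial_tt u (ut O) (utt O)); [|generalize (open2_slice_d U t x HU Htx); apply filter_imp; intros s Hs; now apply (Dt O)|now apply (Dtt O)].
  rewrite (partial_xx u (ux O) (uxx O)); [|generalize (open2_slice_b U t x HU Htx); apply filter_imp; intros s Hs; now apply (Dx O)|now apply (Dxx O)].
  set (l := utt O t x - uxx O t x).
  apply cond_eq. intros e He.
  assert (He' : 0 < e / 6) by lra.
  destruct (HU t x Htx) as [r0 R0]. destruct (Cxx O t x Htx (mkposreal _ He')) as [r1 R1].
  destruct (Ctt O t x Htx (mkposreal _ He')) as [r2 R2]. destruct (nonlinear_cont t x Htx (mkposreal _ He')) as [r3 R3].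
  cbn [pos] in R1, R2, R3. clear Cxx Ctt.
  set (m := Rmin (Rmin r0 r1) (Rmin r2 r3)).
  assert (Hm : 0 < m) by (unfold m; repeat apply Rmin_pos; apply cond_pos).
  assert (Hm' : m <= r0 /\ m <= r1 /\ m <= r2 /\ m <= r3).
  { unfold m. pose proof (Rmin_l (Rmin r0 r1) (Rmin r2 r3)). pose proof (Rmin_r (Rmin r0 r1) (Rmin r2 r3)).
    pose proof (Rmin_l r0 r1). pose proof (Rmin_r r0 r1). pose proof (Rmin_l r2 r3). pose proof (Rmin_r r2 r3). lra. }
  set (h := m / 2). assert (Hh : 0 < h) by (unfold h; lra). assert (Hhm : h < m) by (unfold h; lra).
  assert (Z1 : Rabs (x - x) < m) by (rewrite Rminus_eq_0, Rabs_R0; easy).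
  assert (Z2 : Rabs (t - t) < m) by (rewrite Rminus_eq_0, Rabs_R0; easy).
  assert (A : Rabs (cross u h t x - h ^ 2 * l) <= 4 * (e / 6) * h ^ 2).
  { apply (cross_limit u (ut O) (utt O) (ux O) (uxx O)); [easy| | | | | |].
    - intros z Hz. apply (Dt O). apply R0; lra.
    - intros z Hz. apply (Dtt O). apply R0; lra.
    - intros z Hz. apply (Dx O). apply R0; lra.
    - intros z Hz. apply (Dxx O). apply R0; lra.
    - intros z Hz. left. apply R2; lra.
    - intros z Hz. left. apply R1; lra. }
  destruct (u_cross t x h Hh) as [t' [x' [Ht' [Hx' E]]]].
  { intros t' x' Ht' Hx'. apply R0; lra. }
  specialize (R3 t' x' ltac:(lra) ltac:(lra)).
  rewrite E in A.
  replace (Rabs (h ^ 2 * nonlinearity p (u t' x') - h ^ 2 * l)) with (h ^ 2 * Rabs (nonlinearity p (u t' x') - l)) in A.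
  2:{ rewrite <- (Rabs_pos_eq (h ^ 2)) at 1 by nra. rewrite <- Rabs_mult. f_equal. ring. }
  assert (A' : Rabs (nonlinearity p (u t' x') - l) <= 4 * (e / 6)).
  { apply Rmult_le_reg_l with (h ^ 2); [now apply pow_lt|]. eapply Rle_trans; [exact A|]. right. ring. }
  rewrite Rminus_0_r. replace (l - nonlinearity p (u t x)) with (- (nonlinearity p (u t' x') - l) + (nonlinearity p (u t' x') - nonlinearity p (u t x))) by ring.
  eapply Rle_lt_trans; [apply Rabs_triang|]. rewrite Rabs_Ropp. lra.
Qed.

End Solutions.

(** * Integrals over squares *)

Definition cont2 (g : R -> R -> R) : Prop := forall t x, continuity_2d_pt g t x.

Definition supported (M : R) (g : R -> R -> R) : Prop := forall t x, M < Rabs t \/ M < Rabs x -> g t x = 0.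

Definition square_int (M : R) (g : R -> R -> R) : R :=
  RInt (fun x => RInt (fun t => g t x) (- M) M) (- M) M.

Lemma inner_cont g a c x : cont2 g -> continuous (fun x => RInt (fun t => g t x) a c) x.
Proof.
  intros Hg. apply (cont2_slice_b (prim a g) c x).
  apply (prim_cont everywhere a everywhere_open); [easy| |easy]. intros d b _. apply Hg.
Qed.

Lemma inner_ex g a c x : cont2 g -> ex_RInt (fun t => g t x) a c.
Proof. intros Hg. apply ex_RInt_cont_R. intros z _. apply cont2_slice_d, Hg. Qed.

Lemma outer_ex g a c a' c' : cont2 g -> ex_RInt (fun x => RInt (fun t => g t x) a c) a' c'.
Proof. intros Hg. apply ex_RInt_cont_R. intros z _. now apply inner_cont. Qed.

Lemma square_int_minus M g k : cont2 g -> cont2 k ->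
  square_int M (fun t x => g t x - k t x) = square_int M g - square_int M k.
Proof.
  intros Hg Hk. unfold square_int. rewrite <- RInt_minus_R by now apply outer_ex.
  apply RInt_ext_R. intros x _. apply RInt_minus_R; now apply inner_ex.
Qed.

Lemma square_int_bound M g e : 0 <= M -> 0 <= e -> cont2 g ->
  (forall t x, Rabs t <= M -> Rabs x <= M -> Rabs (g t x) <= e) ->
  Rabs (square_int M g) <= (2 * M) ^ 2 * e.
Proof.
  intros HM He Hg H. unfold square_int.
  assert (E : Rabs (M - - M) = 2 * M) by (rewrite Rabs_pos_eq; lra).
  apply Rle_trans with (Rabs (M - - M) * (Rabs (M - - M) * e)); [|rewrite E; right; ring].
  apply RInt_abs_le; [now apply outer_ex|]. intros x Hx. rewrite Rmin_left, Rmax_right in Hx by lra.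
  apply RInt_abs_le; [now apply inner_ex|]. intros t Ht. rewrite Rmin_left, Rmax_right in Ht by lra.
  apply H; apply Rabs_le; lra.
Qed.

Lemma RInt_zero a c : RInt (fun _ : R => 0) a c = 0.
Proof. rewrite RInt_const. apply Rmult_0_r. Qed.

Lemma RInt_supported (f : R -> R) M a c : (forall t, continuous f t) -> (forall t, M < Rabs t -> f t = 0) ->
  0 <= M -> a <= - M -> M <= c -> RInt f a c = RInt f (- M) M.
Proof.
  intros Hc H0 HM Ha Hcc.
  assert (Hex : forall a c, ex_RInt f a c) by (intros; apply ex_RInt_cont_R; auto).
  rewrite <- (RInt_Chasles_R f a (- M) c), <- (RInt_Chasles_R f (- M) M c) by apply Hex.
  assert (Z : forall a c, a <= c -> (forall t, a < t < c -> M < Rabs t) -> RInt f a c = 0).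
  { intros a' c' Hac H. rewrite (RInt_ext_R f (fun _ => 0)).
    - apply RInt_zero.
    - intros t Ht. rewrite Rmin_left, Rmax_right in Ht by lra. apply H0. now apply H. }
  rewrite (Z a (- M)), (Z M c).
  - now rewrite Rplus_0_l, Rplus_0_r.
  - easy.
  - intros t Ht. rewrite Rabs_pos_eq; lra.
  - easy.
  - intros t Ht. rewrite Rabs_left1; lra.
Qed.

Lemma RInt_shift (f : R -> R) h a c : (forall t, continuous f t) ->
  RInt (fun t => f (t + h)) a c = RInt f (a + h) (c + h).
Proof.
  intros Hf. pose proof (RInt_comp_lin f 1 h a c) as E.
  replace (1 * a + h) with (a + h) in E by ring. replace (1 * c + h) with (c + h) in E by ring.
  rewrite <- E by (apply ex_RInt_cont_R; auto).
  apply RInt_ext_R. intros t _. unfold scal; simpl; unfold mult; simpl. rewrite !Rmult_1_l. easy.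
Qed.

Lemma square_int_support M N g : 0 <= M <= N -> cont2 g -> supported M g -> square_int N g = square_int M g.
Proof.
  intros HM Hg Hs. unfold square_int.
  rewrite (RInt_ext_R (fun x => RInt (fun t => g t x) (- N) N) (fun x => RInt (fun t => g t x) (- M) M)).
  - apply RInt_supported; [intros x; now apply inner_cont| |lra|lra|lra].
    intros x Hx. rewrite (RInt_ext_R _ (fun _ => 0)).
    + apply RInt_zero.
    + intros t _. apply Hs. now right.
  - intros x _. apply RInt_supported; [intros t; apply cont2_slice_d, Hg| |lra|lra|lra].
    intros t Ht. apply Hs. now left.
Qed.

Lemma cont2_translate g a c : cont2 g -> cont2 (fun t x => g (t + a) (x + c)).
Proof.
  intros Hg t x. apply (cont2_comp g (fun t _ => t + a) (fun _ x => x + c)); [apply Hg| |].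
  - apply continuity_2d_pt_plus; [apply continuity_2d_pt_id1|apply continuity_2d_pt_const].
  - apply continuity_2d_pt_plus; [apply continuity_2d_pt_id2|apply continuity_2d_pt_const].
Qed.

Lemma square_int_translate M N g a c : 0 <= M -> Rabs a <= N - M -> Rabs c <= N - M -> cont2 g -> supported M g ->
  square_int N (fun t x => g (t + a) (x + c)) = square_int N g.
Proof.
  intros HM Ha Hc Hg Hs. apply Rabs_le_between in Ha. apply Rabs_le_between in Hc.
  unfold square_int.
  set (F := fun x => RInt (fun t => g t x) (- N) N).
  assert (HF : forall x, continuous F x) by (intros x; now apply inner_cont).
  assert (HF0 : forall x, M < Rabs x -> F x = 0).
  { intros x Hx. unfold F. rewrite (RInt_ext_R _ (fun _ => 0)).
    - apply RInt_zero.
    - intros t _. apply Hs. now right. }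
  rewrite (RInt_ext_R _ (fun x => F (x + c))).
  - rewrite RInt_shift by easy. rewrite (RInt_supported F M (- N + c)), (RInt_supported F M (- N)); try easy; lra.
  - intros x _. unfold F. rewrite (RInt_shift (fun t => g t (x + c))) by (intros t; apply cont2_slice_d, Hg).
    assert (H0 : forall t, M < Rabs t -> g t (x + c) = 0) by (intros t Ht; apply Hs; now left).
    rewrite (RInt_supported (fun t => g t (x + c)) M (- N + a)), (RInt_supported (fun t => g t (x + c)) M (- N)); try easy; try lra;
      intros t; apply cont2_slice_d, Hg.
Qed.

Lemma cont2_mult g k : cont2 g -> cont2 k -> cont2 (fun t x => g t x * k t x).
Proof. intros Hg Hk t x. now apply continuity_2d_pt_mult. Qed.

Lemma cont2_minus g k : cont2 g -> cont2 k -> cont2 (fun t x => g t x - k t x).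
Proof. intros Hg Hk t x. now apply continuity_2d_pt_minus. Qed.

Lemma cont2_plus g k : cont2 g -> cont2 k -> cont2 (fun t x => g t x + k t x).
Proof. intros Hg Hk t x. now apply continuity_2d_pt_plus. Qed.

Lemma cont2_scal c g : cont2 g -> cont2 (fun t x => c * g t x).
Proof. intros Hg t x. apply continuity_2d_pt_mult; [apply continuity_2d_pt_const|apply Hg]. Qed.

Lemma cont2_ext g k : (forall t x, g t x = k t x) -> cont2 g -> cont2 k.
Proof. intros E Hg t x. apply (continuity_2d_pt_ext g); [easy|apply Hg]. Qed.

Lemma cont2_cross h g : cont2 g -> cont2 (cross g h).
Proof.
  intros Hg. unfold cross. apply cont2_minus; [apply cont2_minus; [apply cont2_plus|]|].
  - apply (cont2_ext (fun t x => g (t + h) (x + 0))); [intros; now rewrite Rplus_0_r|now apply cont2_translate].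
  - apply (cont2_ext (fun t x => g (t + - h) (x + 0))); [intros; now rewrite Rplus_0_r|now apply cont2_translate].
  - apply (cont2_ext (fun t x => g (t + 0) (x + h))); [intros; now rewrite Rplus_0_r|now apply cont2_translate].
  - apply (cont2_ext (fun t x => g (t + 0) (x + - h))); [intros; now rewrite Rplus_0_r|now apply cont2_translate].
Qed.

(** Translation invariance of the integral: each of the four translates moves from
    one factor to the other, since the opposite shift also occurs with the same
    sign. *)
Lemma cross_symmetric M N w phi h : 0 <= M -> Rabs h <= N - M -> cont2 w -> cont2 phi -> supported M phi ->
  square_int N (fun t x => w t x * cross phi h t x - phi t x * cross w h t x) = 0.
Proof.
  intros HM Hh Hw Hphi Hs.
  assert (Key : forall a c, Rabs a <= N - M -> Rabs c <= N - M ->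
    let k := fun t x => w (t - a) (x - c) * phi t x in
    cont2 k /\ cont2 (fun t x => k (t + a) (x + c)) /\
    square_int N (fun t x => k (t + a) (x + c) - k t x) = 0).
  { intros a c Ha Hc k.
    assert (Hk : cont2 k).
    { apply cont2_mult; [|easy]. apply (cont2_translate w (- a) (- c) Hw). }
    split; [easy|]. split; [now apply cont2_translate|].
    rewrite square_int_minus; [|now apply cont2_translate|easy].
    rewrite (square_int_translate M N k a c); try easy; [ring|].
    intros t x Htx. unfold k. rewrite (Hs t x Htx). ring. }
  assert (Z : Rabs 0 <= N - M) by (rewrite Rabs_R0; pose proof (Rabs_pos h); lra).
  assert (Hh' : Rabs (- h) <= N - M) by now rewrite Rabs_Ropp.
  destruct (Key h 0 Hh Z) as [A1 [B1 C1]]. destruct (Key (- h) 0 Hh' Z) as [A2 [B2 C2]].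
  destruct (Key 0 h Z Hh) as [A3 [B3 C3]]. destruct (Key 0 (- h) Z Hh') as [A4 [B4 C4]].
  cbv zeta in *.
  set (k1 := fun t x => w (t - h) (x - 0) * phi t x) in *.
  set (k2 := fun t x => w (t - - h) (x - 0) * phi t x) in *.
  set (k3 := fun t x => w (t - 0) (x - h) * phi t x) in *.
  set (k4 := fun t x => w (t - 0) (x - - h) * phi t x) in *.
  set (D1 := fun t x => k1 (t + h) (x + 0) - k1 t x) in *.
  set (D2 := fun t x => k2 (t + - h) (x + 0) - k2 t x) in *.
  set (D3 := fun t x => k3 (t + 0) (x + h) - k3 t x) in *.
  set (D4 := fun t x => k4 (t + 0) (x + - h) - k4 t x) in *.
  assert (E1 : cont2 D1) by now apply cont2_minus. assert (E2 : cont2 D2) by now apply cont2_minus.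
  assert (E3 : cont2 D3) by now apply cont2_minus. assert (E4 : cont2 D4) by now apply cont2_minus.
  assert (EE : (fun t x => w t x * cross phi h t x - phi t x * cross w h t x)
    = (fun t x => (fun t x => (fun t x => D1 t x - D3 t x) t x - D4 t x) t x - (fun t x => 0 * D1 t x - D2 t x) t x)).
  { apply functional_extensionality. intros t. apply functional_extensionality. intros x.
    unfold D1, D2, D3, D4, k1, k2, k3, k4, cross.
    replace (t + h - h) with t by ring. replace (x + 0 - 0) with x by ring. replace (t + - h - - h) with t by ring.
    replace (t + 0 - 0) with t by ring. replace (x + h - h) with x by ring. replace (x + - h - - h) with x by ring.
    replace (t - - h) with (t + h) by ring. replace (x - - h) with (x + h) by ring.
    replace (t + 0) with t by ring. replace (x + 0) with x by ring. replace (x - 0) with x by ring. replace (t - 0) with t by ring.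
    unfold Rminus. ring. }
  rewrite EE.
  assert (F0 : cont2 (fun t x => 0 * D1 t x)) by now apply cont2_scal.
  assert (Z0 : square_int N (fun t x => 0 * D1 t x) = 0).
  { unfold square_int. rewrite (RInt_ext_R _ (fun _ => 0)); [apply RInt_zero|].
    intros x _. rewrite (RInt_ext_R _ (fun _ => 0)); [apply RInt_zero|]. intros t _. apply Rmult_0_l. }
  rewrite square_int_minus; [|apply cont2_minus; [now apply cont2_minus|easy]|now apply cont2_minus].
  rewrite (square_int_minus N (fun t x => D1 t x - D3 t x) D4), (square_int_minus N D1 D3), (square_int_minus N (fun t x => 0 * D1 t x) D2);
    try easy; try now apply cont2_minus.
  change (square_int N D1 = 0) in C1. change (square_int N D2 = 0) in C2.
  change (square_int N D3 = 0) in C3. change (square_int N D4 = 0) in C4.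
  rewrite C1, C2, C3, C4, Z0. ring.
Qed.

(** Uniform continuity bounds the change of g along each of n equal steps from the
    origin. *)
Lemma cont2_bounded_square g M : 0 <= M -> cont2 g -> exists K, 0 <= K /\
  forall t x, Rabs t <= M -> Rabs x <= M -> Rabs (g t x) <= K.
Proof.
  intros HM Hg.
  destruct (uniform_continuity_2d g (- M) M (- M) M (fun x y _ _ => Hg x y) (mkposreal 1 Rlt_0_1)) as [de Hde].
  simpl in Hde. pose proof (cond_pos de) as Hd.
  destruct (archimed_cor1 (de / (M + 1)) ltac:(apply Rdiv_lt_0_compat; lra)) as [n [Hn Hn0]].
  assert (Hn1 : 0 < INR n) by now apply lt_0_INR.
  assert (Hstep : / INR n * M < de).
  { apply Rle_lt_trans with (/ INR n * (M + 1)); [apply Rmult_le_compat_l; [left; now apply Rinv_0_lt_compat|lra]|].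
    apply Rmult_lt_compat_r with (r := M + 1) in Hn; [|lra]. replace (de / (M + 1) * (M + 1)) with (pos de) in Hn by (field; lra). lra. }
  exists (Rabs (g 0 0) + INR n). split; [pose proof (Rabs_pos (g 0 0)); lra|].
  intros t x Ht Hx. apply Rabs_le_between in Ht as Ht'. apply Rabs_le_between in Hx as Hx'.
  assert (H : forall i, (i <= n)%nat -> Rabs (g (INR i / INR n * t) (INR i / INR n * x)) <= Rabs (g 0 0) + INR i).
  { induction i as [|i IH]; intros Hi.
    - simpl. unfold Rdiv. rewrite !Rmult_0_l. lra.
    - specialize (IH ltac:(lia)). rewrite (S_INR i) in *.
      assert (Hi1 : INR i + 1 <= INR n) by (rewrite <- S_INR; now apply le_INR).
      pose proof (pos_INR i) as Hi0.
      assert (Ha : forall j, 0 <= j <= INR n -> 0 <= j / INR n <= 1).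
      { intros j Hj. split; [apply Rmult_le_pos; [lra|left; now apply Rinv_0_lt_compat]|].
        apply Rle_div_l; lra. }
      assert (Hb : forall j s, 0 <= j <= INR n -> - M <= s <= M -> - M <= j / INR n * s <= M).
      { intros j s Hj Hs. specialize (Ha j Hj). nra. }
      assert (Hc : forall s, Rabs s <= M -> Rabs ((INR i + 1) / INR n * s - INR i / INR n * s) < de).
      { intros s Hs. replace ((INR i + 1) / INR n * s - INR i / INR n * s) with (/ INR n * s) by (field; lra).
        rewrite Rabs_mult, (Rabs_pos_eq (/ INR n)) by (left; now apply Rinv_0_lt_compat).
        eapply Rle_lt_trans; [|exact Hstep]. apply Rmult_le_compat_l; [left; now apply Rinv_0_lt_compat|easy]. }
      assert (HH : Rabs (g ((INR i + 1) / INR n * t) ((INR i + 1) / INR n * x) - g (INR i / INR n * t) (INR i / INR n * x)) < 1).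
      { apply Hde; try (apply Hb; lra); now apply Hc. }
      replace (g ((INR i + 1) / INR n * t) ((INR i + 1) / INR n * x))
        with ((g ((INR i + 1) / INR n * t) ((INR i + 1) / INR n * x) - g (INR i / INR n * t) (INR i / INR n * x)) + g (INR i / INR n * t) (INR i / INR n * x)) by ring.
      eapply Rle_trans; [apply Rabs_triang|]. lra. }
  specialize (H n (le_n n)). replace (INR n / INR n) with 1 in H by (field; lra). now rewrite !Rmult_1_l in H.
Qed.

(** Lebesgue number argument for the cover of the square by balls around points
    of K, of half the radius on which O holds, and balls missing K. *)
Lemma compact_margin (K : R * R -> Prop) (O : R -> R -> Prop) L : closed K ->
  (forall t x, K (t, x) -> Rabs t <= L /\ Rabs x <= L) -> open2 O -> (forall t x, K (t, x) -> O t x) ->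
  exists r, 0 < r /\ forall t x t' x', K (t, x) -> Rabs (t' - t) < r -> Rabs (x' - x) < r -> O t' x'.
Proof.
  intros HK HL HO HKO.
  assert (Hr : forall t x, exists e : posreal, (K (t, x) ->
      forall t' x', Rabs (t' - t) < 2 * e -> Rabs (x' - x) < 2 * e -> O t' x') /\
    (~ K (t, x) -> forall t' x', Rabs (t' - t) < e -> Rabs (x' - x) < e -> ~ K (t', x'))).
  { intros t x. destruct (classic (K (t, x))) as [H|H].
    - destruct (HO t x (HKO t x H)) as [e He]. exists (pos_div_2 e). split; [|easy].
      intros _ t' x' Ht Hx. simpl in *. apply He; lra.
    - assert (Hl : locally (t, x) (fun z => ~ K z)) by (apply NNPP; intros A; apply H; now apply HK).
      destruct Hl as [e He]. exists e. split; [easy|]. intros _ t' x' Ht Hx. apply He. split; [exact Ht|exact Hx]. }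
  set (de := fun t x => proj1_sig (constructive_indefinite_description _ (Hr t x))).
  assert (Hde : forall t x, (K (t, x) -> forall t' x', Rabs (t' - t) < 2 * de t x -> Rabs (x' - x) < 2 * de t x -> O t' x') /\
    (~ K (t, x) -> forall t' x', Rabs (t' - t) < de t x -> Rabs (x' - x) < de t x -> ~ K (t', x')))
    by (intros t x; exact (proj2_sig (constructive_indefinite_description _ (Hr t x)))).
  destruct (compactness_value_2d (- L) L (- L) L de) as [d Hd].
  exists d. split; [apply cond_pos|]. intros t x t' x' Htx Ht Hx.
  destruct (HL t x Htx) as [L1 L2]. apply Rabs_le_between in L1. apply Rabs_le_between in L2.
  apply NNPP. intros A. apply (Hd t x L1 L2). intros [a [c [_ [_ [H1 [H2 H3]]]]]]. apply A.
  destruct (classic (K (a, c))) as [Hac|Hac].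
  - apply (proj1 (Hde a c) Hac).
    + replace (t' - a) with ((t' - t) + (t - a)) by ring. eapply Rle_lt_trans; [apply Rabs_triang|]. lra.
    + replace (x' - c) with ((x' - x) + (x - c)) by ring. eapply Rle_lt_trans; [apply Rabs_triang|]. lra.
  - exfalso. now apply (proj2 (Hde a c) Hac t x).
Qed.

(** * Distributional solutions from second differences *)

Lemma cont2_abs g : cont2 g -> cont2 (fun t x => Rabs (g t x)).
Proof. intros Hg t x. apply (continuity_1d_2d_pt_comp Rabs g); [apply Rcontinuity_abs|apply Hg]. Qed.

Lemma cont2_max g k : cont2 g -> cont2 k -> cont2 (fun t x => Rmax (g t x) (k t x)).
Proof.
  intros Hg Hk. apply (cont2_ext (fun t x => / 2 * ((g t x + k t x) + Rabs (g t x - k t x)))).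
  - intros t x. unfold Rmax, Rabs. destruct Rle_dec; destruct Rcase_abs; lra.
  - apply cont2_scal, cont2_plus; [now apply cont2_plus|]. now apply cont2_abs, cont2_minus.
Qed.

Lemma cont2_min g k : cont2 g -> cont2 k -> cont2 (fun t x => Rmin (g t x) (k t x)).
Proof.
  intros Hg Hk. apply (cont2_ext (fun t x => / 2 * ((g t x + k t x) - Rabs (g t x - k t x)))).
  - intros t x. unfold Rmin, Rabs. destruct Rle_dec; destruct Rcase_abs; lra.
  - apply cont2_scal, cont2_minus; [now apply cont2_plus|]. now apply cont2_abs, cont2_minus.
Qed.

Lemma Derive_locally_zero (f : R -> R) x e : 0 < e -> (forall y, Rabs (y - x) < e -> f y = 0) -> Derive f x = 0.
Proof.
  intros He H. rewrite (Derive_ext_loc f (fun _ => 0)); [apply Derive_const|].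
  exists (mkposreal e He). intros y Hy. now apply H.
Qed.

Lemma second_derivative_locally_zero (f : R -> R) x e : 0 < e -> (forall y, Rabs (y - x) < e -> f y = 0) ->
  Derive (Derive f) x = 0.
Proof.
  intros He H. apply (Derive_locally_zero _ x e He). intros y Hy.
  apply (Derive_locally_zero f y (e - Rabs (y - x))); [lra|]. intros z Hz. apply H.
  replace (z - x) with ((z - y) + (y - x)) by ring. eapply Rle_lt_trans; [apply Rabs_triang|]. lra.
Qed.

Lemma uniform_cont2 g L e : cont2 g -> 0 < e -> exists de, 0 < de /\ forall t x t' x',
  Rabs t <= L -> Rabs x <= L -> Rabs t' <= L -> Rabs x' <= L ->
  Rabs (t' - t) < de -> Rabs (x' - x) < de -> Rabs (g t' x' - g t x) <= e.
Proof.
  intros Hg He. destruct (uniform_continuity_2d g (- L) L (- L) L (fun x y _ _ => Hg x y) (mkposreal _ He)) as [de Hde].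
  exists de. split; [apply cond_pos|]. intros t x t' x' H1 H2 H3 H4 H5 H6. left.
  apply Rabs_le_between in H1. apply Rabs_le_between in H2. apply Rabs_le_between in H3. apply Rabs_le_between in H4.
  now apply Hde.
Qed.

Section Distributional.
Variables (p : R) (U : R -> R -> Prop) (u : R -> R -> R) (s0 s : R -> R).
Hypothesis u_cont : forall t x, U t x -> continuity_2d_pt u t x.
Hypothesis u_pos : forall t x, U t x -> 0 < u t x.
Hypothesis u_cross : forall t x h, 0 < h ->
  (forall t' x', Rabs (t' - t) <= h -> Rabs (x' - x) <= h -> U t' x') ->
  exists t' x', Rabs (t' - t) <= h /\ Rabs (x' - x) <= h /\ cross u h t x = h ^ 2 * nonlinearity p (u t' x').
Hypothesis s0_cont : forall x, continuity_pt s0 x.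
Hypothesis s_cont : forall x, continuity_pt s x.
Hypothesis s0_lt : forall x, s0 x < s x.
Hypothesis between_U : forall t x, s0 x < t < s x -> U t x.

Let between (t x : R) : Prop := s0 x < t < s x.

Lemma cont2_of_x g : (forall x, continuity_pt g x) -> cont2 (fun _ x => g x).
Proof. intros H t x. now apply cont2_of_b. Qed.

Lemma cont2_fst : cont2 (fun t _ => t).
Proof. intros t x. apply continuity_2d_pt_id1. Qed.

Lemma between_open : open2 between.
Proof.
  intros t x [H1 H2].
  assert (C1 : cont2 (fun t x => t - s0 x)) by (apply cont2_minus; [apply cont2_fst|now apply cont2_of_x]).
  assert (C2 : cont2 (fun t x => s x - t)) by (apply cont2_minus; [now apply cont2_of_x|apply cont2_fst]).
  assert (P1 : 0 < t - s0 x) by lra. assert (P2 : 0 < s x - t) by lra.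
  destruct (C1 t x (mkposreal _ P1)) as [e1 E1]. destruct (C2 t x (mkposreal _ P2)) as [e2 E2]. cbn [pos] in *.
  assert (Hm : 0 < Rmin e1 e2) by (apply Rmin_pos; apply cond_pos).
  exists (mkposreal _ Hm). intros t' x' Ht Hx. cbn [pos] in *.
  pose proof (Rmin_l e1 e2). pose proof (Rmin_r e1 e2).
  specialize (E1 t' x' ltac:(lra) ltac:(lra)). specialize (E2 t' x' ltac:(lra) ltac:(lra)).
  apply Rabs_def2 in E1. apply Rabs_def2 in E2. unfold between. lra.
Qed.

(** u is only controlled between s0 and s; clip replaces it by a globally continuous
    function that agrees with it at height at least r / 2 from the two curves, hence near
    the support of a given test function. *)
Section Clip.
Variable r : R.
Hypothesis Hr : 0 < r.

Definition clip (t x : R) : R :=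
  Rmax (s0 x + Rmin (r / 2) ((s x - s0 x) / 3)) (Rmin t (s x - Rmin (r / 2) ((s x - s0 x) / 3))).

Lemma clip_between t x : between (clip t x) x.
Proof.
  unfold clip, between. pose proof (s0_lt x). set (m := Rmin (r / 2) ((s x - s0 x) / 3)).
  assert (0 < m) by (apply Rmin_pos; lra). assert (m <= (s x - s0 x) / 3) by apply Rmin_r.
  unfold Rmax, Rmin. repeat destruct Rle_dec; lra.
Qed.

Lemma clip_id t x : s0 x + r / 2 <= t <= s x - r / 2 -> clip t x = t.
Proof.
  intros H. unfold clip. set (m := Rmin (r / 2) ((s x - s0 x) / 3)). assert (m <= r / 2) by apply Rmin_l.
  unfold Rmax, Rmin. repeat destruct Rle_dec; lra.
Qed.

Lemma clip_cont : cont2 clip.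
Proof.
  assert (C0 : cont2 (fun _ x => s0 x)) by now apply cont2_of_x. assert (C1 : cont2 (fun _ x => s x)) by now apply cont2_of_x.
  assert (Cm : cont2 (fun _ x => Rmin (r / 2) ((s x - s0 x) / 3))).
  { apply (cont2_min (fun _ _ => r / 2) (fun _ x => (s x - s0 x) / 3)); [intros t x; apply continuity_2d_pt_const|].
    apply (cont2_ext (fun _ x => / 3 * (s x - s0 x))); [intros; field|]. now apply cont2_scal, cont2_minus. }
  apply cont2_max; [now apply cont2_plus|]. apply cont2_min; [apply cont2_fst|now apply cont2_minus].
Qed.

Definition clipped (t x : R) : R := u (clip t x) x.

Lemma clipped_cont : cont2 clipped.
Proof.
  intros t x. apply (cont2_comp u clip (fun _ x => x)); [apply u_cont, between_U, clip_between|apply clip_cont|apply continuity_2d_pt_id2].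
Qed.

Lemma clipped_pos t x : 0 < clipped t x.
Proof. apply u_pos, between_U, clip_between. Qed.

Lemma clipped_nonlinear_cont : cont2 (fun t x => nonlinearity p (clipped t x)).
Proof.
  intros t x. apply (continuity_1d_2d_pt_comp (nonlinearity p) clipped); [apply nonlinearity_cont, clipped_pos|apply clipped_cont].
Qed.

End Clip.

(** Divide cross by h^2 and integrate against phi.  As cross is symmetric, the
    integral of w cross(phi) - phi cross(w) vanishes for small h, whereas its
    integrand is uniformly close to that of the weak equation: by
    Taylor expansion for the smooth phi, and by the hypothesis on cross for w. *)
Theorem distributional_of_cross : distributional_solution p (open_region s0 s) u.
Proof.
  intros phi M [Hreg [K [HKc [[L HKb] [HKO HK0]]]]] HM.
  set (pt := fun t x => Derive (fun z => phi z x) t). set (ptt := fun t x => Derive (fun z => pt z x) t).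
  set (px := fun t x => Derive (fun z => phi t z) x). set (pxx := fun t x => Derive (fun z => px t z) x).
  assert (Dpt : forall t x, is_derive (fun y => phi y x) t (pt t x)).
  { intros t x. apply Derive_correct. apply (Hreg 1%nat t x). }
  assert (Dpx : forall t x, is_derive (fun y => phi t y) x (px t x)).
  { intros t x. apply Derive_correct. apply (Hreg 1%nat t x). }
  assert (Dptt : forall t x, is_derive (fun y => pt y x) t (ptt t x)).
  { intros t x. apply Derive_correct. destruct (Hreg 2%nat t x) as [_ [_ [_ [[_ [H _]] _]]]]. exact H. }
  assert (Dpxx : forall t x, is_derive (fun y => px t y) x (pxx t x)).
  { intros t x. apply Derive_correct. destruct (Hreg 2%nat t x) as [_ [_ [_ [_ [_ [_ [H _]]]]]]]. exact H. }
  assert (Cphi : cont2 phi) by (intros t x; apply (Hreg 0%nat t x)).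
  assert (Cptt : cont2 ptt).
  { intros t x. destruct (Hreg 2%nat t x) as [_ [_ [_ [[_ [_ [_ [[H _] _]]]] _]]]]. exact H. }
  assert (Cpxx : cont2 pxx).
  { intros t x. destruct (Hreg 2%nat t x) as [_ [_ [_ [_ [_ [_ [_ [_ [H _]]]]]]]]]. exact H. }
  set (box := fun t x => ptt t x - pxx t x).
  assert (Cbox : cont2 box) by now apply cont2_minus.
  assert (Zbox : forall t x e, 0 < e -> (forall t' x', Rabs (t' - t) < e -> Rabs (x' - x) < e -> phi t' x' = 0) -> box t x = 0).
  { intros t x e He H. unfold box, ptt, pxx, pt, px.
    assert (Z : Rabs (t - t) < e /\ Rabs (x - x) < e) by (rewrite !Rminus_eq_0, !Rabs_R0; easy).
    change (fun z => Derive (fun z0 => phi z0 x) z) with (Derive (fun z0 => phi z0 x)).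
    change (fun z => Derive (fun z0 => phi t z0) z) with (Derive (fun z0 => phi t z0)).
    rewrite (second_derivative_locally_zero (fun z0 => phi z0 x) t e He), (second_derivative_locally_zero (fun z0 => phi t z0) x e He).
    - ring.
    - intros y Hy. now apply H.
    - intros y Hy. now apply H. }
  assert (Sphi : supported M phi).
  { intros t x Htx. apply NNPP. intros A. destruct (HM t x A). lra. }
  assert (Sbox : supported M box).
  { intros t x [Ht|Hx].
    - apply (Zbox t x (Rabs t - M)); [lra|]. intros t' x' Ht' _. apply Sphi. left.
      pose proof (Rabs_triang_inv t (t - t')). replace (t - (t - t')) with t' in * by ring. rewrite (Rabs_minus_sym t t') in *. lra.
    - apply (Zbox t x (Rabs x - M)); [lra|]. intros t' x' _ Hx'. apply Sphi. right.
      pose proof (Rabs_triang_inv x (x - x')). replace (x - (x - x')) with x' in * by ring. rewrite (Rabs_minus_sym x x') in *. lra. }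
  assert (Kbox : forall t x, ~ K (t, x) -> box t x = 0).
  { intros t x H. assert (Hl : locally (t, x) (fun z => ~ K z)) by (apply NNPP; intros A; apply H; now apply HKc).
    destruct Hl as [e He]. apply (Zbox t x e (cond_pos e)). intros t' x' Ht Hx. apply HK0. apply He. split; [exact Ht|exact Hx]. }
  destruct (compact_margin K between L HKc HKb between_open (fun t x H => HKO (t, x) H)) as [r [Hr HrO]].
  set (w := clipped r).
  assert (Cw : cont2 w) by now apply clipped_cont.
  assert (Hw : forall t x t' x', K (t, x) -> Rabs (t' - t) < r / 2 -> Rabs (x' - x) < r / 2 -> w t' x' = u t' x').
  { intros t x t' x' HK Ht Hx. unfold w, clipped. rewrite clip_id; [easy|].
    pose proof (HrO t x t' x' HK ltac:(lra) ltac:(lra)) as [H1 H2]. split; apply Rnot_lt_le; intros A.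
    - destruct (HrO t x (s0 x') x' HK) as [B _]; [|lra|lra].
      apply Rabs_def2 in Ht. apply Rabs_def1; lra.
    - destruct (HrO t x (s x') x' HK) as [_ B]; [|lra|lra].
      apply Rabs_def2 in Ht. apply Rabs_def1; lra. }
  set (E := fun t x => w t x * box t x - nonlinearity p (w t x) * phi t x).
  assert (CE : cont2 E).
  { apply cont2_minus; [now apply cont2_mult|]. apply cont2_mult; [now apply clipped_nonlinear_cont|easy]. }
  assert (SE : supported M E).
  { intros t x H. unfold E. rewrite (Sphi t x H), (Sbox t x H). ring. }
  assert (EE : forall t x, u t x * (partial_derive 2 0 phi t x - partial_derive 0 2 phi t x)
      - nonlinearity p (u t x) * phi t x = E t x).
  { intros t x. change (partial_derive 2 0 phi t x - partial_derive 0 2 phi t x) with (box t x). unfold E.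
    destruct (classic (K (t, x))) as [H|H].
    - rewrite (Hw t x t x H); [easy| |]; rewrite Rminus_eq_0, Rabs_R0; lra.
    - rewrite (Kbox t x H), (HK0 t x H). ring. }
  assert (EF : (fun x => RInt (fun t => u t x * (partial_derive 2 0 phi t x - partial_derive 0 2 phi t x)
      - nonlinearity p (u t x) * phi t x) (- M) M) = (fun x => RInt (fun t => E t x) (- M) M)).
  { apply functional_extensionality. intros x. apply RInt_ext_R. intros t _. apply EE. }
  rewrite EF. clear EF EE.
  assert (Main : square_int M E = 0); [|rewrite <- Main; apply RInt_correct_R; now apply outer_ex].
  destruct (Rlt_dec M 0) as [HMn|HMp].
  { unfold square_int. rewrite (RInt_ext_R _ (fun _ => 0)); [apply RInt_zero|]. intros x _.
    rewrite (RInt_ext_R _ (fun _ => 0)); [apply RInt_zero|]. intros t _. apply SE. left. pose proof (Rabs_pos t). lra. }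
  (* a larger square, so that translates of phi by h <= 1 remain supported in it *)
  set (N := M + 1). rewrite <- (square_int_support M N E) by (try easy; unfold N; lra).
  destruct (cont2_bounded_square w N ltac:(unfold N; lra) Cw) as [Bw [HBw0 HBw]].
  destruct (cont2_bounded_square phi N ltac:(unfold N; lra) Cphi) as [Bp [HBp0 HBp]].
  (* C e bounds the integral: area times the two pointwise errors *)
  set (C := (2 * N) ^ 2 * (Bw * 4 + Bp)).
  assert (HC : 0 <= C) by (unfold C; apply Rmult_le_pos; [apply pow2_ge_0|lra]).
  apply cond_eq. intros e0 He0. rewrite Rminus_0_r.
  set (e := e0 / (C + 1)). assert (He : 0 < e) by (apply Rdiv_lt_0_compat; lra).
  apply Rle_lt_trans with (C * e).
  2:{ apply Rlt_le_trans with ((C + 1) * e); [lra|]. unfold e. right. field. lra. }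
  destruct (uniform_cont2 ptt (N + 1) e Cptt He) as [d1 [Hd1 U1]].
  destruct (uniform_cont2 pxx (N + 1) e Cpxx He) as [d2 [Hd2 U2]].
  destruct (uniform_cont2 _ (N + 1) e (clipped_nonlinear_cont r Hr) He) as [d3 [Hd3 U3]]. fold w in U3.
  set (m := Rmin (Rmin d1 d2) (Rmin d3 (Rmin (r / 2) 1))).
  assert (Hm : 0 < m) by (unfold m; repeat apply Rmin_pos; lra).
  assert (Hm' : m <= d1 /\ m <= d2 /\ m <= d3 /\ m <= r / 2 /\ m <= 1).
  { unfold m. pose proof (Rmin_l (Rmin d1 d2) (Rmin d3 (Rmin (r / 2) 1))). pose proof (Rmin_r (Rmin d1 d2) (Rmin d3 (Rmin (r / 2) 1))).
    pose proof (Rmin_l d1 d2). pose proof (Rmin_r d1 d2). pose proof (Rmin_l d3 (Rmin (r / 2) 1)). pose proof (Rmin_r d3 (Rmin (r / 2) 1)).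
    pose proof (Rmin_l (r / 2) 1). pose proof (Rmin_r (r / 2) 1). lra. }
  set (h := m / 2). assert (Hh : 0 < h) by (unfold h; lra). assert (Hhm : h < m) by (unfold h; lra).
  assert (Hh2 : 0 < h ^ 2) by now apply pow_lt.
  set (phi' := fun t x => / h ^ 2 * phi t x).
  set (D := fun t x => w t x * cross phi' h t x - phi' t x * cross w h t x).
  assert (Cphi' : cont2 phi') by now apply cont2_scal.
  assert (CD : cont2 D).
  { apply cont2_minus; apply cont2_mult; try easy; now apply cont2_cross. }
  assert (ZD : square_int N D = 0).
  { apply (cross_symmetric M N w phi' h); try easy; [lra|rewrite Rabs_pos_eq; unfold N; lra|].
    intros t x H. unfold phi'. rewrite (Sphi t x H). ring. }
  replace (square_int N E) with (square_int N (fun t x => E t x - D t x)) by (rewrite square_int_minus, ZD by easy; ring).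
  unfold C. rewrite Rmult_assoc. apply square_int_bound; [unfold N; lra| |now apply cont2_minus|].
  { apply Rmult_le_pos; lra. }
  intros t x Ht Hx.
  assert (Hnear : forall y z, Rabs y <= N -> Rabs (z - y) <= h -> Rabs z <= N + 1).
  { intros y z H1 H2. replace z with (y + (z - y)) by ring. eapply Rle_trans; [apply Rabs_triang|]. lra. }
  assert (Zt : Rabs (t - t) <= h) by (rewrite Rminus_eq_0, Rabs_R0; lra).
  assert (Zx : Rabs (x - x) <= h) by (rewrite Rminus_eq_0, Rabs_R0; lra).
  assert (A : Rabs (cross phi h t x - h ^ 2 * box t x) <= 4 * e * h ^ 2).
  { apply (cross_limit phi pt ptt px pxx); try easy.
    - intros z Hz. apply U1; try lra; [now apply (Hnear t)].
    - intros z Hz. apply U2; try lra; [now apply (Hnear x)]. }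
  assert (Ecross : cross phi' h t x = / h ^ 2 * cross phi h t x) by (unfold cross, phi'; ring).
  assert (A1 : Rabs (w t x * (box t x - cross phi' h t x)) <= Bw * (4 * e)).
  { rewrite Rabs_mult. apply Rmult_le_compat; try apply Rabs_pos; [now apply HBw|].
    rewrite Ecross. replace (box t x - / h ^ 2 * cross phi h t x) with (- (/ h ^ 2 * (cross phi h t x - h ^ 2 * box t x))) by (field; lra).
    rewrite Rabs_Ropp, Rabs_mult, (Rabs_pos_eq (/ h ^ 2)) by (left; now apply Rinv_0_lt_compat).
    apply Rmult_le_reg_l with (h ^ 2); [easy|]. rewrite <- Rmult_assoc, Rinv_r, Rmult_1_l by lra. lra. }
  assert (A2 : Rabs (phi t x * (nonlinearity p (w t x) - / h ^ 2 * cross w h t x)) <= Bp * e).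
  { rewrite Rabs_mult. destruct (classic (K (t, x))) as [HK|HK].
    - apply Rmult_le_compat; try apply Rabs_pos; [now apply HBp|].
      destruct (u_cross t x h Hh) as [t' [x' [Ht' [Hx' EX]]]].
      { intros t' x' Ht' Hx'. apply between_U. apply (HrO t x); [easy|lra|lra]. }
      assert (EW : cross w h t x = cross u h t x).
      { assert (H1 : Rabs (t + h - t) < r / 2) by (apply Rabs_def1; lra). assert (H2 : Rabs (t - h - t) < r / 2) by (apply Rabs_def1; lra).
        assert (H3 : Rabs (x + h - x) < r / 2) by (apply Rabs_def1; lra). assert (H4 : Rabs (x - h - x) < r / 2) by (apply Rabs_def1; lra).
        unfold cross. rewrite !(Hw t x) by (try easy; lra). easy. }
      rewrite EW, EX, <- (Hw t x t' x' HK) by lra.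
      replace (/ h ^ 2 * (h ^ 2 * nonlinearity p (w t' x'))) with (nonlinearity p (w t' x')) by (field; lra).
      rewrite Rabs_minus_sym. apply U3; try lra; [now apply (Hnear t)|now apply (Hnear x)].
    - rewrite (HK0 t x HK), Rabs_R0, Rmult_0_l. apply Rmult_le_pos; lra. }
  replace (E t x - D t x) with (w t x * (box t x - cross phi' h t x) - phi t x * (nonlinearity p (w t x) - / h ^ 2 * cross w h t x))
    by (unfold E, D, phi'; ring).
  unfold Rminus at 1. eapply Rle_trans; [apply Rabs_triang|]. rewrite Rabs_Ropp. lra.
Qed.

End Distributional.

(** * The blow-up surface *)

Lemma slope_bound (sigma : R -> R) : Rbar_lt (sup_abs_derivative sigma) 1 ->
  exists kappa, 0 <= kappa < 1 /\ forall x, Rabs (Derive sigma x) <= kappa.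
Proof.
  unfold sup_abs_derivative. intros H.
  destruct (Lub_Rbar_correct (fun q => exists x, q = Rabs (Derive sigma x))) as [Hub _].
  destruct (Lub_Rbar (fun q => exists x, q = Rabs (Derive sigma x))) as [r| |]; [|easy|].
  - exists r. assert (Hb : forall x, Rabs (Derive sigma x) <= r) by (intros x; apply (Hub (Rabs (Derive sigma x))); now exists x).
    split; [|easy]. split; [|easy]. apply Rle_trans with (2 := Hb 0). apply Rabs_pos.
  - exfalso. apply (Hub (Rabs (Derive sigma 0))). now exists 0.
Qed.

(** The exponents j gam - 2 / p must avoid 2 / p + 2.  With gam = 1 this holds
    when 4 / p is not an integer, and then N + 2 is the least natural number greater
    than 3 + 4 / p, so that k - (N + 2) is exactly the floor of k - 3 - 4 / p.  For
    k infinite derivatives are free, and gam is adjusted to put 2 + 4 / p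
    half-way between N gam and (N + 1) gam. *)
Lemma gain_exponent (p : R) (k : option nat) :
  (0 < p /\ k = None) \/ (0 < p /\ (forall n : nat, 4 / p <> INR n) /\ lt_ext (3 + 4 / p) k) ->
  exists gam N, 0 < gam <= 1 /\ INR N * gam < 2 * (2 / p) + 2 /\ 2 * (2 / p) + 2 < INR (S N) * gam /\
    forall M, le_ext M (regularity_exponent p k) -> le_ext (S (S (N + M))) k.
Proof.
  intros H. assert (Hp : 0 < p) by (destruct H as [[H _]|[H _]]; exact H).
  assert (Ha : 2 * (2 / p) + 2 = 2 + 4 / p) by (field; lra). rewrite Ha.
  assert (H4 : 0 < 4 / p) by (apply Rdiv_lt_0_compat; lra).
  destruct k as [k|].
  - destruct H as [[_ H]|[_ [Hn Hk]]]; [discriminate|]. simpl in Hk.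
    destruct (base_Int_part (4 / p)) as [B1 B2].
    assert (Z0 : (0 <= Int_part (4 / p))%Z).
    { apply Z.lt_succ_r. apply lt_IZR. rewrite succ_IZR. lra. }
    set (i := Z.to_nat (Int_part (4 / p))).
    assert (Ei : IZR (Int_part (4 / p)) = INR i) by (unfold i; rewrite INR_IZR_INZ, Z2Nat.id by easy; easy).
    rewrite Ei in B1, B2.
    assert (B3 : INR i < 4 / p) by (specialize (Hn i); lra).
    exists 1, (S (S i)). rewrite !S_INR. split; [lra|]. split; [lra|]. split; [lra|].
    intros M HM. simpl in HM |- *.
    destruct (base_Int_part (INR k - 3 - 4 / p)) as [C1 C2].
    assert (HM' : INR M <= INR k - 3 - 4 / p).
    { apply Rle_trans with (2 := C1). rewrite INR_IZR_INZ. apply IZR_le.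
      assert (0 <= Int_part (INR k - 3 - 4 / p))%Z by (apply Z.lt_succ_r; apply lt_IZR; rewrite succ_IZR; lra).
      lia. }
    assert (HI : INR (M + i + 3) < INR k) by (rewrite !plus_INR; simpl; lra).
    apply INR_lt in HI. lia.
  - set (N := Z.to_nat (up (2 + 4 / p))). destruct (archimed (2 + 4 / p)) as [A1 A2].
    assert (EN : IZR (up (2 + 4 / p)) = INR N).
    { unfold N. rewrite INR_IZR_INZ, Z2Nat.id; [easy|]. apply le_IZR. lra. }
    rewrite EN in A1. exists ((2 + 4 / p) / (INR N + / 2)), N. rewrite S_INR.
    assert (HN : 0 < INR N + / 2) by lra.
    assert (HG : 0 < (2 + 4 / p) / (INR N + / 2)) by (apply Rdiv_lt_0_compat; lra).
    assert (EG : (INR N + / 2) * ((2 + 4 / p) / (INR N + / 2)) = 2 + 4 / p) by (field; lra).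
    set (g := (2 + 4 / p) / (INR N + / 2)) in *.
    split; [split; [easy|]|split; [nra|split; [nra|easy]]].
    unfold g. apply Rle_div_l; lra.
Qed.

Lemma le_ext_mono n n' k : (n <= n')%nat -> le_ext n' k -> le_ext n k.
Proof. destruct k; simpl; [lia|easy]. Qed.

Theorem theorem1p1 (p : R) (k : option nat) (sigma : R -> R)
  (hpk : (0 < p /\ k = None) \/
         (0 < p /\ (forall n : nat, 4 / p <> INR n) /\ lt_ext (3 + 4 / p) k))
  (hsigma : is_C k sigma)
  (hspace : Rbar_lt (sup_abs_derivative sigma) 1) :
  let m := regularity_exponent p k in
  exists (sigma0 : R -> R) (u : R -> R -> R),
    space_like sigma0 /\
    (forall x, sigma0 x < sigma x) /\
    is_C_on m (region sigma0 sigma) u /\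
    is_solution p m sigma0 sigma u /\
    blows_up_on p sigma u.
Proof.
  intros m.
  assert (Hp : 0 < p) by (destruct hpk as [[H _]|[H _]]; exact H).
  destruct (gain_exponent p k hpk) as [gam [N [Hgam [HN1 [HN2 Hreg]]]]]. fold m in Hreg.
  destruct (slope_bound sigma hspace) as [kappa [Hkappa Bsigma']].
  assert (H0 : le_ext 0 m) by (destruct m; simpl; [lia|easy]).
  assert (Sreg : forall M, le_ext (S M) k -> smooth1 (S M) sigma).
  { intros M HM. apply smooth1_of_derivs. intros n x Hn. apply hsigma. now apply (le_ext_mono n (S M)). }
  assert (Dsigma : forall x, is_derive sigma x (Derive sigma x)).
  { intros x. apply Derive_correct. apply (hsigma 1%nat x). apply (le_ext_mono _ (S (S (N + 0)))); [lia|]. now apply Hreg. }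
  assert (S'reg : forall M, le_ext (S M) k -> smooth1 M (Derive sigma)).
  { intros M HM. apply (smooth1_deriv M sigma); [now apply Sreg|easy]. }
  assert (Csigma' : forall x, continuity_pt (Derive sigma) x).
  { assert (H : smooth1 0 (Derive sigma)).
    { apply S'reg. apply (le_ext_mono _ (S (S (N + 0)))); [lia|]. now apply Hreg. }
    apply H. }
  set (W := amplitude sigma (Derive sigma) kappa Hkappa Dsigma Bsigma' p).
  assert (HW : forall M, le_ext M m -> smooth1 (S (N + M)) W).
  { intros M HM. apply amplitude_smooth; [easy|]. apply S'reg. now apply Hreg. }
  destruct (layer_solution (2 / p) (p + 1) gam N W) as [rho [v [vd [rho_pos [_ [rho_lip Hsol]]]]]]; try easy.
  { apply Rdiv_lt_0_compat; lra. }
  { field. lra. }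
  { intros b. apply exp_pos. }
  { specialize (HW 0%nat H0). now rewrite Nat.add_0_r in HW. }
  destruct (initial_surface sigma (Derive sigma) kappa Hkappa Dsigma Csigma' Bsigma' rho rho_pos rho_lip)
    as [sigma0 [Hs0 [Hlt [Cs0 Hin]]]].
  set (u := wave sigma (Derive sigma) kappa Hkappa Dsigma Bsigma' v).
  set (U := near_surface sigma (Derive sigma) kappa Hkappa Dsigma Bsigma' rho) in *.
  assert (HU : open2 U) by (apply near_surface_open; easy).
  assert (Hjet : forall M, le_ext M m -> jet U M 1 0 (cs u)).
  { intros M HM. apply (wave_jet sigma (Derive sigma) kappa Hkappa Dsigma Csigma' Bsigma' p gam N rho v vd); try easy.
    - apply S'reg. apply (le_ext_mono _ (S (S (N + M)))); [lia|]. now apply Hreg.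
    - now apply HW. }
  assert (Hex : forall M t x, le_ext M m -> U t x -> ex_diff_n u M t x).
  { intros M t x HM Htx. exact (jet_ex_diff_n U HU M (cs u) 0%nat (Hjet M HM) t x Htx). }
  assert (u_cont : forall t x, U t x -> continuity_2d_pt u t x).
  { intros t x Htx. apply (Hex 0%nat t x H0 Htx). }
  assert (u_pos : forall t x, U t x -> 0 < u t x).
  { exact (wave_pos sigma (Derive sigma) kappa Hkappa Dsigma Bsigma' p gam N rho v vd Hsol). }
  assert (u_cross : forall t x h, 0 < h ->
    (forall t' x', Rabs (t' - t) <= h -> Rabs (x' - x) <= h -> U t' x') ->
    exists t' x', Rabs (t' - t) <= h /\ Rabs (x' - x) <= h /\ cross u h t x = h ^ 2 * nonlinearity p (u t' x')).
  { exact (cross_wave sigma (Derive sigma) kappa Hkappa Dsigma Csigma' Bsigma' p gam N rho v vd Hp Hsol). }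
  exists sigma0, u. split; [exact Hs0|]. split; [exact Hlt|]. split; [|split].
  - exists (fun z => U (fst z) (snd z)). split; [|split].
    + intros [t x] H. destruct (HU t x H) as [e He]. exists e. intros [t' x'] [Ht Hx]. apply He; [exact Ht|exact Hx].
    + intros [t x] H. apply Hin. exact H.
    + intros n t x Hn Htx. now apply Hex.
  - assert (Hdist : distributional_solution p (open_region sigma0 sigma) u).
    { apply (distributional_of_cross p U u sigma0 sigma); try easy.
      - intros x. apply continuity_pt_filterlim, (ex_derive_continuous sigma). now exists (Derive sigma x).
      - intros t x [H1 H2]. apply Hin. lra. }
    assert (Hclass : le_ext 2 m -> classical_solution p (region sigma0 sigma) u).
    { intros H2. apply (classical_of_cross p U u HU u_cont u_pos u_cross); [|now apply Hjet].
      intros t x H. apply Hin. exact H. }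
    unfold is_solution. destruct m as [[|[|m']]|]; try easy; apply Hclass; simpl; [lia|easy].
  - apply (wave_blows_up sigma (Derive sigma) kappa Hkappa Dsigma Csigma' Bsigma' p gam N rho v vd); easy.
Qed.
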